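(* Suppose that the regularity conditions listed in the context are satisfied. Let $W=[\partial^2\ell(\phi,F_0)/\partial\phi\,\partial\phi^T]_{\phi=\phi_0}$, let $W^\dagger$ be its Moore–Penrose inverse, $P_W$ the orthogonal projection onto its column space, and $g^*(X,Y,\phi_0,F_0)$ the influence function at $F_0$ of the mapping $F\mapsto g(\phi_0,F)=[\partial\ell(\phi,F)/\partial\phi]_{\phi=\phi_0}$. Then $$\sqrt n\,P_W(\hat\phi-\phi_0)\xrightarrow{\mathcal{D}}N(0,\Lambda(\phi_0,F_0)),$$ where $$\Lambda(\phi_0,F_0)=W^\dagger E\{g^*(X,Y,\phi_0,F_0)[g^*(X,Y,\phi_0,F_0)]^T\}W^\dagger.$$
   Context: Data and notation. $(X_1,Y_1),\dots,(X_n,Y_n)$ are i.i.d. copies of $(X,Y)\sim F_0$, with $X$ a $p$-dimensional random vector and $Y$ a real random variable with sample space $\Omega_Y\subseteq\mathbb{R}$; $F_n$ is the empirical distribution; $E_nr(X,Y)=n^{-1}\sum_{i=1}^nr(X_i,Y_i)$; $E_F$ is expectation under $F$ and $E=E_{F_0}$. $\mathcal{F}$ is a convex class of distributions of $(X,Y)$ containing $F_0$ and the empirical distributions; moments and matrix inverses below are assumed to exist wherever used (for $F_n$, with probability tending to one). Basis functions. $H(y)=(h_1(y),\dots,h_s(y))^T$, where $h_1,\dots,h_s$ are monomials of $y$, one of them the constant $1$. $G(u)=(f_1(u),\dots,f_k(u))^T$, $u\in\mathbb{R}^d$, where $f_1,\dots,f_k$ are monomials in the components of $u$, one of them the constant $1$.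 Parameterization. Let $m=pd-d(d+1)/2$ and $\Omega_\phi=[0,\pi]^m$. Order the pairs $(i,j)$, $1\le i\le d$, $i<j\le p$, lexicographically ($j$ changing first), $t(i,j)=p(i-1)-(i-1)i/2+(j-i)$, and let $(i(t),j(t))$ be the $t$th pair. $D_t(\phi_t)$ is the $p\times p$ identity matrix with its $(i(t),j(t))\times(i(t),j(t))$ submatrix replaced by $\begin{pmatrix}\cos\phi_t&-\sin\phi_t\\ \sin\phi_t&\cos\phi_t\end{pmatrix}$. For $\phi=(\phi_1,\dots,\phi_m)^T$, $\eta(\phi)$ is the $p\times d$ matrix of the first $d$ columns of $D_1(\phi_1)D_2(\phi_2)\cdots D_m(\phi_m)$. Objective function. Let $R_1(F)=E_F[XH^T(Y)]$, $R_2(\phi,F)=E_F[XG^T(\eta^T(\phi)X)]$, $R_3(\phi,F)=E_F[G(\eta^T(\phi)X)G^T(\eta^T(\phi)X)]$, $R_4(\phi,F)=E_F[G(\eta^T(\phi)X)H^T(Y)]$, $R_5(F)=E_F[H(Y)H^T(Y)]$, $R(\phi,F)=R_1(F)-R_2(\phi,F)R_3^{-1}(\phi,F)R_4(\phi,F)$, and $$\ell(\phi,F)=\mathrm{tr}[R(\phi,F)R_5^{-1}(F)R^T(\phi,F)].$$ For $F\in\mathcal{F}$, $\phi(F)\in\Omega_\phi$ denotes the minimizer of $\ell(\cdot,F)$ over $\Omega_\phi$, satisfying the first-order condition $[\partial\ell(\phi,F)/\partial\phi]_{\phi=\phi(F)}=0$; $\phi_0=\phi(F_0)$, $\hat\phi=\phi(F_n)$.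 Model assumption. Let $\rho(y,\tilde y)=H^T(y)\{E[H(Y)H^T(Y)]\}^{-1}H(\tilde y)$ and let $\tilde Y$ have the distribution of $Y$ and be independent of $(X,Y)$. A solution space is $\mathrm{span}(\beta)$ for a $p$-row matrix $\beta$ satisfying $E[X\rho(Y,\tilde Y)|\tilde Y]=E[E(X|\beta^TX)\rho(Y,\tilde Y)|\tilde Y]$ a.s.; the central solution space is the intersection of all solution spaces, assumed to be itself a solution space. It has dimension $d$, the columns of $\beta=\eta(\phi_0)$ form a basis of it, and each component of $E(X|\beta^TX)$ is a linear combination of $f_1(\beta^TX),\dots,f_k(\beta^TX)$. Influence functions. For a functional $A$ on $\mathcal{F}$ that is Fréchet differentiable at $F_0$ with respect to the sup norm $\|\cdot\|_\infty$, its derivative is represented by a random element $A^*(X,Y,F_0)$ (the influence function) with entries in $L_2(F_0)$, $E\,A^*(X,Y,F_0)=0$ and $[\frac{d}{d\alpha}A((1-\alpha)F_0+\alpha F)]_{\alpha=0}=E_FA^*(X,Y,F_0)$ for $F\in\mathcal{F}$. Regularity conditions. The functionals $F\mapsto\phi(F)$, $F\mapsto g(\phi_0,F)$ and $F\mapsto g(\phi(F),F)$, where $g(\phi,F)=\partial\ell(\phi,F)/\partial\phi$, are Fréchet differentiable at $F_0$ with respect to the sup norm $\|\cdot\|_\infty$, each with derivative represented by an influence function that has entries in $L_2(F_0)$, has mean zero under $F_0$, and whose expectation under any $F\in\mathcal{F}$ equals the derivative at $\alpha=0$ of the functional along $(1-\alpha)F_0+\alpha F$, and $\phi(\cdot)$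 is asymptotically linear: $\phi(F_n)=\phi(F_0)+E_n\phi^*(X,Y,F_0)+o_p(n^{-1/2})$. *)

(* Defs.v *)
From HB Require Import structures.
From mathcomp Require Import all_boot all_order all_algebra.
From mathcomp Require Import interval_inference zify.
From mathcomp Require Import all_classical all_reals all_analysis.

Set Implicit Arguments.
Unset Strict Implicit.
Unset Printing Implicit Defensive.

Import Order.TTheory GRing.Theory Num.Theory.
Import numFieldNormedType.Exports.

Local Open Scope classical_set_scope.
Local Open Scope ring_scope.

Section linear_algebra.
Context {R : realType}.

Definition is_mpinv m n (A : 'M[R]_(m, n)) (B : 'M[R]_(n, m)) : Prop :=
  [/\ A *m B *m A = A, B *m A *m B = B,
      (A *m B)^T = A *m B & (B *m A)^T = B *m A].

(* The choice is legitimate by [mpinvP] and unique by [is_mpinv_uniq]. *)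
Definition mpinv m n (A : 'M[R]_(m, n)) : 'M[R]_(n, m) :=
  xget 0 [set B : 'M[R]_(n, m) | is_mpinv A B]%classic.

(* [Q v] lies in the column space of [A] and [v - Q v] is orthogonal to it. *)
Definition is_orthproj m n (A : 'M[R]_(m, n)) (Q : 'M[R]_m) : Prop :=
  forall v : 'cV[R]_m,
    (exists c : 'cV[R]_n, Q *m v = A *m c) /\ A^T *m (v - Q *m v) = 0.

Definition orthproj m n (A : 'M[R]_(m, n)) : 'M[R]_m :=
  xget 0 [set Q | is_orthproj A Q]%classic.

Lemma mulmx_tr_eq0 m n (A : 'M[R]_(m, n)) : A^T *m A = 0 -> A = 0.
Proof.
move=> h; apply/matrixP => i j; rewrite !mxE; apply/eqP.
have := congr1 (fun M : 'M[R]_n => M j j) h; rewrite !mxE.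
under eq_bigr do rewrite mxE -expr2.
move/eqP; rewrite psumr_eq0 => [|l _]; last exact: sqr_ge0.
by move/allP => /(_ i (mem_index_enum i)) /=; rewrite sqrf_eq0.
Qed.

Lemma is_mpinv_uniq m n (A : 'M[R]_(m, n)) B C :
  is_mpinv A B -> is_mpinv A C -> B = C.
Proof.
case=> [b1 b2 b3 b4] [c1 c2 c3 c4].
have AB : A *m B = A *m C.
  rewrite -{1}c1 -mulmxA -[A *m C in LHS]c3 -[A *m B in LHS]b3 -trmx_mul.
  by rewrite mulmxA b1 c3.
have BA : B *m A = C *m A.
  rewrite -{1}c1 -(mulmxA A) mulmxA -[C *m A in LHS]c4 -[B *m A in LHS]b4.
  by rewrite -trmx_mul -(mulmxA C) (mulmxA A) b1 c4.
by rewrite -b2 BA -mulmxA AB mulmxA c2.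
Qed.

Lemma gram_unit m n (A : 'M[R]_(m, n)) : row_free A -> A *m A^T \in unitmx.
Proof.
move=> fA; rewrite -row_free_unit -kermx_eq0; apply/eqP.
set K := kermx _.
have KA : K *m (A *m A^T) = 0 by exact: mulmx_ker.
have : (K *m A)^T = 0.
  apply: mulmx_tr_eq0.
  by rewrite trmxK trmx_mul !mulmxA -(mulmxA K) KA mul0mx.
move/(congr1 trmx); rewrite trmxK trmx0 => KA0.
apply: (row_free_inj fA); by rewrite KA0 mul0mx.
Qed.

Lemma is_mpinv_factor m n r (C : 'M[R]_(m, r)) (D : 'M[R]_(r, n)) :
    row_free C^T -> row_free D ->
  is_mpinv (C *m D)
    (D^T *m invmx (D *m D^T) *m invmx (C^T *m C) *m C^T).
Proof.
move=> fC fD; set S := invmx (D *m D^T); set U := invmx (C^T *m C).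
have DS : D *m D^T *m S = 1%:M by apply: mulmxV; exact: gram_unit.
have US : U *m (C^T *m C) = 1%:M.
  by apply: mulVmx; rewrite -{2}[C]trmxK; exact: gram_unit.
have St : S^T = S by rewrite /S trmx_inv trmx_mul trmxK.
have Ut : U^T = U by rewrite /U trmx_inv trmx_mul trmxK.
set B := _ *m C^T.
have AB : C *m D *m B = C *m U *m C^T.
  by rewrite /B !mulmxA -(mulmxA C D) -(mulmxA C) DS mulmx1.
have BA : B *m (C *m D) = D^T *m S *m D.
  by rewrite /B !mulmxA -(mulmxA _ C^T C) -(mulmxA _ U) US mulmx1.
split.
- by rewrite AB !mulmxA -(mulmxA _ C^T C) -(mulmxA _ U) US mulmx1.
- rewrite BA /B !mulmxA -(mulmxA _ D D^T) -(mulmxA (D^T *m S)).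
  by rewrite DS mulmx1.
- by rewrite AB !trmx_mul trmxK Ut mulmxA.
- by rewrite BA !trmx_mul trmxK St mulmxA.
Qed.

Lemma mpinv_ex m n (A : 'M[R]_(m, n)) : exists B, is_mpinv A B.
Proof.
have := @is_mpinv_factor _ _ _ (col_base A) (row_base A).
rewrite mulmx_base => H; eexists; apply: H; last exact: row_base_free.
by rewrite /row_free mxrank_tr; exact: col_base_full.
Qed.

Lemma mpinvP m n (A : 'M[R]_(m, n)) : is_mpinv A (mpinv A).
Proof. by rewrite /mpinv; case: xgetP => [//|nex]; have [B /nex] := mpinv_ex A. Qed.

Lemma orthprojP m n (A : 'M[R]_(m, n)) : is_orthproj A (orthproj A).
Proof.
rewrite /orthproj; case: xgetP => [//|nex]; exfalso; apply: (nex (A *m mpinv A)).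
have [h1 _ h3 _] := mpinvP A => v; split; first by exists (mpinv A *m v); rewrite mulmxA.
by rewrite mulmxBr mulmxA -h3 -trmx_mul h1 subrr.
Qed.

Lemma is_orthproj_uniq m n (A : 'M[R]_(m, n)) Q1 Q2 :
  is_orthproj A Q1 -> is_orthproj A Q2 -> Q1 = Q2.
Proof.
move=> h1 h2; apply/eqP; rewrite -subr_eq0; apply/eqP; set D := Q1 - Q2.
suff Dv (v : 'cV[R]_m) : D *m v = 0.
  apply/matrixP => i j; have := congr1 (fun v : 'cV[R]_m => v i ord0) (Dv (delta_mx j ord0)).
  by rewrite -colE !mxE.
have [[c1 e1] o1] := h1 v; have [[c2 e2] o2] := h2 v.
apply: mulmx_tr_eq0.
have AD : A^T *m (D *m v) = 0.
  rewrite mulmxBl -[_ - _]opprK opprB.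
  have -> : Q2 *m v - Q1 *m v = (v - Q1 *m v) - (v - Q2 *m v).
    by rewrite opprB [RHS]addrC -addrA addKr.
  by rewrite mulmxN mulmxBr o1 o2 subrr oppr0.
have -> : (D *m v)^T = (c1 - c2)^T *m A^T.
  by rewrite -trmx_mul mulmxBl e1 e2 mulmxBr.
by rewrite -mulmxA AD mulmx0.
Qed.

End linear_algebra.

Section probability.
Context {R : realType}.

Definition colv n (x : n.-tuple R) : 'cV[R]_n := \col_i tnth x i.

Definition rowt n (v : 'cV[R]_n) : n.-tuple R := [tuple v i ord0 | i < n].

Definition Emx dT (T : measurableType dT) (F : probability T R) m n
    (M : T -> 'M[R]_(m, n)) : 'M[R]_(m, n) :=
  \matrix_(i, j) fine 'E_F[fun z => M z i j].

Definition Lmx dT (T : measurableType dT) (F : probability T R) (r : \bar R)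
    m n (M : T -> 'M[R]_(m, n)) : Prop :=
  forall i j, (fun z => M z i j) \in Lfun F r.

(* [e (U z)] is a version of the conditional expectation of [V] given [U]. *)
Definition is_condexp dT (T : measurableType dT) dU (TU : measurableType dU)
    (mu : {measure set T -> \bar R}) (V : T -> R) (U : T -> TU) (e : TU -> R) :
    Prop :=
  [/\ measurable_fun setT e,
      mu.-integrable setT (EFin \o V),
      mu.-integrable setT (EFin \o e \o U) &
      forall B, measurable B ->
        (\int[mu]_(z in U @^-1` B) (V z)%:E =
         \int[mu]_(z in U @^-1` B) (e (U z))%:E)%E].

Definition mutually_independent dO (Omega : measurableType dO)
    (P : probability Omega R) dT (T : measurableType dT)
    (Z : nat -> Omega -> T) : Prop :=
  forall n (B : nat -> set T), (forall i, measurable (B i)) ->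
    (P (\bigcap_(i < n) (Z i @^-1` B i)) = \prod_(i < n) P (Z i @^-1` B i))%E.

(* The weight [t] is clamped so that [mixture F G t] is a probability for all
   real [t]; it is [(1 - t) F + t G] when [0 <= t <= 1]. *)
Definition clamp01 (t : R) : R := Num.max 0 (Num.min 1 t).

Lemma clamp01_ge0 t : 0 <= clamp01 t.
Proof. by rewrite /clamp01 le_max lexx. Qed.

Lemma clamp01_le1 t : 0 <= 1 - clamp01 t.
Proof. by rewrite subr_ge0 /clamp01 ge_max ler01 ge_min lexx. Qed.

Lemma clamp01_id t : 0 <= t <= 1 -> clamp01 t = t.
Proof. by case/andP=> t0 t1; rewrite /clamp01 (min_idPr t1) (max_idPr t0). Qed.

Section mixture.
Context dT (T : measurableType dT) (F G : probability T R) (t : R).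

Definition mixture : set T -> \bar R :=
  measure_add (mscale (NngNum (clamp01_le1 t)) F)
              (mscale (NngNum (clamp01_ge0 t)) G).

HB.instance Definition _ := Measure.on mixture.

Let mixture_setT : mixture setT = 1%E.
Proof.
rewrite /mixture measure_addE.
transitivity ((1 - clamp01 t)%:E * F setT + (clamp01 t)%:E * G setT)%E => //.
by rewrite !probability_setT !mule1 -EFinD subrK.
Qed.

HB.instance Definition _ :=
  Measure_isProbability.Build _ _ _ mixture mixture_setT.

End mixture.

(* Empirical distribution of the [n.+1] observations [z 0, ..., z n]. *)
Section empirical.
Context dT (T : measurableType dT) (n : nat) (z : nat -> T).

Definition empirical : set T -> \bar R :=
  mscale (n.+1%:R^-1)%:nng (msum (fun i => \d_(z i)) n.+1).

HB.instance Definition _ := Measure.on empirical.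

Let empirical_setT : empirical setT = 1%E.
Proof.
transitivity ((n.+1%:R^-1)%:E * \sum_(i < n.+1) @dirac _ T (z i) R [set: T])%E => //.
under eq_bigr do rewrite diracT.
by rewrite sumEFin -EFinM sumr_const card_ord mulVf.
Qed.

HB.instance Definition _ :=
  Measure_isProbability.Build _ _ _ empirical empirical_setT.

End empirical.

Definition sample_mean T q (n : nat) (z : nat -> T) (r : T -> 'cV[R]_q) :
    'cV[R]_q :=
  n.+1%:R^-1 *: \sum_(i < n.+1) r (z i).

(* [normal_prob 0 0] is not a Dirac mass, hence the case distinction. *)
Definition normal_var (v : R) : set R -> \bar R :=
  if v == 0 then \d_(0 : R) else normal_prob 0 (Num.sqrt v).

Definition is_normal0 q (N : probability (q.-tuple R) R) (L : 'M[R]_q) : Prop :=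
  forall (c : 'cV[R]_q) (A : set R), measurable A ->
    N [set x | A ((c^T *m colv x) ord0 ord0)] =
    normal_var ((c^T *m L *m c) ord0 ord0) A.

Definition cvg_in_distribution dO (Omega : measurableType dO)
    (P : probability Omega R) q (U : nat -> Omega -> 'cV[R]_q)
    (N : probability (q.-tuple R) R) : Prop :=
  forall f : 'cV[R]_q -> R, continuous f ->
    (exists M : R, forall v, `|f v| <= M) ->
    (fun n => 'E_P[fun w => f (U n w)])%E @ \oo --> 'E_N[f \o @colv q]%E.

Definition op1 dO (Omega : measurableType dO)
    (P : probability Omega R) q (U : nat -> Omega -> 'cV[R]_q) : Prop :=
  forall e : R, 0 < e ->
    (fun n => P [set w | e <= `|U n w|]) @ \oo --> 0%E.

End probability.

Notation obs R p := (p.-tuple R * R)%type.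

Section functionals.
Context {R : realType} {p : nat}.
Implicit Types (F G : probability (obs R p) R) (FF : set (probability (obs R p) R)).

Definition convex_class FF : Prop :=
  forall F G (t : R), FF F -> FF G -> 0 <= t <= 1 ->
    FF (mixture F G t : probability _ _).

Definition jcdf F (x : p.-tuple R) (y : R) : R :=
  fine (F [set z | (forall i, tnth z.1 i <= tnth x i) /\ z.2 <= y]).

Definition supdist F G : R :=
  sup [set `|jcdf F xy.1 xy.2 - jcdf G xy.1 xy.2| | xy in [set: p.-tuple R * R]].

(* The derivative of [A] at [F0] is the functional
   [F - F0 |-> E_F Astar - E_F0 Astar] on the span of the differences of
   members of [FF].  As [FF] is convex, every element of this span is a multiple
   of some [F - G] with [F], [G] in [FF], so the second item says that the
   functional is bounded (its linearity is clear). *)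
Definition frechet_diff FF F0 q (A : probability (obs R p) R -> 'cV[R]_q)
    (Astar : obs R p -> 'cV[R]_q) : Prop :=
  [/\ forall F, FF F -> Lmx F 1 Astar,
      exists C : R, forall F G, FF F -> FF G ->
        `|Emx F Astar - Emx G Astar| <= C * supdist F G &
      forall e : R, 0 < e -> exists2 del : R, 0 < del &
        forall F, FF F -> supdist F F0 < del ->
          `|A F - A F0 - (Emx F Astar - Emx F0 Astar)| <= e * supdist F F0].

Definition influence_function FF F0 q (A : probability (obs R p) R -> 'cV[R]_q)
    (Astar : obs R p -> 'cV[R]_q) : Prop :=
  [/\ frechet_diff FF F0 A Astar,
      Lmx F0 2%:E Astar,
      Emx F0 Astar = 0 &
      forall F, FF F ->
        (fun t : R => t^-1 *: (A (mixture F0 F t : probability _ _) - A F0))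
          @ 0^'+ --> Emx F Astar].

End functionals.

Section parameterization.
Context {R : realType}.

Definition nangles (p d : nat) : nat := (p * d - (d * d.+1)./2)%N.

(* The pairs (i, j) with i < d and i < j < p, in lexicographic order; all
   indices start from 0. *)
Definition pairs (p d : nat) : seq (nat * nat) :=
  [seq (i, j) | i <- iota 0 d, j <- iota i.+1 (p - i.+1)].

Let size_pairsS p d :
  pairs p d.+1 = pairs p d ++ [seq (d, j) | j <- iota d.+1 (p - d.+1)].
Proof.
by rewrite /pairs -(addn1 d) iotaD add0n map_cat flatten_cat /= cats0 addn1.
Qed.

Let nanglesS p d : (d < p)%N -> nangles p d.+1 = (nangles p d + (p - d.+1))%N.
Proof.
rewrite /nangles => dp.
have -> : (d.+1 * d.+2)./2 = ((d * d.+1)./2 + d.+1)%N.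
  by rewrite (_ : d.+1 * d.+2 = d * d.+1 + d.+1.*2)%N ?halfD ?oddM ?odd_double
    ?doubleK /= ?andbN ?andbF ?add0n//; lia.
have : ((d * d.+1)./2 <= d * p)%N.
  by apply: leq_trans (leq_mul (leqnn d) dp); rewrite -leq_double; lia.
nia.
Qed.

Lemma size_pairs p d : (d <= p)%N -> size (pairs p d) = nangles p d.
Proof.
elim: d => [|d IH] dp; first by rewrite /nangles muln0.
by rewrite size_pairsS size_cat IH ?(ltnW dp)// size_map size_iota nanglesS.
Qed.

Lemma nth_pairs p d i j : (d <= p)%N -> (i < d)%N -> (i < j < p)%N ->
  nth (0, 0)%N (pairs p d) (p * i - (i * i.+1)./2 + (j - i)).-1%N = (i, j).
Proof.
move=> dp + /andP[ij jp]; rewrite -/(nangles p i).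
elim: d dp => [//|d IH] dp; rewrite ltnS leq_eqVlt.
rewrite size_pairsS nth_cat size_pairs ?(ltnW dp)//.
move=> /predU1P[ide|id]; last first.
  rewrite ifT ?IH ?(ltnW dp)//.
  have : (nangles p i + (p - i.+1) <= nangles p d)%N.
    elim: d dp id {IH} => [//|d IH] dp; rewrite ltnS leq_eqVlt.
    rewrite nanglesS ?(ltnW dp)// => /predU1P[->//|id].
    exact: leq_trans (IH (ltnW dp) id) (leq_addr _ _).
  lia.
rewrite ide in ij *; rewrite ifF; last lia.
have lt : ((nangles p d + (j - d)).-1 - nangles p d < p - d.+1)%N by lia.
rewrite (nth_map 0%N) ?size_iota// nth_iota//; congr (_, _); lia.
Qed.

Definition Dmx p (ij : nat * nat) (a : R) : 'M[R]_p :=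
  \matrix_(r < p, c < p)
    if (r == ij.1 :> nat) && (c == ij.1 :> nat) then cos a
    else if (r == ij.1 :> nat) && (c == ij.2 :> nat) then - sin a
    else if (r == ij.2 :> nat) && (c == ij.1 :> nat) then sin a
    else if (r == ij.2 :> nat) && (c == ij.2 :> nat) then cos a
    else (r == c)%:R.

Definition eta p d (hd : (d <= p)%N) (phi : 'cV[R]_(nangles p d)) :
    'M[R]_(p, d) :=
  \matrix_(r < p, c < d)
    (\big[mulmx/1%:M]_(t < nangles p d)
       Dmx p (nth (0, 0)%N (pairs p d) t) (phi t ord0)) r (widen_ord hd c).

Definition Omega_phi p d : set 'cV[R]_(nangles p d) :=
  [set phi | forall t, 0 <= phi t ord0 <= pi].

End parameterization.

Section model.
Context {R : realType} {p d s k : nat} (hd : (d <= p)%N).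
(* exponents of the monomials h_1, ..., h_s and f_1, ..., f_k *)
Context (b : 'I_s -> nat) (a : 'I_k -> 'I_d -> nat).
Implicit Types (F : probability (obs R p) R) (phi : 'cV[R]_(nangles p d)).

Definition Hvec (y : R) : 'cV[R]_s := \col_j y ^+ b j.

Definition Gvec (u : 'cV[R]_d) : 'cV[R]_k :=
  \col_i \prod_(j < d) u j ord0 ^+ a i j.

Definition Gphi phi (x : p.-tuple R) : 'cV[R]_k :=
  Gvec ((eta hd phi)^T *m colv x).

Definition XH (z : obs R p) := colv z.1 *m (Hvec z.2)^T.
Definition XG phi (z : obs R p) := colv z.1 *m (Gphi phi z.1)^T.
Definition GG phi (z : obs R p) := Gphi phi z.1 *m (Gphi phi z.1)^T.
Definition GH phi (z : obs R p) := Gphi phi z.1 *m (Hvec z.2)^T.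
Definition HH (z : obs R p) := Hvec z.2 *m (Hvec z.2)^T.

Definition R1 F := Emx F XH.
Definition R2 phi F := Emx F (XG phi).
Definition R3 phi F := Emx F (GG phi).
Definition R4 phi F := Emx F (GH phi).
Definition R5 F := Emx F HH.

Definition Rmx phi F : 'M[R]_(p, s) :=
  R1 F - R2 phi F *m invmx (R3 phi F) *m R4 phi F.

Definition ell phi F : R :=
  \tr (Rmx phi F *m invmx (R5 F) *m (Rmx phi F)^T).

Definition moments_exist F : Prop :=
  [/\ Lmx F 1 XH, Lmx F 1 HH &
      forall phi, Omega_phi phi ->
        [/\ Lmx F 1 (XG phi), Lmx F 1 (GG phi) & Lmx F 1 (GH phi)]].

Definition inverses_exist F : Prop :=
  R5 F \in unitmx /\ forall phi, Omega_phi phi -> R3 phi F \in unitmx.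

(* [ell] is considered on the whole of R^m, so that the partial derivatives are
   two-sided also at the boundary of [Omega_phi]. *)
Definition partial q (i : 'I_q) (f : 'cV[R]_q -> R) (v : 'cV[R]_q) : R :=
  'D_(delta_mx i ord0) f v.

Definition grad_ell phi F : 'cV[R]_(nangles p d) :=
  \col_i partial i (fun psi => ell psi F) phi.

Definition hess_ell phi F : 'M[R]_(nangles p d) :=
  \matrix_(i, j) partial i (partial j (fun psi => ell psi F)) phi.

Definition is_phi F phi : Prop :=
  [/\ Omega_phi phi, (forall psi, Omega_phi psi -> ell phi F <= ell psi F) &
      grad_ell phi F = 0].

Definition rho F (y y' : R) : R :=
  ((Hvec y)^T *m invmx (R5 F) *m Hvec y') ord0 ord0.

Definition redX q (beta : 'M[R]_(p, q)) (x : p.-tuple R) : q.-tuple R :=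
  rowt (beta^T *m colv x).

(* [m (redX beta x)] is a version of E(X | beta^T X) under [F]. *)
Definition is_condexpX F q (beta : 'M[R]_(p, q)) (m : q.-tuple R -> 'cV[R]_p) :
    Prop :=
  forall i, is_condexp F (fun z => tnth z.1 i) (fun z => redX beta z.1)
              (fun u => m u i ord0).

(* (X, Y, Y~) is realized on the product of two copies of the space of (X, Y):
   at a point [w], X = w.1.1, Y = w.1.2 and Y~ = w.2.2. *)
Definition solves F q (beta : 'M[R]_(p, q)) : Prop :=
  exists2 m, is_condexpX F beta m &
    forall i, exists e1 e2 : R -> R,
      [/\ is_condexp (F \x F)%E
             (fun w => tnth w.1.1 i * rho F w.1.2 w.2.2) (fun w => w.2.2) e1,
          is_condexp (F \x F)%E
             (fun w => m (redX beta w.1.1) i ord0 * rho F w.1.2 w.2.2)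
             (fun w => w.2.2) e2 &
          {ae (F \x F)%E, forall w, e1 w.2.2 = e2 w.2.2}].

Definition colspan q (beta : 'M[R]_(p, q)) : set 'cV[R]_p :=
  [set beta *m c | c in [set: 'cV[R]_q]].

Definition solution_space F (S : set 'cV[R]_p) : Prop :=
  exists q (beta : 'M[R]_(p, q)), solves F beta /\ S = colspan beta.

Definition central_solution_space F : set 'cV[R]_p :=
  \bigcap_(S in solution_space F) S.

Definition model_assumption F phi : Prop :=
  [/\ solution_space F (central_solution_space F),
      \rank (eta hd phi) = d,
      colspan (eta hd phi) = central_solution_space F &
      exists C : 'M[R]_(p, k),
        is_condexpX F (eta hd phi) (fun u => C *m Gvec (colv u))].

End model.

(* Main.v *)
Require Import Defs.
From HB Require Import structures.
From mathcomp Require Import all_boot all_order all_algebra.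
From mathcomp Require Import ring lra zify.
From mathcomp Require Import all_classical all_reals all_analysis.
From mathcomp Require Import measurable_realfun.

Set Implicit Arguments.
Unset Strict Implicit.
Unset Printing Implicit Defensive.

Import Order.TTheory GRing.Theory Num.Theory.
Import numFieldNormedType.Exports.

Local Open Scope classical_set_scope.
Local Open Scope ring_scope.

(** Write [W] for the Hessian and [M] for its pseudoinverse.  Along the path
    [(1 - t) F0 + t F] the minimizers satisfy the first-order condition at every
    [t], and differentiating it at [t = 0] gives
    [W E_F phistar + E_F gstar = 0] ([influence_linearization]).  Since [W] is
    symmetric, [M W = P_W]; taking for [F] the empirical distribution shows that
    [P_W] maps the sample mean of [phistar] to the sample mean of
    [r = - M gstar].  By asymptotic linearity, [sqrt n P_W (phi_n - phi0)] is
    therefore a normalized sum of independent copies of the centred vector [r],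
    whose covariance is [Lambda], plus a remainder that tends to [0] in
    probability, and the central limit theorem applies
    ([central_limit_slutsky]).

    Differentiating the first-order condition requires [ell] to be twice
    differentiable jointly in the angles and the weight [t], while moments are
    only assumed for angles in [[0, pi]].  The entries of the moment matrices are
    trigonometric polynomials in the angles, hence fixed combinations of their
    values at finitely many nodes in [[0, pi]] ([trig_degree_interpolation]).
    Near the base point, [ell] is thus a formal expression in [t] and in the
    cosines and sines of the angles ([ell_expressible]), and such expressions
    can be differentiated symbolically ([eval_slope], [implicit_slope]).  The
    inverses survive along the path because the matrices involved are Gram
    matrices ([psd_comb_unit]).

    The central limit theorem rests on characteristic functions, kept in real
    form as pairs of expectations of a cosine and a sine.  The pair of a sum of
    [n] independent terms obeys a linear recursion whose solution tends to the
    Gaussian value ([char_recursion_cvg]); the same recursion, applied to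
    convolutions of normal laws, computes the characteristic function of a
    normal law ([normal_law_char]).  Bernstein polynomials in
    [(1 + sin (x_j / K)) / 2] show that bounded continuous functions are limits,
    uniformly on boxes, of combinations of cosines of linear forms
    ([trig_approx]); with tightness this turns convergence of characteristic
    functions into convergence in distribution ([levy_continuity]). *)

(** * Real-valued expectations *)

Section real_expectation.
Context {R : realType} d (T : measurableType d) (F : probability T R).

Lemma fine_expectationE (f : T -> R) :
  fine 'E_F[f] = \int[F]_x f x.
Proof. by rewrite unlock. Qed.

Lemma bounded_integrable (f : T -> R) (M : R) :
  measurable_fun setT f -> (forall x, `|f x| <= M) -> F.-integrable setT (EFin \o f).
Proof.
move=> mf fM; apply: measurable_bounded_integrable => //.
  by rewrite (@le_lt_trans _ _ 1%E) ?ltry// probability_le1.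
exists M; split; first by rewrite num_real.
by move=> x Mx y _; exact: le_trans (fM y) (ltW Mx).
Qed.

Lemma Rintegral_cst_prob (c : R) :
  \int[F]_x c = c.
Proof.
rewrite Rintegral_cst//; have e : (F : measure T R) setT = 1%E := probability_setT F.
by rewrite [X in fine X]e mulr1.
Qed.

Lemma integrable_sumR I (r : seq I)
    (P : pred I) (f : I -> T -> R) :
  (forall i, F.-integrable setT (EFin \o f i)) ->
  F.-integrable setT (EFin \o (fun x => \sum_(i <- r | P i) f i x)).
Proof.
move=> hf.
rewrite (_ : EFin \o _ = fun x => (\sum_(i <- r | P i) (f i x)%:E)%E); last first.
  by apply/funext => x; rewrite /= sumEFin.
apply: (@integrable_sum _ _ _ _ _ measurableT _ r P (fun i x => (f i x)%:E)) => i _.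
exact: hf.
Qed.

Lemma Rintegral_sum I (r : seq I)
    (P : pred I) (f : I -> T -> R) :
  (forall i, F.-integrable setT (EFin \o f i)) ->
  \int[F]_x (\sum_(i <- r | P i) f i x) = \sum_(i <- r | P i) \int[F]_x f i x.
Proof.
move=> hf; elim: r => [|i r ih].
  by under eq_Rintegral do rewrite big_nil; rewrite big_nil Rintegral_cst_prob.
under eq_Rintegral do rewrite big_cons.
rewrite big_cons; case: (P i) => //; rewrite RintegralD ?ih//.
exact: integrable_sumR.
Qed.

Lemma integrableZlR (c : R) (f : T -> R) :
  F.-integrable setT (EFin \o f) -> F.-integrable setT (EFin \o (fun x => c * f x)).
Proof. by move=> hf; apply: (integrableZl measurableT c hf). Qed.

Lemma integrableDR (f g : T -> R) :
  F.-integrable setT (EFin \o f) -> F.-integrable setT (EFin \o g) ->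
  F.-integrable setT (EFin \o (fun x => f x + g x)).
Proof. by move=> hf hg; exact: (integrableD measurableT hf hg). Qed.

Lemma integrableBR (f g : T -> R) :
  F.-integrable setT (EFin \o f) -> F.-integrable setT (EFin \o g) ->
  F.-integrable setT (EFin \o (fun x => f x - g x)).
Proof. by move=> hf hg; exact: (integrableB measurableT hf hg). Qed.

Lemma integrable_cstR (c : R) :
  F.-integrable setT (EFin \o (fun=> c)).
Proof. exact: (@bounded_integrable _ `|c|). Qed.

Lemma norm_Rintegral_le (f : T -> R) (M : R) :
  measurable_fun setT f -> (forall x, `|f x| <= M) -> `|\int[F]_x f x| <= M.
Proof.
move=> mf fM; have i := bounded_integrable mf fM.
apply: le_trans (le_normr_Rintegral measurableT i) _.
rewrite -[leRHS]Rintegral_cst_prob; apply: le_Rintegral => //.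
  exact: (integrable_norm i).
exact: integrable_cstR.
Qed.

Lemma integrable_indicR (A : set T) :
  measurable A -> F.-integrable setT (EFin \o (\1_A : T -> R)).
Proof.
move=> mA; apply: (@bounded_integrable _ 1) => [|x]; first exact: measurable_indic.
by rewrite indicE; case: (_ \in _); rewrite ?normr1 ?normr0.
Qed.

Lemma Rintegral_indic_prob (A : set T) :
  measurable A -> \int[F]_x (\1_A x : R) = fine (F A).
Proof. by move=> mA; rewrite /Rintegral integral_indic// setIT. Qed.

End real_expectation.

Section expectation_under_transformations.
Context {R : realType}.

Lemma measurable_cosR : measurable_fun setT (@cos R).
Proof. exact: (continuous_measurable_fun (@continuous_cos R)). Qed.

Lemma measurable_sinR : measurable_fun setT (@sin R).
Proof. exact: (continuous_measurable_fun (@continuous_sin R)). Qed.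

(** Stated for an arbitrary measure [H] that integrates nonnegative functions like
    [a F + b G], so that it does not depend on how the combination is built. *)
Lemma Rintegral_comb d (T : measurableType d) (F G H : {measure set T -> \bar R}) (a b : R)
    (f : T -> R) : 0 <= a -> 0 <= b ->
  (forall g : T -> \bar R, measurable_fun setT g -> (forall x, 0 <= g x)%E ->
    \int[H]_x g x = a%:E * \int[F]_x g x + b%:E * \int[G]_x g x)%E ->
  F.-integrable setT (EFin \o f) -> G.-integrable setT (EFin \o f) ->
  H.-integrable setT (EFin \o f) /\
  \int[H]_x f x = a * \int[F]_x f x + b * \int[G]_x f x.
Proof.
move=> a0 b0 h iF iG; have mf : measurable_fun setT (fun x => (f x)%:E) := measurable_int _ iF.
have iH : H.-integrable setT (EFin \o f).
  apply/integrableP; split => //; rewrite h; first last.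
  - by [].
  - exact: measurableT_comp.
  apply: lte_add_pinfty; rewrite lte_mul_pinfty//.
    by have /integrableP[] := iF.
  by have /integrableP[] := iG.
split => //.
pose g (x : T) := (f x)%:E; rewrite /Rintegral -/g.
rewrite !(integralE _ _ g).
have fp := integrable_funepos measurableT iF; have fn := integrable_funeneg measurableT iF.
have gp := integrable_funepos measurableT iG; have gn := integrable_funeneg measurableT iG.
have hp := integrable_funepos measurableT iH; have hn := integrable_funeneg measurableT iH.
have fin (K : {measure set T -> \bar R}) u : K.-integrable setT u -> (\int[K]_x u x)%E \is a fin_num.
  by move=> /(integrable_fin_num measurableT).
have mg : measurable_fun setT g := mf.
have e1 := h _ (measurable_funepos mg) (fun x => funepos_ge0 _ _).
have e2 := h _ (measurable_funeneg mg) (fun x => funeneg_ge0 _ _).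
rewrite e1 e2 -(fineK (fin _ _ fp)) -(fineK (fin _ _ fn)) -(fineK (fin _ _ gp))
  -(fineK (fin _ _ gn)) /=; ring.
Qed.

Lemma mixture_Rintegral d (T : measurableType d) (F G : probability T R) (t : R)
    (f : T -> R) : 0 <= t <= 1 ->
  F.-integrable setT (EFin \o f) -> G.-integrable setT (EFin \o f) ->
  (mixture F G t : probability _ _).-integrable setT (EFin \o f) /\
  \int[mixture F G t]_x f x = (1 - t) * \int[F]_x f x + t * \int[G]_x f x.
Proof.
move=> t01 iF iG; apply: Rintegral_comb => //.
- by rewrite subr_ge0; case/andP: t01.
- by case/andP: t01.
move=> g mg g0; rewrite ge0_integral_measure_add// !ge0_integral_mscale//=.
by rewrite clamp01_id.
Qed.

Lemma law_Rintegral d d' (O : measurableType d) (T : measurableType d')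
    (P : probability O R) (F : probability T R) (X : O -> T) (f : T -> R) :
  measurable_fun setT X -> (forall A, measurable A -> P (X @^-1` A) = F A) ->
  F.-integrable setT (EFin \o f) ->
  P.-integrable setT (EFin \o (f \o X)) /\ \int[P]_w f (X w) = \int[F]_x f x.
Proof.
move=> mX h iF; have mf := measurable_int _ iF.
have eF (g : T -> \bar R) : (\int[F]_x g x = \int[pushforward P X]_x g x)%E.
  by apply: eq_measure_integral => A mA _; apply/esym; exact: h.
have iP : P.-integrable setT (EFin \o (f \o X)).
  apply/integrableP; split; first exact: (measurableT_comp mf).
  have /integrableP[_] := iF; rewrite eF ge0_integral_pushforward//.
  exact: measurableT_comp.
by split => //; rewrite /Rintegral eF integral_pushforward.
Qed.

Lemma empirical_Rintegral d (T : measurableType d) n (z : nat -> T) (f : T -> R) :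
  measurable_fun setT f ->
  \int[empirical n z : probability T R]_x f x = n.+1%:R^-1 * \sum_(i < n.+1) f (z i).
Proof.
move=> mf.
have h (g : T -> \bar R) : measurable_fun setT g -> (forall x, 0 <= g x)%E ->
    (\int[empirical n z : probability T R]_x g x =
      (n.+1%:R^-1)%:E * \sum_(i < n.+1) g (z i))%E.
  move=> mg g0; rewrite ge0_integral_mscale//= ge0_integral_measure_sum//.
  congr (_ * _)%E; apply: eq_bigr => i _.
  by rewrite integral_dirac// diracT mul1e.
have mg : measurable_fun setT (fun x => (f x)%:E) by exact/measurable_EFinP.
rewrite /Rintegral (integralE _ _ (fun x => (f x)%:E)).
rewrite (h _ (measurable_funepos mg))// (h _ (measurable_funeneg mg))//.
have -> : (fun x => (f x)%:E) = EFin \o f by [].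
rewrite funerpos funerneg/= !sumEFin -!EFinM -EFinB/= -mulrBr -sumrB.
by congr (_ * _); apply: eq_bigr => i _; rewrite -[in RHS](funrposBneg f).
Qed.

End expectation_under_transformations.

(** * One-sided derivatives *)

Section quotient_limits.
Context {R : realType}.

(** Repeated use of this form of the mean value theorem bounds the Taylor
    remainders of sine and cosine at [0]. *)
Lemma mvt0 (f df : R -> R) (x : R) : f 0 = 0 -> (forall y, is_derive y (1:R) f (df y)) ->
  exists2 c, `|c| <= `|x| & f x = df c * x.
Proof.
move=> f0 hf; have cf : continuous f.
  by move=> y; apply/differentiable_continuous/derivable1_diffP; case: (hf y).
have [x0|/ltW x0] := leP 0 x.
  have [c] := MVT_segment x0 (fun y _ => hf y) (continuous_subspaceT cf).
  rewrite in_itv/= f0 !subr0 => /andP[c0 cx] ->; exists c => //.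
  by rewrite !ger0_norm.
have [c] := MVT_segment x0 (fun y _ => hf y) (continuous_subspaceT cf).
rewrite in_itv/= f0 !sub0r => /andP[c0 cx] e; exists c; first by rewrite !ler0_norm ?lerN2.
by apply: oppr_inj; rewrite e mulrN.
Qed.

Lemma norm_sin_le (x : R) : `|sin x| <= `|x|.
Proof.
have [c _ ->] := mvt0 x (@sin0 R) (@is_derive_sin R).
by rewrite normrM ler_piMl// cos_max.
Qed.

Lemma cos_sub1_le (h : R) : `|cos h - 1| <= h ^+ 2 / 2.
Proof.
have e : cos h - 1 = - (sin (h / 2) ^+ 2 *+ 2).
  rewrite -{1}[h](@divfK _ 2)// mulrC mulr_natl cos_mulr2n.
  by rewrite cos2sin2; ring.
have : `|sin (h / 2)| ^+ 2 <= `|h / 2| ^+ 2 by rewrite ler_sqr ?nnegrE// norm_sin_le.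
rewrite !real_normK ?num_real// => hh.
rewrite e normrN ger0_norm ?mulrn_wge0 ?sqr_ge0//.
by rewrite exprMn in hh; lra.
Qed.

Lemma sin_sub_le3 (h : R) : `|sin h - h| <= `|h| ^+ 3.
Proof.
have hd y : is_derive y (1:R) (fun x : R => sin x - x) (cos y - 1) by exact: is_deriveB.
have [|c ch ->] := @mvt0 (fun x => sin x - x) _ h _ hd; first by rewrite sin0 subrr.
rewrite normrM exprSr ler_wpM2r// (le_trans (cos_sub1_le _))//.
have : `|c| ^+ 2 <= `|h| ^+ 2 by rewrite ler_sqr ?nnegrE.
by rewrite -[c ^+ 2]real_normK ?num_real//; have := sqr_ge0 `|c|; lra.
Qed.

Lemma cos_sub1_le4 (h : R) : `|cos h - 1 + h ^+ 2 / 2| <= `|h| ^+ 4.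
Proof.
have hd y : is_derive y (1:R) (fun x : R => cos x - 1 + x ^+ 2 / 2) (- (sin y - y)).
  apply: is_derive_eq => /=; rewrite /GRing.scale/=; lra.
have [|c ch ->] := @mvt0 (fun x => cos x - 1 + x ^+ 2 / 2) _ h _ hd.
  by rewrite cos0 subrr expr0n/= mul0r addr0.
rewrite normrM normrN exprSr ler_wpM2r// (le_trans (sin_sub_le3 _))//.
by rewrite lerXn2r ?nnegrE.
Qed.

Lemma sin_sub_le (h : R) : `|sin h - h| <= h ^+ 2.
Proof.
have hd y : is_derive y (1:R) (fun x : R => sin x - x) (cos y - 1) by exact: is_deriveB.
have [|c ch ->] := @mvt0 (fun x => sin x - x) _ h _ hd; first by rewrite sin0 subrr.
have hd2 y : is_derive y (1:R) (fun x : R => cos x - 1) (- sin y).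
  by apply: is_derive_eq; rewrite subr0.
have [|c2 _ ->] := @mvt0 (fun x => cos x - 1) _ c _ hd2; first by rewrite cos0 subrr.
rewrite -[h ^+ 2]real_normK ?num_real// normrM ler_wpM2r// (le_trans _ ch)//.
by rewrite normrM normrN ler_piMl// sin_max.
Qed.

(** [f] has derivative [l] along the filter [F], the value at the base point being
    replaced by [a]: one-sided derivatives and paths undefined at [0] are covered. *)
Definition has_slope (F : set_system R) (f : R -> R) (a l : R) :=
  (fun t => t^-1 * (f t - a)) @ F --> l.

Variable F : set_system R.
Context {FF : ProperFilter F}.
Hypothesis F0 : F `=>` 0^'.

Let nz : \forall t \near F, t != 0.
Proof. by have := nbhs_dnbhs_neq (0 : R); exact: F0. Qed.

Let id0 : t @[t --> F] --> (0 : R).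
Proof. by move=> A /nbhs_dnbhs; exact: F0. Qed.

Lemma slope_cvg f a l : has_slope F f a l -> f @ F --> a.
Proof.
move=> h; have : (fun t => t * (t^-1 * (f t - a)) + a) @ F --> 0 * l + a.
  by apply: cvgD; [apply: cvgM|exact: cvg_cst].
rewrite mul0r add0r; apply: cvg_trans; apply: near_eq_cvg.
by near=> t; rewrite mulrA divff ?mul1r ?subrK//; near: t.
Unshelve. all: by end_near. Qed.

Lemma slope_cst c : has_slope F (fun=> c) c 0.
Proof. by rewrite /has_slope subrr; under eq_fun do rewrite mulr0; exact: cvg_cst. Qed.

Lemma slope_id : has_slope F id 0 1.
Proof.
apply: cvg_near_cst.
by near=> t; rewrite subr0 mulVf//; near: t.
Unshelve. all: by end_near. Qed.

Lemma slopeD f g a b l k : has_slope F f a l -> has_slope F g b k ->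
  has_slope F (fun t => f t + g t) (a + b) (l + k).
Proof.
move=> hf hg; rewrite /has_slope; under eq_fun => t.
  rewrite (_ : _ * _ = t^-1 * (f t - a) + t^-1 * (g t - b)); last by ring.
  over.
exact: cvgD.
Qed.

Lemma slopeM f g a b l k : has_slope F f a l -> has_slope F g b k ->
  has_slope F (fun t => f t * g t) (a * b) (l * b + a * k).
Proof.
move=> hf hg; rewrite /has_slope; under eq_fun => t.
  rewrite (_ : _ * _ = t^-1 * (f t - a) * g t + a * (t^-1 * (g t - b))); last by ring.
  over.
apply: cvgD; apply: cvgM => //; [exact: slope_cvg hg|exact: cvg_cst].
Qed.

Lemma slopeV f a l : a != 0 -> has_slope F f a l ->
  has_slope F (fun t => (f t)^-1) a^-1 (- (l / a ^+ 2)).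
Proof.
move=> a0 hf; have fa := slope_cvg hf.
have : (fun t => - (t^-1 * (f t - a) * ((f t)^-1 * a^-1))) @ F --> - (l * (a^-1 * a^-1)).
  apply: cvgN; apply: cvgM => //; apply: cvgM; last exact: cvg_cst.
  exact: cvgV.
rewrite -invfM -expr2; apply: cvg_trans; apply: near_eq_cvg.
near=> t; have ft : f t != 0.
  near: t; apply: (cvgr_neq0 _ fa) => //.
by field; rewrite a0 ft; near: t.
Unshelve. all: by end_near. Qed.

Let slope_small f a l : has_slope F f a l ->
  (fun t => t^-1 * (f t - a) ^+ 2) @ F --> (0 : R).
Proof.
move=> hf; have : (fun t => t^-1 * (f t - a) * (f t - a)) @ F --> l * (a - a).
  by apply: cvgM => //; apply: cvgB; [exact: slope_cvg hf|exact: cvg_cst].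
by rewrite subrr mulr0; under eq_fun do rewrite -mulrA -expr2.
Qed.

Let slope_cos1 f a l : has_slope F f a l ->
  (fun t => t^-1 * (cos (f t - a) - 1)) @ F --> (0 : R).
Proof.
move=> hf; apply/cvgr0Pnorm_le => e e0.
have /cvgr0Pnorm_le/(_ e e0) := slope_small hf.
apply: filterS => t; apply: le_trans; rewrite normrM [leRHS]normrM ler_wpM2l//.
by rewrite (le_trans (cos_sub1_le _))// normrX real_normK ?num_real//; have := sqr_ge0 (f t - a); lra.
Qed.

Let slope_sin1 f a l : has_slope F f a l ->
  (fun t => t^-1 * sin (f t - a)) @ F --> l.
Proof.
move=> hf; rewrite -[l]add0r.
under eq_fun => t.
  rewrite (_ : _ * _ = t^-1 * (sin (f t - a) - (f t - a)) + t^-1 * (f t - a)); last by ring.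
  over.
apply: cvgD => //; apply/cvgr0Pnorm_le => e e0.
have /cvgr0Pnorm_le/(_ e e0) := slope_small hf.
apply: filterS => t; apply: le_trans; rewrite normrM [leRHS]normrM ler_wpM2l//.
by rewrite (le_trans (sin_sub_le _))// normrX real_normK ?num_real.
Qed.

Lemma slope_cos f a l : has_slope F f a l ->
  has_slope F (fun t => cos (f t)) (cos a) (- sin a * l).
Proof.
move=> hf; rewrite /has_slope; under eq_fun => t.
  rewrite (_ : _ * _ = cos a * (t^-1 * (cos (f t - a) - 1)) +
     - sin a * (t^-1 * sin (f t - a))); last first.
    have -> : cos (f t) = cos a * cos (f t - a) - sin a * sin (f t - a).
      by rewrite -cosD addrC subrK.
    by ring.
  over.
rewrite -[X in nbhs X]add0r -[X in nbhs (X + _)](mulr0 (cos a)).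
apply: cvgD; (apply: cvgM; first exact: cvg_cst).
  exact: slope_cos1 hf.
exact: slope_sin1.
Qed.

Lemma slope_sin f a l : has_slope F f a l ->
  has_slope F (fun t => sin (f t)) (sin a) (cos a * l).
Proof.
move=> hf; rewrite /has_slope; under eq_fun => t.
  rewrite (_ : _ * _ = sin a * (t^-1 * (cos (f t - a) - 1)) +
     cos a * (t^-1 * sin (f t - a))); last first.
    have -> : sin (f t) = sin a * cos (f t - a) + cos a * sin (f t - a).
      by rewrite -sinD addrC subrK.
    by ring.
  over.
rewrite -[X in nbhs X]add0r -[X in nbhs (X + _)](mulr0 (sin a)).
apply: cvgD; (apply: cvgM; first exact: cvg_cst).
  exact: slope_cos1 hf.
exact: slope_sin1.
Qed.

End quotient_limits.

(** * Formal differentiation of expressions *)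

Section expressions.
Context {R : realType} {I : finType}.

(** Symbolic description of the smooth functions that occur here.  They are closed
    under partial differentiation, so that their derivatives of every order exist
    and are continuous wherever no inverted quantity vanishes. *)
Inductive expr : Type :=
| EVar of I | ECos of I | ESin of I | ECst of R
| EAdd of expr & expr | EMul of expr & expr | EInv of expr.

Fixpoint eval (v : I -> R) (e : expr) : R :=
  match e with
  | EVar i => v i | ECos i => cos (v i) | ESin i => sin (v i) | ECst c => c
  | EAdd e1 e2 => eval v e1 + eval v e2
  | EMul e1 e2 => eval v e1 * eval v e2
  | EInv e1 => (eval v e1)^-1
  end.

Fixpoint well_def (v : I -> R) (e : expr) : Prop :=
  match e with
  | EAdd e1 e2 | EMul e1 e2 => well_def v e1 /\ well_def v e2
  | EInv e1 => well_def v e1 /\ eval v e1 != 0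
  | _ => True
  end.

Fixpoint diff_expr (i : I) (e : expr) : expr :=
  match e with
  | EVar j => ECst (i == j)%:R
  | ECos j => EMul (ECst (- (i == j)%:R)) (ESin j)
  | ESin j => EMul (ECst (i == j)%:R) (ECos j)
  | ECst _ => ECst 0
  | EAdd e1 e2 => EAdd (diff_expr i e1) (diff_expr i e2)
  | EMul e1 e2 => EAdd (EMul (diff_expr i e1) e2) (EMul e1 (diff_expr i e2))
  | EInv e1 => EMul (ECst (-1)) (EMul (diff_expr i e1) (EMul (EInv e1) (EInv e1)))
  end.

Lemma well_def_diff v i e : well_def v e -> well_def v (diff_expr i e).
Proof. by elim: e => //= [e1 h1 e2 h2|e1 h1 e2 h2|e1 h1] [] /[dup] + /h1; tauto. Qed.

Lemma diff_exprC v i j e : eval v (diff_expr i (diff_expr j e)) = eval v (diff_expr j (diff_expr i e)).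
Proof.
elim: e => //= [k|k|e1 h1 e2 h2|e1 h1 e2 h2|e1 h1].
- by rewrite !mul0r !add0r; case: eqP; case: eqP => //= _ _; ring.
- by rewrite !mul0r !add0r; case: eqP; case: eqP => //= _ _; ring.
- by rewrite h1 h2.
- by rewrite h1 h2; ring.
- by rewrite h1; ring.
Qed.

Lemma eval_cvg T (F : set_system T) {FF : Filter F} (g : T -> I -> R) (v : I -> R) e :
  (forall i, g ^~ i @ F --> v i) -> well_def v e ->
  ((fun t => eval (g t) e) @ F --> eval v e) /\ (\forall t \near F, well_def (g t) e).
Proof.
move=> gv; elim: e => /= [i|i|i|c|e1 h1 e2 h2|e1 h1 e2 h2|e1 h1].
- by move=> _; split; [exact: gv|near=> t].
- move=> _; split; last by near=> t.
  by apply: (cvg_comp _ _ (gv i)); exact: continuous_cos.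
- move=> _; split; last by near=> t.
  by apply: (cvg_comp _ _ (gv i)); exact: continuous_sin.
- by move=> _; split; [exact: cvg_cst|near=> t].
- case=> /h1[c1 n1] /h2[c2 n2]; split; first exact: cvgD.
  by near=> t; split; near: t.
- case=> /h1[c1 n1] /h2[c2 n2]; split; first exact: cvgM.
  by near=> t; split; near: t.
- case=> /h1[c1 n1] e0; split; first exact: cvgV.
  by near=> t; split; near: t => //; exact: cvgr_neq0 c1 e0.
Unshelve. all: by end_near. Qed.

(** Chain rule along a path whose coordinates are only known to have slopes at the
    base point; no partial derivative near the base point enters. *)
Lemma eval_slope (F : set_system R) {FF : ProperFilter F} (F0 : F `=>` 0^')
    (g : R -> I -> R) (v w : I -> R) e :
  (forall i, has_slope F (g ^~ i) (v i) (w i)) -> well_def v e ->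
  has_slope F (fun t => eval (g t) e) (eval v e) (\sum_i eval v (diff_expr i e) * w i).
Proof.
move=> gv; elim: e => /= [i|i|i|c|e1 h1 e2 h2|e1 h1 e2 h2|e1 h1].
- move=> _; rewrite (bigD1 i)//= eqxx mul1r big1 ?addr0// => j /negPf ->.
  by rewrite mul0r.
- move=> _; rewrite (bigD1 i)//= eqxx mulN1r big1 ?addr0; first exact: slope_cos.
  by move=> j /negPf ->; rewrite oppr0 !mul0r.
- move=> _; rewrite (bigD1 i)//= eqxx mul1r big1 ?addr0; first exact: slope_sin.
  by move=> j /negPf ->; rewrite !mul0r.
- by move=> _; rewrite big1 ?mul0r// => [|j _]; [exact: slope_cst|rewrite mul0r].
- case=> /h1 s1 /h2 s2; under eq_bigr do rewrite mulrDl.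
  by rewrite big_split/=; exact: slopeD.
- case=> /h1 s1 /h2 s2; under eq_bigr do rewrite mulrDl mulrAC -[X in _ + X]mulrA.
  by rewrite big_split/= -mulr_suml -mulr_sumr; exact: slopeM.
- case=> /h1 s1 e0.
  rewrite [X in has_slope _ _ _ X](_ : _ =
    - ((\sum_i eval v (diff_expr i e1) * w i) / eval v e1 ^+ 2)); first exact: slopeV.
  rewrite mulr_suml -sumrN; apply: eq_bigr => i _.
  by field.
Qed.


End expressions.
Arguments expr : clear implicits.

(** * Functions of angles and weight given by an expression *)

Section expressible.
Context {R : realType} {m : nat} (phi0 : 'cV[R]_m).

Definition env (x : 'cV[R]_m * R) (o : option 'I_m) : R :=
  if o is Some i then x.1 i ord0 else x.2.

(** The weight approaches [0] from the right only, because the weight of a mixture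
    is clamped: for [t < 0] the mixture is constantly [F0]. *)
Definition base_filter : set_system ('cV[R]_m * R) :=
  filter_prod (nbhs phi0) (within [set t | 0 <= t] (nbhs (0 : R))).

Global Instance base_filter_filter : Filter base_filter.
Proof. exact: filter_prod_filter. Qed.

Lemma env_cvg o : env x o @[x --> base_filter] --> env (phi0, 0) o.
Proof.
case: o => [i|] /=.
  by apply: (@cvg_comp _ _ _ fst (fun v : 'cV[R]_m => v i ord0) _ (nbhs phi0)); [exact: cvg_fst|exact: coord_continuous].
move=> A A0; apply: cvg_snd; exact: cvg_within A0.
Qed.

(** Equality is only required near the base point, since matrix inverses are given
    by the cofactor formula only where the determinant does not vanish. *)
Definition expressible (f : 'cV[R]_m * R -> R) : Prop :=
  exists e : expr R (option 'I_m), well_def (env (phi0, 0)) e /\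
    \forall x \near base_filter, f x = eval (env x) e.

Lemma expressible_cvg f : expressible f -> f x @[x --> base_filter] --> f (phi0, 0).
Proof.
move=> [e [we fe]]; rewrite (_ : f (phi0, 0) = eval (env (phi0, 0)) e).
  have [h _] := eval_cvg env_cvg we.
  apply: cvg_trans h; apply: near_eq_cvg.
  by apply: filterS fe => x ->.
case: fe => -[A B] /= [/nbhs_singleton A0 /nbhs_singleton B0] AB.
by apply: (AB (phi0, 0)); split => //; apply: B0; rewrite /= lexx.
Qed.

Lemma near_expressible f g : (\forall x \near base_filter, f x = g x) ->
  expressible g -> expressible f.
Proof.
move=> fg [e [we ge]]; exists e; split => //.
by apply: filterS2 fg ge => x -> ->.
Qed.

Lemma expressible_cst c : expressible (fun=> c).
Proof. by exists (ECst c); split => //; near=> x. Unshelve. all: by end_near. Qed.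

Lemma expressible_var : expressible snd.
Proof. by exists (EVar None); split => //; near=> x. Unshelve. all: by end_near. Qed.

Lemma expressible_cos i : expressible (fun x => cos (x.1 i ord0)).
Proof. by exists (ECos (Some i)); split => //; near=> x. Unshelve. all: by end_near. Qed.

Lemma expressible_sin i : expressible (fun x => sin (x.1 i ord0)).
Proof. by exists (ESin (Some i)); split => //; near=> x. Unshelve. all: by end_near. Qed.

Lemma expressibleD f g : expressible f -> expressible g ->
  expressible (fun x => f x + g x).
Proof.
move=> [e [we fe]] [e' [we' ge]]; exists (EAdd e e'); split => //.
by apply: filterS2 fe ge => x /= -> ->.
Qed.

Lemma expressibleM f g : expressible f -> expressible g ->
  expressible (fun x => f x * g x).
Proof.
move=> [e [we fe]] [e' [we' ge]]; exists (EMul e e'); split => //.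
by apply: filterS2 fe ge => x /= -> ->.
Qed.

Lemma expressibleN f : expressible f -> expressible (fun x => - f x).
Proof.
move=> ef; apply: near_expressible (expressibleM (expressible_cst (-1)) ef).
by near=> x; rewrite mulN1r.
Unshelve. all: by end_near. Qed.

Lemma expressibleB f g : expressible f -> expressible g ->
  expressible (fun x => f x - g x).
Proof. by move=> ef eg; apply: expressibleD => //; exact: expressibleN. Qed.

Lemma expressibleV f : f (phi0, 0) != 0 -> expressible f ->
  expressible (fun x => (f x)^-1).
Proof.
move=> f0 [e [we fe]]; exists (EInv e); split; last by apply: filterS fe => x /= ->.
split=> //; case: fe => -[A B] /= [/nbhs_singleton A0 /nbhs_singleton B0] AB.
rewrite -(AB (phi0, 0))//=; split => //=; by apply: B0; rewrite /= lexx.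
Qed.

Lemma expressible_sum J (r : seq J) P (F : J -> 'cV[R]_m * R -> R) :
  (forall j, expressible (F j)) -> expressible (fun x => \sum_(j <- r | P j) F j x).
Proof.
move=> h; elim: r => [|j r ih].
  under eq_fun do rewrite big_nil.
  exact: expressible_cst.
under eq_fun do rewrite big_cons.
by case: (P j) => //; exact: expressibleD.
Qed.

Lemma expressible_prod J (r : seq J) P (F : J -> 'cV[R]_m * R -> R) :
  (forall j, expressible (F j)) -> expressible (fun x => \prod_(j <- r | P j) F j x).
Proof.
move=> h; elim: r => [|j r ih].
  under eq_fun do rewrite big_nil.
  exact: expressible_cst.
under eq_fun do rewrite big_cons.
by case: (P j) => //; exact: expressibleM.
Qed.

Lemma expressibleX f n : expressible f -> expressible (fun x => f x ^+ n).
Proof.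
move=> ef; elim: n => [|n ih]; first exact: expressible_cst.
by under eq_fun do rewrite exprS; exact: expressibleM.
Qed.

Lemma expressible_horner (p : {poly R}) f :
  expressible f -> expressible (fun x => p.[f x]).
Proof.
move=> ef; under eq_fun do rewrite horner_coef.
apply: expressible_sum => i; apply: expressibleM; first exact: expressible_cst.
exact: expressibleX.
Qed.

Definition expressible_mx p q (A : 'cV[R]_m * R -> 'M[R]_(p, q)) : Prop :=
  forall i j, expressible (fun x => A x i j).

Lemma expressible_mulmx p q r (A : _ -> 'M[R]_(p, q)) (B : _ -> 'M[R]_(q, r)) :
  expressible_mx A -> expressible_mx B -> expressible_mx (fun x => A x *m B x).
Proof.
move=> hA hB i j; under eq_fun do rewrite mxE.
by apply: expressible_sum => k; exact: expressibleM.
Qed.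

Lemma expressible_subrmx p q (A B : _ -> 'M[R]_(p, q)) :
  expressible_mx A -> expressible_mx B -> expressible_mx (fun x => A x - B x).
Proof. by move=> hA hB i j; under eq_fun do rewrite !mxE; exact: expressibleB. Qed.

Lemma expressible_trmx p q (A : _ -> 'M[R]_(p, q)) :
  expressible_mx A -> expressible_mx (fun x => (A x)^T).
Proof. by move=> hA i j; under eq_fun do rewrite mxE. Qed.

Lemma expressible_mxtrace p (A : _ -> 'M[R]_p) :
  expressible_mx A -> expressible (fun x => \tr (A x)).
Proof. by move=> hA; exact: expressible_sum. Qed.

Lemma expressible_det p (A : _ -> 'M[R]_p) :
  expressible_mx A -> expressible (fun x => \det (A x)).
Proof.
move=> hA; apply: expressible_sum => s; apply: expressibleM; first exact: expressible_cst.
exact: expressible_prod.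
Qed.

(** The cofactor formula divides by the determinant, which stays nonzero near the
    base point by continuity. *)
Lemma expressible_invmx p (A : _ -> 'M[R]_p) : A (phi0, 0) \in unitmx ->
  expressible_mx A -> expressible_mx (fun x => invmx (A x)).
Proof.
move=> uA hA i j; rewrite unitmxE unitfE in uA.
apply: near_expressible; last first.
  apply: (@expressibleM (fun x => (\det (A x))^-1) (fun x => cofactor (A x) j i)).
    by apply: expressibleV => //; exact: expressible_det.
  apply: expressibleM; first exact: expressible_cst.
  by apply: expressible_det => k l; under eq_fun do rewrite !mxE.
near=> x; rewrite /invmx ifT ?mxE// unitmxE unitfE.
by near: x; apply: cvgr_neq0 uA; exact: (expressible_cvg (expressible_det hA)).
Unshelve. all: by end_near. Qed.

End expressible.

(** * Implicit differentiation *)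

Section partials.
Context {R : realType} {m : nat} (phi0 : 'cV[R]_m).

Lemma sum_option (I : finType) (F : option I -> R) :
  \sum_o F o = F None + \sum_i F (Some i).
Proof.
rewrite (bigD1 None)//=; congr +%R.
rewrite (reindex_omap Some id) => [|[]//].
by apply: eq_bigl => i; rewrite /= eqxx.
Qed.

Lemma partial_eval (i : 'I_m) (x : 'cV[R]_m * R) (e : expr R (option 'I_m)) :
  well_def (env x) e ->
  partial i (fun v => eval (env (v, x.2)) e) x.1 = eval (env x) (diff_expr (Some i) e).
Proof.
case: x => u t /= we; apply: cvg_lim => //.
pose w (o : option 'I_m) : R := if o is Some j then (j == i)%:R else 0.
have hw : \sum_o eval (env (u, t)) (diff_expr o e) * w o = eval (env (u, t)) (diff_expr (Some i) e).
  rewrite (bigD1 (Some i))//= eqxx mulr1 big1 ?addr0// => -[j|] //=; last by rewrite mulr0.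
  by move=> ji; rewrite (_ : j == i = false) ?mulr0//; apply/negP => /eqP ji'; rewrite ji' eqxx in ji.
rewrite -hw; apply: (@eval_slope _ _ _ _ _ (fun h => env (h *: delta_mx i ord0 + u, t))) => //.
move=> [j|] /=; last exact: slope_cst.
rewrite /has_slope; apply: cvg_near_cst.
near=> h; rewrite !mxE eqxx andbT addrK mulrA mulVf ?mul1r//.
by near: h; exact: nbhs_dnbhs_neq.
Unshelve. all: by end_near. Qed.

Lemma partial_near (i : 'I_m) (f g : 'cV[R]_m -> R) (v : 'cV[R]_m) :
  (\forall u \near v, f u = g u) -> partial i f v = partial i g v.
Proof. exact: near_eq_derive. Qed.

(** A partial derivative depends on the values near the point only, so that it may
    be computed on the expression, at the base point and also nearby. *)
Lemma partial_expressible (L : 'cV[R]_m * R -> R) : expressible phi0 L ->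
  exists e : expr R (option 'I_m), [/\ well_def (env (phi0, 0)) e,
    \forall x \near base_filter phi0, forall i,
      partial i (fun v => L (v, x.2)) x.1 = eval (env x) (diff_expr (Some i) e) &
    forall i j, partial i (partial j (fun v => L (v, 0))) phi0 =
      eval (env (phi0, 0)) (diff_expr (Some i) (diff_expr (Some j) e))].
Proof.
move=> [e [we Le]]; have [_ wn] := eval_cvg (@env_cvg _ _ phi0) we.
have [[A B] /= [nA nB] AB] := filterI Le wn.
have B0 : B 0 by apply: (nbhs_singleton nB); rewrite /= lexx.
have first (x : _) i : A^° x.1 -> B x.2 ->
    partial i (fun v => L (v, x.2)) x.1 = eval (env x) (diff_expr (Some i) e).
  move=> Ax Bx; have [_ wx] : L x = eval (env x) e /\ well_def (env x) e.
    by apply: (AB x); split => //; exact: interior_subset.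
  rewrite -partial_eval//; apply: partial_near.
  by apply: filterS Ax => u Au; have [] := AB (u, x.2) (conj Au Bx).
exists e; split => //.
  exists (A^°, B) => /=; first by split => //; exact: nbhs_interior.
  by move=> x [/= Ax Bx] i; exact: first.
move=> i j; rewrite -partial_eval; last exact: well_def_diff.
apply: partial_near; have := nbhs_interior nA.
by apply: filterS => u Au /=; exact: (first (u, 0)).
Qed.

Lemma hess_sym (L : 'cV[R]_m * R -> R) i j : expressible phi0 L ->
  partial i (partial j (fun v => L (v, 0))) phi0 =
  partial j (partial i (fun v => L (v, 0))) phi0.
Proof. by case/partial_expressible => e [_ _ h]; rewrite !h diff_exprC. Qed.

(** The path [(phi t, t)] keeps the derivative of [L] equal to [0]; subtracting the
    slope along [(phi0, t)], which is [g], from the chain rule along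
    [(phi t, t)] leaves the Hessian applied to [dphi]. *)
Lemma implicit_slope (L : 'cV[R]_m * R -> R) (phi : R -> 'cV[R]_m)
    (dphi g : 'cV[R]_m) i : expressible phi0 L ->
  partial i (fun v => L (v, 0)) phi0 = 0 ->
  (\forall t \near 0^'+, partial i (fun v => L (v, t)) (phi t) = 0) ->
  (fun t => t^-1 *: (phi t - phi0)) @ 0^'+ --> dphi ->
  has_slope 0^'+ (fun t => partial i (fun v => L (v, t)) phi0) 0 (g i ord0) ->
  (\sum_j partial i (partial j (fun v => L (v, 0))) phi0 * dphi j ord0) + g i ord0 = 0.
Proof.
move=> eL.
have [e [we pe he]] := partial_expressible eL.
move=> p0 pt phit gt.
have r0 : (0 : R)^'+ `=>` 0^'.
  move=> A; rewrite /at_right /dnbhs /within/=.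
  by apply: filterS => t h t0; apply: h; rewrite gt_eqF.
have id0 : t @[t --> (0 : R)^'+] --> (0 : R).
  by move=> A /nbhs_dnbhs; exact: r0.
have sphi j : has_slope 0^'+ (fun t => phi t j ord0) (phi0 j ord0) (dphi j ord0).
  have : (fun t => (t^-1 *: (phi t - phi0)) j ord0) @ 0^'+ --> dphi j ord0.
    by apply: (@cvg_comp _ _ _ _ (fun v : 'cV[R]_m => v j ord0) _ _ _ phit); exact: coord_continuous.
  by under eq_fun do rewrite !mxE.
have phi_cvg : phi @ 0^'+ --> phi0.
  have : (fun t => t *: (t^-1 *: (phi t - phi0)) + phi0) @ 0^'+ --> 0 *: dphi + phi0.
    by apply: cvgD; [apply: cvgZ|exact: cvg_cst].
  rewrite scale0r add0r; apply: cvg_trans; apply: near_eq_cvg.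
  near=> t; have t0 : t != 0 by rewrite gt_eqF//; near: t; exact: nbhs_right_gt.
  by rewrite scalerA divff// scale1r subrK.
have cvgt : t @[t --> (0 : R)^'+] --> within [set t : R | 0 <= t] (nbhs (0 : R)).
  move=> A wA; have {}wA : nbhs (0 : R) [set t | 0 <= t -> A t] by exact: wA.
  by apply: (filterS _ wA) => t h t0; exact/h/ltW.
have cvgb : (fun t => (phi t, t)) @ 0^'+ --> base_filter phi0.
  exact: (@cvg_pair _ _ _ _ (nbhs phi0) _ _ _ _ _ _ phi_cvg cvgt).
have cvgc : (fun t => (phi0, t)) @ 0^'+ --> base_filter phi0.
  exact: (@cvg_pair _ _ _ _ (nbhs phi0) _ _ _ _ _ _ (cvg_cst _) cvgt).
have wi := well_def_diff (Some i) we.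
have base0 : eval (env (phi0, 0)) (diff_expr (Some i) e) = 0.
  apply: etrans p0; case: pe => -[A B] /= [/nbhs_singleton A0 /nbhs_singleton B0] AB.
  by rewrite -(AB (phi0, 0) _ i)//; split => //; apply: B0; rewrite /= lexx.
have s1 := @eval_slope _ _ _ _ r0 (fun t => env (phi t, t)) (env (phi0, 0))
  (fun o => if o is Some j then dphi j ord0 else 1) (diff_expr (Some i) e).
have s2 := @eval_slope _ _ _ _ r0 (fun t => env (phi0, t)) (env (phi0, 0))
  (fun o => if o is Some j then 0 else 1) (diff_expr (Some i) e).
have {}s1 := s1 _ _ wi; have {}s2 := s2 _ _ wi.
have pb : \forall t \near 0^'+, partial i (fun v => L (v, t)) (phi t) =
    eval (env (phi t, t)) (diff_expr (Some i) e).
  by have : (0^'+) _ := cvgb _ pe; apply: filterS => t /=.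
have pc : \forall t \near 0^'+, partial i (fun v => L (v, t)) phi0 =
    eval (env (phi0, t)) (diff_expr (Some i) e).
  by have : (0^'+) _ := cvgc _ pe; apply: filterS => t /=.
have slope0 : has_slope 0^'+ (fun t => eval (env (phi t, t)) (diff_expr (Some i) e)) 0 0.
  apply: cvg_near_cst; near=> t; rewrite subr0.
  by rewrite -(near pb t)// (near pt t)// mulr0.
have slopeg : has_slope 0^'+ (fun t => eval (env (phi0, t)) (diff_expr (Some i) e)) 0 (g i ord0).
  apply: cvg_trans gt; apply: near_eq_cvg; near=> t; congr (_ * (_ - _)).
  exact: (near pc t).
rewrite base0 in s1 s2.
have e1 : \sum_o eval (env (phi0, 0)) (diff_expr o (diff_expr (Some i) e)) *
    (if o is Some j then dphi j ord0 else 1) = 0.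
  apply: cvg_unique slope0; first exact: Rhausdorff.
  by apply: s1 => -[j|]//=; exact: slope_id.
have e2 : \sum_o eval (env (phi0, 0)) (diff_expr o (diff_expr (Some i) e)) *
    (if o is Some j then 0 else 1) = g i ord0.
  apply: cvg_unique slopeg; first exact: Rhausdorff.
  by apply: s2 => -[j|]/=; [exact: slope_cst|exact: slope_id].
rewrite sum_option [X in _ + X]big1 ?addr0 in e2; last by move=> j _; rewrite mulr0.
rewrite -e2 addrC; apply: etrans e1; rewrite sum_option; congr +%R.
by apply: eq_bigr => j _; rewrite he diff_exprC.
Unshelve. all: by end_near. Qed.
End partials.

(** * Interpolation of trigonometric polynomials *)

Section trig_interpolation.
Context {R : realType}.

(** Every trigonometric polynomial has this form, as powers of the sine reduce by
    [sin ^ 2 = 1 - cos ^ 2]. *)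
Definition trig_poly (N : nat) (h : R -> R) : Prop :=
  exists A B : {poly R}, [/\ (size A <= N)%N, (size B <= N)%N &
    forall t, h t = A.[cos t] + sin t * B.[cos t]].

Lemma poly_eq0_geq2 (A : {poly R}) : (forall x, 2 <= x -> A.[x] = 0) -> A = 0.
Proof.
move=> h; apply: (@roots_geq_poly_eq0 _ _ [seq l.+2%:R | l <- iota 0 (size A)]).
- by apply/allP => _ /mapP[l _ ->]; rewrite /root h// ler_nat.
- by rewrite map_inj_uniq ?iota_uniq// => i j /eqP; rewrite eqr_nat => /eqP[].
- by rewrite size_map size_iota.
Qed.

(** At the given points [A ^ 2 = (1 - X ^ 2) B ^ 2].  There are more of them than
    the degree of this equation, so it is an identity of polynomials; for
    [x >= 2] its right-hand side is nonpositive and its left-hand side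
    nonnegative, hence both vanish and [A], [B] have infinitely many roots. *)
Lemma trig_poly_eq0 (N : nat) (A B : {poly R}) (c : nat -> R) :
  (size A <= N)%N -> (size B <= N)%N -> injective c ->
  (forall l, (l < N.*2.+1)%N -> -1 <= c l <= 1) ->
  (forall l, (l < N.*2.+1)%N -> A.[c l] + sin (acos (c l)) * B.[c l] = 0) ->
  A = 0 /\ B = 0.
Proof.
move=> sA sB cinj c1 AB0.
have [N0|N0] := posnP N.
  by move: sA sB; rewrite N0 !leqn0 !size_poly_eq0 => /eqP -> /eqP ->.
have AB2 : A ^+ 2 = (1 - 'X ^+ 2) * B ^+ 2.
  apply/eqP; rewrite -subr_eq0; apply/eqP.
  apply: (@roots_geq_poly_eq0 _ _ [seq c l | l <- iota 0 N.*2.+1]).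
  - apply/allP => x /mapP[l]; rewrite mem_iota/= add0n => lN ->.
    rewrite /root hornerD hornerN horner_exp hornerM horner_exp hornerD hornerN hornerC hornerXn.
    apply/eqP.
    have -> : A.[c l] = - (sin (acos (c l)) * B.[c l]).
      by apply/eqP; rewrite -addr_eq0 AB0.
    rewrite sqrrN exprMn sin_acos ?c1// sqr_sqrtr ?subrr//.
    by have /andP[? ?] := c1 _ lN; nra.
  - by rewrite map_inj_uniq ?iota_uniq.
  - rewrite size_map size_iota.
    have hA := size_polyMleq A A; have hB := size_polyMleq B B.
    have h1 : (size (1 - 'X ^+ 2 : {poly R})%R <= 3)%N.
      by rewrite (leq_trans (size_polyD _ _))// geq_max size_polyN size_polyXn size_poly1.
    have hB1 : (size ((1 - 'X ^+ 2) * (B * B))%R <= (size (1 - 'X ^+ 2 : {poly R})%R + size (B * B)%R).-1)%N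
      by exact: size_polyMleq.
    rewrite -!expr2 in hA hB hB1.
    rewrite (leq_trans (size_polyD _ _))// geq_max size_polyN; apply/andP; split.
      by apply: leq_trans hA _; clear -sA; lia.
    apply: leq_trans hB1 _; rewrite -subn1 leq_subLR.
    by apply: leq_trans (leq_add h1 hB) _; clear -sB N0; lia.
have h x : 2 <= x -> A.[x] = 0 /\ B.[x] = 0.
  move=> x2; have := congr1 (horner^~ x) AB2.
  rewrite horner_exp hornerM horner_exp hornerD hornerN hornerC hornerXn => e.
  have : A.[x] ^+ 2 <= 0.
    rewrite e mulr_le0_ge0 ?sqr_ge0//; by nra.
  rewrite le_eqVlt ltNge sqr_ge0 orbF sqrf_eq0 => /eqP A0; split => //.
  move/eqP: e; rewrite A0 expr0n/= eq_sym mulf_eq0 sqrf_eq0 => /orP[|/eqP//].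
  by move=> /eqP; nra.
by split; apply: poly_eq0_geq2 => x /h[].
Qed.

(** Evaluation at the nodes is injective on pairs [(A, B)] by [trig_poly_eq0], so it
    has a linear left inverse, which recovers [h] from its values there.  The
    nodes lie in the half period [[0, pi]] although [h] has period [2 pi]. *)
Lemma trig_poly_interpolation (N : nat) :
  exists M (node : 'I_M -> R) (L : 'I_M -> {poly R} * {poly R}),
    (forall l, 0 <= node l <= pi) /\
    forall h, trig_poly N h -> forall t,
      h t = \sum_l ((L l).1.[cos t] + sin t * (L l).2.[cos t]) * h (node l).
Proof.
(* The nodes have cosines in [[0, 1[]; [2 N + 1] of them exceed the degree of the
   polynomial equation in [trig_poly_eq0]. *)
pose M := N.*2.+1; pose c (l : nat) : R := l%:R / M%:R.
have M0 : 0 < M%:R :> R by rewrite ltr0n.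
have cinj : injective c.
  by move=> i j /(mulIf (lt0r_neq0 (etrans (invr_gt0 _) M0)))/eqP; rewrite eqr_nat => /eqP.
have c1 l : (l < M)%N -> -1 <= c l <= 1.
  move=> lM; apply/andP; split.
    by rewrite (@le_trans _ _ 0) ?lerN10// divr_ge0.
  by rewrite ler_pdivrMr// mul1r ler_nat ltnW.
pose node (l : 'I_M) := acos (c l).
pose V : 'M[R]_(M, N + N) := \matrix_(l, j)
  match fintype.split j with inl i => c l ^+ i | inr i => sin (node l) * c l ^+ i end.
pose P1 (q : 'cV[R]_(N + N)) : {poly R} := \poly_(j < N) (if insub j is Some i then q (lshift N i) ord0 else 0).
pose P2 (q : 'cV[R]_(N + N)) : {poly R} := \poly_(j < N) (if insub j is Some i then q (rshift N i) ord0 else 0).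
have P1E q x : (P1 q).[x] = \sum_(i < N) q (lshift N i) ord0 * x ^+ i.
  by rewrite horner_poly; apply: eq_bigr => i _; rewrite valK.
have P2E q x : (P2 q).[x] = \sum_(i < N) q (rshift N i) ord0 * x ^+ i.
  by rewrite horner_poly; apply: eq_bigr => i _; rewrite valK.
have VE q l : (V *m q) l ord0 = (P1 q).[c l] + sin (node l) * (P2 q).[c l].
  rewrite mxE big_split_ord/= P1E P2E mulr_sumr; congr +%R; apply: eq_bigr => i _.
    by rewrite mxE (unsplitK (inl i)) mulrC.
  by rewrite mxE (unsplitK (inr i)) mulrAC mulrA.
have Vinj (q : 'cV[R]_(N + N)) : V *m q = 0 -> q = 0.
  move=> Vq; have [] := @trig_poly_eq0 N (P1 q) (P2 q) c => //; [exact: size_poly..| |].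
    move=> l lM; rewrite -[l]/(val (Ordinal lM)) -/(node (Ordinal lM)) -VE Vq mxE //.
  move=> p1 p2; apply/colP => j; rewrite mxE -[j]splitK.
  case: (fintype.split j) => i /=.
    have := congr1 (fun p : {poly R} => p`_i) p1.
    by rewrite coef_poly ltn_ord valK coef0.
  have := congr1 (fun p : {poly R} => p`_i) p2.
  by rewrite coef_poly ltn_ord valK coef0.
have [W WV] : exists W : 'M[R]_(N + N, M), W *m V = 1%:M.
  have /row_freeP[W] : row_free V^T.
    apply/inj_row_free => v vV; apply: trmx_inj; rewrite trmx0; apply: Vinj.
    by rewrite -[V]trmxK -trmx_mul vV trmx0.
  move/(congr1 trmx); rewrite trmx_mul trmxK trmx1 => WV.
  by exists W^T.
exists M, node, (fun l => (P1 (col l W), P2 (col l W))); split.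
  by move=> l; rewrite acos_ge0 ?acos_lepi ?c1.
move=> h [A [B [sA sB hAB]]] t.
pose q : 'cV[R]_(N + N) := \col_j
  match fintype.split j with inl i => A`_i | inr i => B`_i end.
have AE x : A.[x] = (P1 q).[x].
  by rewrite P1E (horner_coef_wide _ sA); apply: eq_bigr => i _; rewrite mxE (unsplitK (inl i)).
have BE x : B.[x] = (P2 q).[x].
  by rewrite P2E (horner_coef_wide _ sB); apply: eq_bigr => i _; rewrite mxE (unsplitK (inr i)).
have hnode l : h (node l) = (V *m q) l ord0.
  by rewrite VE hAB AE BE acosK// in_itv/= c1.
have qE j : q j ord0 = \sum_l W j l * h (node l).
  rewrite -{1}[q]mul1mx -WV -mulmxA mxE.
  by apply: eq_bigr => l _; rewrite hnode.
rewrite hAB AE BE !P1E !P2E.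
under [RHS]eq_bigr do rewrite mulrDl P1E P2E mulr_suml mulr_sumr mulr_suml.
rewrite big_split/= mulr_sumr; congr +%R; rewrite exchange_big/=; apply: eq_bigr => i _.
  by rewrite qE mulr_suml; apply: eq_bigr => l _; rewrite mxE; ring.
by rewrite qE mulr_suml mulr_sumr; apply: eq_bigr => l _; rewrite mxE; ring.
Qed.

End trig_interpolation.

(** * Trigonometric polynomials in several angles *)

Section multivariate_trig.
Context {R : realType}.

Lemma trig_poly_le N M (h : R -> R) : (N <= M)%N -> trig_poly N h -> trig_poly M h.
Proof.
move=> NM [A [B [sA sB e]]]; exists A, B; split => //; exact: leq_trans NM.
Qed.

Lemma trig_poly_cst N c : (0 < N)%N -> trig_poly N (fun _ : R => c).
Proof.
move=> N0; exists c%:P, 0; split; rewrite ?size_poly0//.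
  by rewrite (leq_trans (size_polyC_leq1 _)).
by move=> t; rewrite hornerC horner0 mulr0 addr0.
Qed.

Lemma trig_poly_cos N : (1 < N)%N -> trig_poly N (@cos R).
Proof.
move=> N0; exists 'X, 0; split; rewrite ?size_poly0 ?size_polyX//.
by move=> t; rewrite hornerX horner0 mulr0 addr0.
Qed.

Lemma trig_poly_sin N : (0 < N)%N -> trig_poly N (@sin R).
Proof.
move=> N0; exists 0, 1; split; rewrite ?size_poly0 ?size_poly1//.
by move=> t; rewrite horner0 hornerC mulr1 add0r.
Qed.

Lemma trig_polyD N (f g : R -> R) : trig_poly N f -> trig_poly N g ->
  trig_poly N (fun t => f t + g t).
Proof.
move=> [A [B [sA sB fE]]] [A' [B' [sA' sB' gE]]]; exists (A + A'), (B + B'); split.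
- by rewrite (leq_trans (size_polyD _ _))// geq_max sA.
- by rewrite (leq_trans (size_polyD _ _))// geq_max sB.
- by move=> t; rewrite fE gE !hornerD; ring.
Qed.

Lemma trig_polyM N M (f g : R -> R) : trig_poly N f -> trig_poly M g ->
  trig_poly (N + M)%N.+2 (fun t => f t * g t).
Proof.
move=> [A [B [sA sB fE]]] [A' [B' [sA' sB' gE]]].
have sM (P Q : {poly R}) : (size P <= N)%N -> (size Q <= M)%N -> (size (P * Q)%R <= N + M)%N.
  move=> sP sQ; apply: leq_trans (size_polyMleq _ _) _.
  by apply: leq_trans (leq_pred _) _; exact: leq_add.
exists (A * A' + (1 - 'X^2) * (B * B')), (A * B' + B * A'); split.
- apply: leq_trans (size_polyD _ _) _; rewrite geq_max; apply/andP; split.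
    by rewrite (leq_trans (sM _ _ sA sA'))// -addn2 leq_addr.
  apply: leq_trans (size_polyMleq _ _) _; rewrite -subn1 leq_subLR.
  have h1 : (size (1 - 'X ^+ 2 : {poly R})%R <= 3)%N.
    by rewrite (leq_trans (size_polyD _ _))// geq_max size_polyN size_polyXn size_poly1.
  by apply: leq_trans (leq_add h1 (sM _ _ sB sB')) _; lia.
- apply: leq_trans (size_polyD _ _) _; rewrite geq_max.
  by rewrite !(leq_trans (sM _ _ _ _))// -addn2 leq_addr.
- move=> t; rewrite fE gE !hornerD !hornerM hornerD hornerN hornerC hornerXn.
  have := cos2Dsin2 t; set c := cos t; set s := sin t => cs.
  have -> : 1 - c ^+ 2 = s ^+ 2 by rewrite -cs; ring.
  ring.
Qed.

Context {m : nat}.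
Implicit Types (phi psi : 'cV[R]_m).

Definition set_angle phi (t : 'I_m) (a : R) : 'cV[R]_m :=
  \col_i if i == t then a else phi i ord0.

(** The degree is bounded in each angle separately: this is what successive
    interpolation in the coordinates needs. *)
Definition trig_degree (N : nat) (f : 'cV[R]_m -> R) : Prop :=
  forall phi t, trig_poly N (fun a => f (set_angle phi t a)).

(** The bound does not depend on the parameter, so that the same nodes serve for all
    values of the parameter, in particular under an expectation. *)
Definition trig_family Z (f : Z -> 'cV[R]_m -> R) : Prop :=
  exists N, forall z, trig_degree N (f z).

Lemma trig_family_cst Z (c : Z -> R) : trig_family (fun z _ => c z).
Proof. by exists 1 => z phi t; exact: trig_poly_cst. Qed.

Lemma trig_family_cos Z i : trig_family (fun (_ : Z) phi => cos (phi i ord0)).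
Proof.
exists 2 => z phi t; under eq_fun do rewrite mxE.
by case: (i == t); [exact: trig_poly_cos|exact: trig_poly_cst].
Qed.

Lemma trig_family_sin Z i : trig_family (fun (_ : Z) phi => sin (phi i ord0)).
Proof.
exists 2 => z phi t; under eq_fun do rewrite mxE.
by case: (i == t); [exact: trig_poly_sin|exact: trig_poly_cst].
Qed.

Lemma trig_familyD Z (f g : Z -> 'cV[R]_m -> R) :
  trig_family f -> trig_family g -> trig_family (fun z phi => f z phi + g z phi).
Proof.
move=> [N hf] [M hg]; exists (maxn N M) => z phi t.
apply: trig_polyD; [apply: trig_poly_le (hf z phi t)|apply: trig_poly_le (hg z phi t)].
  exact: leq_maxl.
exact: leq_maxr.
Qed.

Lemma trig_familyM Z (f g : Z -> 'cV[R]_m -> R) :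
  trig_family f -> trig_family g -> trig_family (fun z phi => f z phi * g z phi).
Proof.
by move=> [N hf] [M hg]; exists (N + M)%N.+2 => z phi t; exact: (trig_polyM (hf z phi t) (hg z phi t)).
Qed.

Lemma trig_family_sum Z J (r : seq J) P (F : J -> Z -> 'cV[R]_m -> R) :
  (forall j, trig_family (F j)) -> trig_family (fun z phi => \sum_(j <- r | P j) F j z phi).
Proof.
move=> h; elim: r => [|j r ih].
  under eq_fun do under eq_fun do rewrite big_nil.
  exact: trig_family_cst.
under eq_fun do under eq_fun do rewrite big_cons.
by case: (P j); [exact: trig_familyD|exact: ih].
Qed.

Lemma trig_family_prod Z J (r : seq J) P (F : J -> Z -> 'cV[R]_m -> R) :
  (forall j, trig_family (F j)) -> trig_family (fun z phi => \prod_(j <- r | P j) F j z phi).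
Proof.
move=> h; elim: r => [|j r ih].
  under eq_fun do under eq_fun do rewrite big_nil.
  exact: trig_family_cst.
under eq_fun do under eq_fun do rewrite big_cons.
by case: (P j); [exact: trig_familyM|exact: ih].
Qed.

Lemma trig_familyX Z (f : Z -> 'cV[R]_m -> R) n :
  trig_family f -> trig_family (fun z phi => f z phi ^+ n).
Proof.
move=> hf; elim: n => [|n ih]; first exact: trig_family_cst.
under eq_fun do under eq_fun do rewrite exprS.
exact: trig_familyM.
Qed.

Definition set_angles (s : seq 'I_m) psi phi : 'cV[R]_m :=
  \col_i if i \in s then psi i ord0 else phi i ord0.

(** Interpolate one coordinate after the other.  The weights do not depend on [f]. *)
Lemma trig_degree_interpolation (phi0 : 'cV[R]_m) (N : nat) :
  exists (J : finType) (w : J -> 'cV[R]_m -> R) (p : J -> 'cV[R]_m),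
    [/\ forall j, expressible phi0 (fun x => w j x.1),
       forall j i, 0 <= p j i ord0 <= pi &
       forall f, trig_degree N f -> forall phi, f phi = \sum_j w j phi * f (p j)].
Proof.
have [M [node [L [nodepi interp]]]] := @trig_poly_interpolation R N.
suff H (s : seq 'I_m) : exists (J : finType) (w : J -> 'cV[R]_m -> R) (p : J -> 'cV[R]_m),
    [/\ forall j, expressible phi0 (fun x => w j x.1),
       forall j i, 0 <= p j i ord0 <= pi &
       forall f, trig_degree N f -> forall phi,
         f phi = \sum_j w j phi * f (set_angles s (p j) phi)].
  have [J [w [p [ew p0 wf]]]] := H (enum 'I_m); exists J, w, p; split => // f hf phi.
  rewrite (wf _ hf); apply: eq_bigr => q _; congr (_ * f _).
  by apply/colP => i; rewrite mxE mem_enum.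
elim: s => [|t s [J [w [p [ew p0 wf]]]]].
  exists unit, (fun _ _ => 1), (fun=> 0); split.
  - by move=> _; exact: expressible_cst.
  - by move=> _ i; rewrite mxE lexx pi_ge0.
  - move=> f hf phi; rewrite (big_pred1 tt) => [|[]//]; rewrite mul1r; congr f.
    by apply/colP => i; rewrite mxE.
pose W l j (phi : 'cV[R]_m) : R :=
  let a := if t \in s then p j t ord0 else phi t ord0 in
  (L l).1.[cos a] + sin a * (L l).2.[cos a].
exists (J * 'I_M)%type, (fun q phi => w q.1 phi * W q.2 q.1 phi),
  (fun q => set_angle (p q.1) t (node q.2)); split.
- move=> [j l] /=; apply: expressibleM => //; rewrite /W /=; case: (t \in s).
    exact: expressible_cst.
  apply: expressibleD; first by apply: expressible_horner; exact: expressible_cos.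
  apply: expressibleM; first exact: expressible_sin.
  by apply: expressible_horner; exact: expressible_cos.
- by move=> [j l] i /=; rewrite mxE; case: eqP.
move=> f hf phi; rewrite (wf f hf) -(pair_bigA _ (fun j l => w j phi * W l j phi *
  f (set_angles (t :: s) (set_angle (p j) t (node l)) phi)))/=.
apply: eq_bigr => j _.
pose u := set_angles s (p j) phi.
have -> : f u = \sum_l W l j phi * f (set_angle u t (node l)).
  have := interp _ (hf u t) (u t ord0).
  rewrite (_ : set_angle u t (u t ord0) = u); last first.
    by apply/colP => i; rewrite mxE; case: eqP => // ->.
  by move=> ->; apply: eq_bigr => l _; rewrite /W /u mxE.
rewrite mulr_sumr; apply: eq_bigr => l _; rewrite mulrA; congr (_ * f _).
by apply/colP => i; rewrite !mxE inE; case: eqP => //= ->.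
Qed.

End multivariate_trig.

(** * The objective function along a mixture path *)

Section ell_expressible.
Context {R : realType} {p d s k : nat} (hd : (d <= p)%N).
Context (b : 'I_s -> nat) (a : 'I_k -> 'I_d -> nat).
Local Notation m := (nangles p d).
Implicit Types (F G : probability (obs R p) R) (phi : 'cV[R]_m).

Lemma LmxP F q r (M : obs R p -> 'M[R]_(q, r)) :
  Lmx F 1 M <-> forall i j, F.-integrable setT (EFin \o (fun z => M z i j)).
Proof. by split => h i j; apply/Lfun1_integrable; exact: h. Qed.

Lemma EmxE F q r (M : obs R p -> 'M[R]_(q, r)) i j :
  Emx F M i j = \int[F]_z M z i j.
Proof. by rewrite mxE fine_expectationE. Qed.

Lemma eq_Emx F G q r (M : obs R p -> 'M[R]_(q, r)) :
  (forall A, measurable A -> F A = G A) -> Emx F M = Emx G M.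
Proof.
move=> FG; apply/matrixP => i j; rewrite !EmxE /Rintegral; congr fine.
by apply: eq_measure_integral => A mA _; exact: FG.
Qed.

Definition trig_mx Z q r (M : 'cV[R]_m -> Z -> 'M[R]_(q, r)) : Prop :=
  forall i j, trig_family (fun z phi => M phi z i j).

Lemma trig_mulmx Z q r l (M : 'cV[R]_m -> Z -> 'M[R]_(q, r))
    (N : 'cV[R]_m -> Z -> 'M[R]_(r, l)) : trig_mx M -> trig_mx N ->
  trig_mx (fun phi z => M phi z *m N phi z).
Proof.
move=> hM hN i j; under eq_fun do under eq_fun do rewrite mxE.
by apply: trig_family_sum => x; exact: trig_familyM.
Qed.

Lemma trig_trmx Z q r (M : 'cV[R]_m -> Z -> 'M[R]_(q, r)) :
  trig_mx M -> trig_mx (fun phi z => (M phi z)^T).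
Proof. by move=> hM i j; under eq_fun do under eq_fun do rewrite mxE. Qed.

Lemma trig_cstmx Z q r (M : Z -> 'M[R]_(q, r)) : trig_mx (fun _ => M).
Proof. by move=> i j; exact: trig_family_cst. Qed.

Lemma trig_eta Z : trig_mx (fun phi (_ : Z) => Defs.eta hd phi).
Proof.
have hD (t : 'I_m) : trig_mx (fun phi (_ : Z) =>
    Dmx p (nth (0, 0)%N (pairs p d) t) (phi t ord0)).
  move=> i j; set ij := nth _ _ _; under eq_fun do under eq_fun do rewrite mxE.
  case: ((i == ij.1 :> nat) && (j == ij.1 :> nat)); first exact: trig_family_cos.
  case: ((i == ij.1 :> nat) && (j == ij.2 :> nat)).
    under eq_fun do under eq_fun do rewrite -mulN1r.
    by apply: trig_familyM; [exact: trig_family_cst|exact: trig_family_sin].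
  case: ((i == ij.2 :> nat) && (j == ij.1 :> nat)); first exact: trig_family_sin.
  case: ((i == ij.2 :> nat) && (j == ij.2 :> nat)); first exact: trig_family_cos.
  exact: trig_family_cst.
have hP : trig_mx (fun phi (_ : Z) => \big[mulmx/1%:M]_(t < m)
       Dmx p (nth (0, 0)%N (pairs p d) t) (phi t ord0)).
  elim: (index_enum _) => [|t r ih].
    under eq_fun do under eq_fun do rewrite big_nil.
    exact: trig_cstmx.
  under eq_fun do under eq_fun do rewrite big_cons.
  exact: trig_mulmx.
by move=> i j; under eq_fun do under eq_fun do rewrite mxE.
Qed.

Lemma trig_Gphi : trig_mx (fun phi (z : obs R p) => Gphi hd a phi z.1).
Proof.
move=> i j; under eq_fun do under eq_fun do rewrite mxE.
apply: trig_family_prod => l; apply: trig_familyX.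
by apply: trig_mulmx; [apply: trig_trmx; exact: trig_eta|exact: trig_cstmx].
Qed.

Lemma trig_XG : trig_mx (XG hd a).
Proof. exact: (trig_mulmx (trig_cstmx (fun z : obs R p => colv z.1)) (trig_trmx trig_Gphi)). Qed.

Lemma trig_GG : trig_mx (GG hd a).
Proof. exact: (trig_mulmx trig_Gphi (trig_trmx trig_Gphi)). Qed.

Lemma trig_GH : trig_mx (GH hd b a).
Proof. exact: (trig_mulmx trig_Gphi (trig_cstmx (fun z : obs R p => (Hvec b z.2)^T))). Qed.

Lemma base_filter_snd (phi0 : 'cV[R]_m) (P : set R) :
  (\forall t \near (0 : R), 0 <= t -> P t) -> \forall x \near base_filter phi0, P x.2.
Proof.
move=> nP; exists (setT, P); last by move=> x [].
by split; [exact: (@filterT _ (nbhs phi0))|exact: nP].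
Qed.

Lemma near_unit_interval (phi0 : 'cV[R]_m) : \forall x \near base_filter phi0, 0 <= x.2 <= 1.
Proof.
apply: (@base_filter_snd phi0 [set t | 0 <= t <= 1]).
by apply: filterS (lt_nbhsl_le (@ltr01 R)) => t h t0 /=; rewrite t0 h.
Qed.

Lemma Emx_mixture F0 F q r (M : obs R p -> 'M[R]_(q, r)) (t : R) : 0 <= t <= 1 ->
  Lmx F0 1 M -> Lmx F 1 M ->
  Emx (mixture F0 F t : probability _ _) M = (1 - t) *: Emx F0 M + t *: Emx F M.
Proof.
move=> t01 /LmxP h0 /LmxP h; apply/matrixP => i j.
rewrite EmxE !mxE.
rewrite !fine_expectationE.
by have [_ ->] := mixture_Rintegral t01 (h0 i j) (h i j).
Qed.

(** By interpolation, the integrand at any angles is a combination, with weights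
    free of the observation, of integrands at nodes in [Omega_phi], where the
    moments exist; the weights then come out of the expectation, which is affine
    in the weight of the mixture. *)
Lemma Emx_mixture_expressible (phi0 : 'cV[R]_m) F0 F q r
    (M : 'cV[R]_m -> obs R p -> 'M[R]_(q, r)) : trig_mx M ->
  (forall phi, Omega_phi phi -> Lmx F0 1 (M phi)) ->
  (forall phi, Omega_phi phi -> Lmx F 1 (M phi)) ->
  expressible_mx phi0 (fun x => Emx (mixture F0 F x.2 : probability _ _) (M x.1)).
Proof.
move=> tM h0 h i j; have [N hN] := tM i j.
have [J [w [ps [ew p0 wf]]]] := @trig_degree_interpolation R m phi0 N.
have MS phi : (fun z => M phi z i j) = (fun z => \sum_l w l phi * M (ps l) z i j).
  by apply/funext => z; rewrite [LHS](wf _ (hN z)).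
have i0 l : F0.-integrable setT (EFin \o (fun z => M (ps l) z i j)).
  by have /LmxP := h0 (ps l) (p0 l); exact.
have i1 l : F.-integrable setT (EFin \o (fun z => M (ps l) z i j)).
  by have /LmxP := h (ps l) (p0 l); exact.
apply: (@near_expressible _ _ _ _ (fun x => \sum_l w l x.1 *
    ((1 - x.2) * \int[F0]_z M (ps l) z i j + x.2 * \int[F]_z M (ps l) z i j))).
  apply: filterS (near_unit_interval phi0) => -[phi t] /= t01.
  rewrite EmxE MS Rintegral_sum; last first.
    move=> l; apply: integrableZlR; exact: (mixture_Rintegral t01 (i0 l) (i1 l)).1.
  apply: eq_bigr => l _; have [im <-] := mixture_Rintegral t01 (i0 l) (i1 l).
  by rewrite RintegralZl.
apply: expressible_sum => l; apply: expressibleM => //.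
apply: expressibleD; apply: expressibleM; try exact: expressible_cst.
  by apply: expressibleB; [exact: expressible_cst|exact: expressible_var].
exact: expressible_var.
Qed.

Lemma eq_ell phi F G : (forall A, measurable A -> F A = G A) ->
  ell hd b a phi F = ell hd b a phi G.
Proof.
by move=> FG; rewrite /ell /Rmx /R1 /R2 /R3 /R4 /R5 !(eq_Emx _ FG).
Qed.

Lemma mixture0 F G A : (mixture F G 0 : probability _ _) A = F A.
Proof.
rewrite /= /mixture measure_addE.
rewrite [X in (X + _)%E](_ : _ = (1 - clamp01 0)%:E * F A)%E//.
rewrite [X in (_ + X)%E](_ : _ = (clamp01 (0 : R))%:E * G A)%E//.
by rewrite clamp01_id ?lexx ?ler01// subr0 mul1e mul0e adde0.
Qed.

Lemma ell_expressible (phi0 : 'cV[R]_m) F0 F : Omega_phi phi0 ->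
  moments_exist hd b a F0 -> moments_exist hd b a F -> inverses_exist hd b a F0 ->
  expressible phi0 (fun x => ell hd b a x.1 (mixture F0 F x.2 : probability _ _)).
Proof.
move=> O0 [XH0 HH0 G0] [XH1 HH1 G1] [u5 u3].
have cmx q r (M : obs R p -> 'M[R]_(q, r)) : Lmx F0 1 M -> Lmx F 1 M ->
    expressible_mx phi0 (fun x => Emx (mixture F0 F x.2 : probability _ _) M).
  by move=> h0 h; apply: (@Emx_mixture_expressible phi0 F0 F q r (fun=> M)) => //; exact: trig_cstmx.
have e1 := cmx _ _ _ XH0 XH1; have e5 := cmx _ _ _ HH0 HH1.
have e2 : expressible_mx phi0 (fun x => R2 hd a x.1 (mixture F0 F x.2 : probability _ _)).
  by apply: Emx_mixture_expressible => [|v /G0[]|v /G1[]]//; exact: trig_XG.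
have e3 : expressible_mx phi0 (fun x => R3 hd a x.1 (mixture F0 F x.2 : probability _ _)).
  by apply: Emx_mixture_expressible => [|v /G0[]|v /G1[]]//; exact: trig_GG.
have e4 : expressible_mx phi0 (fun x => R4 hd b a x.1 (mixture F0 F x.2 : probability _ _)).
  by apply: Emx_mixture_expressible => [|v /G0[]|v /G1[]]//; exact: trig_GH.
have eR : expressible_mx phi0 (fun x => Rmx hd b a x.1 (mixture F0 F x.2 : probability _ _)).
  apply: expressible_subrmx => //; apply: expressible_mulmx => //.
  apply: expressible_mulmx => //; apply: expressible_invmx => //=.
  by rewrite /R3 (eq_Emx _ (fun A _ => mixture0 F0 F A)); exact: u3.
apply: expressible_mxtrace; apply: expressible_mulmx; last exact: expressible_trmx.
apply: expressible_mulmx => //; apply: expressible_invmx => //=.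
by rewrite /R5 (eq_Emx _ (fun A _ => mixture0 F0 F A)).
Qed.

End ell_expressible.

(** * Linearization of the first-order condition *)

Section gram.
Context {R : realType}.

Lemma sqr_linear_form q (c v : 'cV[R]_q) :
  ((c^T *m v) ord0 ord0) ^+ 2 = \sum_j \sum_i (c i ord0 * c j ord0) * (v *m v^T) i j.
Proof.
rewrite expr2 mxE mulr_sumr; apply: eq_bigr => j _; rewrite mulr_suml.
by apply: eq_bigr => i _; rewrite !mxE big_ord1 !mxE; ring.
Qed.

Lemma gram_form d (T : measurableType d) (F : probability T R) q (v : T -> 'cV[R]_q) (c : 'cV[R]_q) :
  (forall i j, F.-integrable setT (EFin \o (fun z => (v z *m (v z)^T) i j))) ->
  (c^T *m Emx F (fun z => v z *m (v z)^T) *m c) ord0 ord0 =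
  \int[F]_z ((c^T *m v z) ord0 ord0) ^+ 2.
Proof.
move=> iv.
under eq_Rintegral do rewrite sqr_linear_form.
rewrite Rintegral_sum; last by move=> j; apply: integrable_sumR => i; exact: integrableZlR.
rewrite mxE; apply: eq_bigr => j _; rewrite Rintegral_sum; last by move=> i; exact: integrableZlR.
rewrite mxE mulr_suml; apply: eq_bigr => i _.
by rewrite RintegralZl// !mxE fine_expectationE; ring.
Qed.

Definition psd q (A : 'M[R]_q) : Prop := forall c : 'cV[R]_q, 0 <= (c^T *m A *m c) ord0 ord0.

Lemma gram_psd d (T : measurableType d) (F : probability T R) q (v : T -> 'cV[R]_q) :
  (forall i j, F.-integrable setT (EFin \o (fun z => (v z *m (v z)^T) i j))) ->
  psd (Emx F (fun z => v z *m (v z)^T)).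
Proof. by move=> iv c; rewrite gram_form//; apply: Rintegral_ge0 => z _; exact: sqr_ge0. Qed.

Lemma gram_sym d (T : measurableType d) (F : probability T R) q (v : T -> 'cV[R]_q) :
  (Emx F (fun z => v z *m (v z)^T))^T = Emx F (fun z => v z *m (v z)^T).
Proof.
apply/matrixP => i j; rewrite !mxE; congr (fine 'E_F[_]); apply/funext => z.
by rewrite !mxE; apply: eq_bigr => l _; rewrite !mxE mulrC.
Qed.

(** Minimality of the form at [c]: a perturbation of [c] along [A c] would otherwise
    make it negative. *)
Lemma psd_form_eq0 q (A : 'M[R]_q) (c : 'cV[R]_q) : A^T = A -> psd A ->
  (c^T *m A *m c) ord0 ord0 = 0 -> A *m c = 0.
Proof.
move=> sA pA c0; set e := A *m c.
have ee : 0 <= (e^T *m e) ord0 ord0.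
  rewrite mxE; apply: sumr_ge0 => i _; rewrite mxE -expr2; exact: sqr_ge0.
have := pA e; set q2 := (_ *m e) _ _ => q20.
have hx (x : R) : 0 <= x ^+ 2 * q2 - 2 * x * (e^T *m e) ord0 ord0.
  have := pA (c - x *: e).
  have -> : (c - x *: e)^T = c^T - x *: e^T by rewrite linearB linearZ.
  rewrite !(mulmxBl, mulmxBr) -!(scalemxAr, scalemxAl).
  have -> : c^T *m A *m e = e^T *m e by rewrite /e trmx_mul sA.
  have -> : e^T *m A *m c = e^T *m e by rewrite -mulmxA.
  rewrite /q2; move: c0 ee; move: (c^T *m A *m c) (e^T *m e) (e^T *m A *m e) => X Y Z c0 ee.
  by rewrite !mxE c0 => h; apply: le_trans h _; rewrite le_eqVlt; apply/orP; left; apply/eqP; ring.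
have e0 : (e^T *m e) ord0 ord0 = 0.
  apply/eqP; rewrite eq_le ee andbT leNgt; apply/negP => ep.
  set w := (e^T *m e) ord0 ord0 in ee hx ep.
  have [q0|q0] := eqVneq q2 0; first by have := hx 1; rewrite q0; lra.
  have qp : 0 < q2 by rewrite lt_neqAle eq_sym q0.
  have := hx (w / q2); rewrite leNgt => /negP; apply.
  have -> : (w / q2) ^+ 2 * q2 - 2 * (w / q2) * w = - (w ^+ 2 / q2) by field.
  by rewrite oppr_lt0 divr_gt0// exprn_gt0.
apply: mulmx_tr_eq0; apply/matrixP => i j; by rewrite !ord1 e0 mxE.
Qed.

(** A kernel vector of the combination is isotropic for [A], as both forms are
    nonnegative, hence lies in the kernel of [A]. *)
Lemma psd_comb_unit q (A B : 'M[R]_q) (t : R) : 0 <= t -> t < 1 ->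
  A^T = A -> psd A -> psd B -> A \in unitmx -> (1 - t) *: A + t *: B \in unitmx.
Proof.
move=> t0 t1 sA pA pB uA; rewrite -row_free_unit; apply: inj_row_free => v vM.
have /(congr1 (fun M : 'M[R]_1 => M ord0 ord0)) : v *m ((1 - t) *: A + t *: B) *m v^T = 0.
  by rewrite vM mul0mx.
rewrite mulmxDr mulmxDl -!scalemxAr -!scalemxAl.
have := pA v^T; have := pB v^T; rewrite trmxK.
set x := v *m A *m v^T; set y := v *m B *m v^T => y0 x0.
rewrite [LHS]mxE [X in X + _]mxE [X in _ + X]mxE [RHS]mxE => e.
have xe : x ord0 ord0 = 0.
  apply/eqP; rewrite eq_le x0 andbT.
  have h1 : 0 <= t * y ord0 ord0 by rewrite mulr_ge0.
  have h2 : (1 - t) * x ord0 ord0 <= 0 by lra.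
  by rewrite -(pmulr_rle0 _ (_ : 0 < 1 - t))// subr_gt0.
have Av : A *m v^T = 0 by apply: psd_form_eq0 => //; rewrite trmxK.
have vA : v *m A = 0 by rewrite -[v *m A]trmxK trmx_mul sA Av trmx0.
by rewrite -[v](mulmxK uA) vA mul0mx.
Qed.

End gram.

Section linearization.
Context {R : realType} {p d s k : nat} (hd : (d <= p)%N).
Context (b : 'I_s -> nat) (a : 'I_k -> 'I_d -> nat).
Local Notation m := (nangles p d).

(** [R3] and [R5] are Gram matrices and affine in the distribution. *)
Lemma inverses_mixture (F0 F : probability (obs R p) R) (t : R) : 0 <= t -> t < 1 ->
  moments_exist hd b a F0 -> moments_exist hd b a F -> inverses_exist hd b a F0 ->
  inverses_exist hd b a (mixture F0 F t : probability _ _).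
Proof.
move=> t0 t1 [_ H0 G0] [_ H1 G1] [u5 u3].
have t01 : 0 <= t <= 1 by rewrite t0 ltW.
split.
  rewrite /R5 Emx_mixture//; apply: psd_comb_unit => //.
  - exact: (gram_sym F0 (fun z : obs R p => Hvec b z.2)).
  - by apply: (gram_psd (v := fun z : obs R p => Hvec b z.2)); exact/LmxP.
  - by apply: (gram_psd (v := fun z : obs R p => Hvec b z.2)); exact/LmxP.
move=> phi /[dup] O /u3 u; have [_ g0 _] := G0 _ O; have [_ g1 _] := G1 _ O.
rewrite /R3 Emx_mixture//; apply: psd_comb_unit => //.
- exact: (gram_sym F0 (fun z : obs R p => Gphi hd a phi z.1)).
- by apply: (gram_psd (v := fun z : obs R p => Gphi hd a phi z.1)); exact/LmxP.
- by apply: (gram_psd (v := fun z : obs R p => Gphi hd a phi z.1)); exact/LmxP.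
Qed.

Lemma hess_ell_sym (F0 : probability (obs R p) R) (phi0 : 'cV[R]_m) :
  Omega_phi phi0 -> moments_exist hd b a F0 -> inverses_exist hd b a F0 ->
  (hess_ell hd b a phi0 F0)^T = hess_ell hd b a phi0 F0.
Proof.
move=> O0 M0 I0; apply/matrixP => i j; rewrite !mxE.
have := hess_sym j i (ell_expressible O0 M0 M0 I0) => /=.
by rewrite (_ : (fun v => ell hd b a v _) = (fun v => ell hd b a v F0))//;
  apply/funext => v; apply: eq_ell => A _; rewrite mixture0.
Qed.

(** The minimizers at the mixtures [(1 - t) F0 + t F] satisfy the first-order
    condition, with slope [E_F phistar] at [t = 0], and the gradient at fixed
    angles has slope [E_F gstar]: implicit differentiation applies. *)
Lemma influence_linearization (FF : set (probability (obs R p) R))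
    (F0 : probability (obs R p) R) (phi : probability (obs R p) R -> 'cV[R]_m)
    (phistar gstar : obs R p -> 'cV[R]_m) (F : probability (obs R p) R) :
  convex_class FF -> FF F0 -> FF F ->
  (forall G, FF G -> moments_exist hd b a G) -> inverses_exist hd b a F0 ->
  (forall G, FF G -> inverses_exist hd b a G -> is_phi hd b a G (phi G)) ->
  influence_function FF F0 phi phistar ->
  influence_function FF F0 (fun G => grad_ell hd b a (phi F0) G) gstar ->
  hess_ell hd b a (phi F0) F0 *m Emx F phistar + Emx F gstar = 0.
Proof.
move=> conv FF0 FFF mom inv0 hphi [_ _ _ sphi] [_ _ _ sg].
have [inO _ g0] := hphi _ FF0 inv0.
have eF G v : ell hd b a v (mixture F0 G 0 : probability _ _) = ell hd b a v F0.
  by apply: eq_ell => A _; rewrite mixture0.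
have e := ell_expressible inO (mom _ FF0) (mom _ FFF) inv0.
have g0i i : partial i (fun v => ell hd b a v F0) (phi F0) = 0.
  by have := congr1 (fun v : 'cV[R]_m => v i ord0) g0; rewrite !mxE.
apply/colP => i.
have gs : has_slope 0^'+ (fun t => partial i (fun v => ell hd b a v
    (mixture F0 F t : probability _ _)) (phi F0)) 0 (Emx F gstar i ord0).
  have /= := cvg_comp _ _ (sg _ FFF) (@coord_continuous _ _ _ i ord0 (Emx F gstar)).
  apply: cvg_trans; apply: near_eq_cvg; near=> t.
  by rewrite /= !mxE g0i.
have := implicit_slope e _ _ (sphi _ FFF) gs.
rewrite /= (_ : (fun v => ell hd b a v _) = (fun v => ell hd b a v F0)); last first.
  by apply/funext => v; exact: eF.
move=> H; rewrite [in RHS]mxE -[RHS]H.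
- rewrite mxE [X in X + _]mxE; congr (_ + _); apply: eq_bigr => j _.
  by rewrite [hess_ell _ _ _ _ _ _ _]mxE.
- exact: g0i.
- near=> t; have t0 : 0 < t by near: t; exact: nbhs_right_gt.
  have t1 : t < 1 by near: t; exact: nbhs_right_lt.
  have FFt : FF (mixture F0 F t : probability _ _) by apply: conv => //; rewrite !ltW.
  have [_ _ gt0] := hphi _ FFt (inverses_mixture (ltW t0) t1 (mom _ FF0) (mom _ FFF) inv0).
  have /= := congr1 (fun v : 'cV[R]_m => v i ord0) gt0.
  rewrite [in RHS]mxE => <-.
  by rewrite [RHS]mxE.
Unshelve. all: by end_near. Qed.

End linearization.

(** * Change of variables with a density *)

Section transfer_density.
Local Open Scope ereal_scope.
Context {R : realType} d d' (O : measurableType d) (T : measurableType d').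
Variables (mu : {measure set O -> \bar R}) (nu : {measure set T -> \bar R}).
Variables (X : O -> T) (h : O -> R).
Hypotheses (mX : measurable_fun setT X) (mh : measurable_fun setT h).
Hypothesis h0 : forall x, (0 <= h x)%R.
Hypothesis nuE : forall B, measurable B -> nu B = \int[mu]_x ((\1_B (X x))%:E * (h x)%:E).
Import HBNNSimple.

Let meh : measurable_fun setT (fun x => (h x)%:E : \bar R).
Proof. exact/measurable_EFinP. Qed.

Let mindic B : measurable B -> measurable_fun setT (fun x => (\1_B (X x))%:E : \bar R).
Proof.
by move=> mB; apply/measurable_EFinP; apply: (measurableT_comp (measurable_indic mB)).
Qed.

Let transfer_nnsfun (w : {nnsfun T >-> R}) :
  \int[nu]_x (w x)%:E = \int[mu]_x ((w (X x))%:E * (h x)%:E).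
Proof.
have mw r : measurable (w @^-1` [set r]) by exact: measurable_funPTI.
transitivity (\sum_(r \in range w) (r%:E * nu (w @^-1` [set r]))).
  under eq_integral do rewrite fimfunE -fsumEFin//.
  rewrite ge0_integral_fsum//; last 2 first.
  - by move=> r; exact/measurable_EFinP/measurable_funM.
  - by move=> r x _; rewrite EFinM nnfun_muleindic_ge0.
  apply: eq_fsbigr => r _; rewrite integralZl_indic_nnsfun//.
  by rewrite integral_indic// setIT.
transitivity (\int[mu]_x (\sum_(r \in range w) (r%:E * ((\1_(w @^-1` [set r]) (X x))%:E * (h x)%:E)))).
  rewrite ge0_integral_fsum//; last 2 first.
  - by move=> r; apply: emeasurable_funM => //; apply: emeasurable_funM => //; exact: mindic.
  - move=> r x _; have [r0|r0] := leP 0%R r; first by rewrite !mule_ge0// lee_fin.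
    by rewrite preimage_nnfun0//= indic0 mul0e mule0.
  apply: eq_fsbigr => r; rewrite inE => -[y _ <-]; rewrite nuE// ge0_integralZl//.
  - by apply: emeasurable_funM => //; exact: mindic.
  - by move=> x _; rewrite mule_ge0// lee_fin.
  - by rewrite lee_fin.
apply: eq_integral => x _; rewrite [in RHS]fimfunE -fsumEFin//.
rewrite ge0_mule_fsuml; last by move=> r; rewrite EFinM nnfun_muleindic_ge0.
by apply: eq_fsbigr => r _; rewrite EFinM muleA.
Qed.

(** Both sides agree on indicators by hypothesis, hence on nonnegative simple
    functions, hence in general by monotone convergence. *)
Lemma transfer_density (w : T -> \bar R) : measurable_fun setT w -> (forall x, 0 <= w x) ->
  \int[nu]_x w x = \int[mu]_x (w (X x) * (h x)%:E).
Proof.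
move=> mw w0; pose w_ := nnsfun_approx measurableT mw.
transitivity (limn (fun n => \int[nu]_x (w_ n x)%:E)).
  rewrite -monotone_convergence//=.
  - apply: eq_integral => x _; apply/esym/cvg_lim => //=.
    by apply: cvg_nnsfun_approx => // *; exact: w0.
  - by move=> n; apply: measurableT_comp => //; exact: measurable_funTS.
  - by move=> n x _; rewrite lee_fin.
  - by move=> x _ a b ab; rewrite lee_fin//; exact/lefP/nd_nnsfun_approx.
under eq_fun do rewrite transfer_nnsfun.
rewrite -monotone_convergence//=; last 3 first.
- move=> n; apply: emeasurable_funM => //; apply/measurable_EFinP.
  by apply: measurableT_comp.
- by move=> n x _; rewrite mule_ge0// lee_fin.
- by move=> x _ a b ab; rewrite lee_wpmul2r// lee_fin//; exact/lefP/nd_nnsfun_approx.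
apply: eq_integral => x _; apply/cvg_lim => //=.
apply: cvgeZr => //.
have cw : (w_ n (X x))%:E @[n --> \oo] --> w (X x).
  by apply: cvg_nnsfun_approx => // *; exact: w0.
exact: cw.
Qed.
End transfer_density.

(** * Affine images and convolutions of normal laws *)

Section normal_affine.
Context {R : realType}.
Local Notation mu := (@lebesgue_measure R).
Implicit Types (u a s v : R).

Lemma measurable_affine u a : measurable_fun setT (fun y : R => u + a * y).
Proof. by apply: measurable_funD => //; apply: measurable_funM. Qed.

(** Both sides are measures that agree on half-open intervals. *)
Lemma lebesgue_affine u a (A : set R) : a != 0 -> measurable A ->
  mu A = (`|a|%:E * mu ((fun y => (u + a * y)%R) @^-1` A))%E.
Proof.
move=> a0 mA.
pose f : R -> measurableTypeR R := fun y => u + a * y.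
have mf : measurable_fun setT f by exact: measurable_affine.
pose pm : {measure set (measurableTypeR R) -> \bar R} :=
  measure_function_pushforward__canonical__measure_function_Measure mu mf.
pose fm : {measure set (measurableTypeR R) -> \bar R} := mscale (NngNum (normr_ge0 a)) pm.
suff H X : ocitv X -> mu X = fm X by exact: (lebesgue_measure_unique H mA).
move=> [[c d]] _ <-.
rewrite (_ : fm _ = `|a|%:E * mu (f @^-1` `]c, d]%classic))%E; last by [].
have an : 0 < `|a| by rewrite normr_gt0.
have [ap|aN] := ltP 0 a.
  rewrite (_ : f @^-1` _ = `](c - u) / a, (d - u) / a]%classic); last first.
    apply/seteqP; split => x /=; rewrite !in_itv/= /f ltr_pdivrMr// ler_pdivlMr//;
    by rewrite ltrBlDl lerBrDl mulrC.
  rewrite !lebesgue_measure_itv/= !lte_fin ltr_pM2r ?invr_gt0// ltrD2r.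
  case: ifPn => _; last by rewrite mule0.
  by rewrite gtr0_norm// -!EFinD -EFinM; congr EFin; field; rewrite gt_eqF.
have {}aN : a < 0 by rewrite lt_neqAle a0.
rewrite (_ : f @^-1` _ = `[(d - u) / a, (c - u) / a[%classic); last first.
  apply/seteqP; split => x /=; rewrite !in_itv/= /f ler_ndivrMr// ltr_ndivlMr// => /andP[h1 h2];
  by apply/andP; split; lra.
rewrite !lebesgue_measure_itv/= !lte_fin ltr_nM2r ?invr_lt0// ltrD2r.
case: ifPn => _; last by rewrite mule0.
by rewrite ltr0_norm// -!EFinD -EFinM; congr EFin; field; rewrite lt_eqF.
Qed.

Lemma integral_affine u a (g : R -> \bar R) : a != 0 -> measurable_fun setT g ->
  (forall x, 0 <= g x)%E ->
  (\int[mu]_x g x = `|a|%:E * \int[mu]_y g (u + a * y)%R)%E.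
Proof.
move=> a0 mg g0.
pose f : R -> measurableTypeR R := fun y => u + a * y.
have mf : measurable_fun setT f by exact: measurable_affine.
pose pm : {measure set (measurableTypeR R) -> \bar R} :=
  measure_function_pushforward__canonical__measure_function_Measure mu mf.
pose fm : {measure set (measurableTypeR R) -> \bar R} := mscale (NngNum (normr_ge0 a)) pm.
transitivity (\int[fm]_x g x)%E.
  by apply: eq_measure_integral => A mA _; exact: (lebesgue_affine u a0 mA).
by rewrite ge0_integral_mscale// ge0_integral_pushforward.
Qed.

Lemma normal_probE m s (A : set R) : measurable A ->
  normal_prob m s A = (\int[mu]_x ((\1_A x)%:E * (normal_pdf m s x)%:E))%E.
Proof.
move=> mA; rewrite /normal_prob integral_mkcond; apply: eq_integral => x _.
by rewrite patchE indicE; case: (x \in A); rewrite ?mul1e ?mul0e.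
Qed.

Lemma measurable_indic_normal m s (A : set R) : measurable A ->
  measurable_fun setT (fun x => (\1_A x)%:E * (normal_pdf m s x)%:E)%E.
Proof.
move=> mA; apply: emeasurable_funM; apply/measurable_EFinP; first exact: measurable_indic.
exact: measurable_normal_pdf.
Qed.

Lemma normal_pdf_affine u a y : a != 0 ->
  `|a| * normal_pdf u `|a| (u + a * y) = normal_pdf 0 1 y.
Proof.
move=> a0; rewrite !normal_pdfE ?oner_eq0 ?normr_eq0// mulrA; congr (_ * _).
  rewrite /normal_peak expr1n mul1r real_normK ?num_real// -mulrnAr sqrtrM ?sqr_ge0//.
  by rewrite sqrtr_sqr invfM mulrA divff ?mul1r ?normr_eq0.
rewrite /normal_fun; congr expR; rewrite real_normK ?num_real// expr1n subr0 addrC addKr.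
by field.
Qed.

Lemma normal_prob_affine u a (A : set R) : a != 0 -> measurable A ->
  normal_prob u `|a| A = normal_prob 0 1 ((fun y => u + a * y) @^-1` A).
Proof.
move=> a0 mA.
have mA' : measurable ((fun y => u + a * y) @^-1` A).
  by rewrite -[_ @^-1` _]setTI; exact: measurable_affine.
rewrite !normal_probE// (@integral_affine u a)//; last 2 first.
- exact: measurable_indic_normal.
- by move=> x; rewrite mule_ge0// lee_fin ?normal_pdf_ge0.
rewrite -ge0_integralZl//.
  by apply: eq_integral => y _; rewrite muleCA -EFinM normal_pdf_affine.
- have h := measurable_indic_normal u `|a| mA.
  by apply: (measurableT_comp h); exact: measurable_affine.
- by move=> x _; rewrite mule_ge0// lee_fin ?normal_pdf_ge0.
Qed.

Lemma measurable_id_R : measurable_fun setT (id : measurableTypeR R -> R).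
Proof. by move=> _ B mB; rewrite setTI. Qed.

(** The normal law, carried over to the sigma-algebra that the type of reals
    inherits by default, so that it can be multiplied with other laws on reals. *)
Definition gauss m s : probability R R :=
  distribution (normal_prob m s)
    (HB.pack (id : measurableTypeR R -> R) (isMeasurableFun.Build _ _ _ _ _ measurable_id_R)).

Lemma gaussE m s A : gauss m s A = normal_prob m s A.
Proof. by []. Qed.

Lemma integral_gauss m s (w : R -> \bar R) : measurable_fun setT w ->
  (forall x, 0 <= w x)%E ->
  (\int[gauss m s]_x w x = \int[mu]_x (w x * (normal_pdf m s x)%:E))%E.
Proof.
move=> mw w0; apply: (@transfer_density _ _ _ _ _ mu (gauss m s) (id : measurableTypeR R -> R)) => //.
- exact: measurable_normal_pdf.
- by move=> x; exact: normal_pdf_ge0.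
- by move=> B mB; rewrite -normal_probE.
Qed.

(** Completing the square: the joint density of [(u, s)] factors into the marginal
    density of [s] and the conditional density of [u]. *)
Lemma normal_pdf_mul a t (s u : R) : a != 0 -> 0 < t ->
  normal_pdf u `|a| s * normal_pdf 0 (Num.sqrt t) u =
  normal_pdf 0 (Num.sqrt (t + a ^+ 2)) s *
    normal_pdf (s * t / (t + a ^+ 2)) (Num.sqrt (t * a ^+ 2 / (t + a ^+ 2))) u.
Proof.
move=> a0 t0; have a2 : 0 < a ^+ 2 by rewrite exprn_even_gt0.
have ta : 0 < t + a ^+ 2 by exact: addr_gt0.
have q0 : 0 < t * a ^+ 2 / (t + a ^+ 2) by rewrite divr_gt0// mulr_gt0.
rewrite !normal_pdfE ?normr_eq0// ?gt_eqF ?sqrtr_gt0//.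
rewrite /normal_peak /normal_fun !sqr_sqrtr ?(ltW ta, ltW t0, ltW q0)// real_normK ?num_real//.
rewrite mulrACA [RHS]mulrACA -!expRD; congr (_ * expR _).
  have p2 (x : R) : 0 < x -> Num.sqrt (x * pi *+ 2) = Num.sqrt x * Num.sqrt (pi *+ 2).
    by move=> x0; rewrite -mulrnAr sqrtrM// ltW.
  rewrite !p2// -!invfM mulrACA [in RHS]mulrACA; congr (_ * _)^-1.
  by rewrite -!sqrtrM ?ltW//; congr Num.sqrt; field; rewrite gt_eqF.
by field; rewrite a0 !gt_eqF.
Qed.

(** Integrate the factorized joint density first with respect to [u]. *)
Lemma normal_convolution a t (A : set R) : a != 0 -> 0 < t -> measurable A ->
  (\int[gauss 0 (Num.sqrt t)]_u normal_prob u `|a| A =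
   normal_prob 0 (Num.sqrt (t + a ^+ 2)) A)%E.
Proof.
move=> a0 t0 mA; have an0 : `|a| != 0 by rewrite normr_eq0.
pose q u s := ((\1_A s)%:E * (normal_pdf u `|a| s * normal_pdf 0 (Num.sqrt t) u)%:E)%E.
have mpdf2 : measurable_fun setT (fun z : R * R => normal_pdf z.1 `|a| z.2).
  rewrite (_ : (fun z => _) = (fun z : R * R => normal_pdf 0 `|a| (z.2 - z.1))).
    apply: (measurableT_comp (measurable_normal_pdf 0 `|a|)).
    by apply: measurable_funB.
  apply/funext => z; rewrite !normal_pdfE// /normal_fun; congr (_ * expR _).
  by rewrite subr0.
have mq : measurable_fun setT (fun z : R * R => q z.1 z.2).
  apply: emeasurable_funM; apply/measurable_EFinP.
    exact: (measurableT_comp (measurable_indic mA)).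
  apply: measurable_funM => //.
  exact: (measurableT_comp (measurable_normal_pdf 0 (Num.sqrt t))).
have q0 (z : R * R) : (0 <= q z.1 z.2)%E.
  by rewrite mule_ge0// lee_fin ?mulr_ge0 ?normal_pdf_ge0.
transitivity (\int[mu]_u \int[mu]_s q u s)%E.
  rewrite integral_gauss//; last first.
    rewrite (_ : (fun u => _) = fubini_F mu (fun z : R * R =>
        (\1_A z.2)%:E * (normal_pdf z.1 `|a| z.2)%:E)%E); last first.
      by apply/funext => u; rewrite normal_probE.
    apply: measurable_fun_fubini_tonelli_F => [|z]; last first.
      by rewrite mule_ge0// lee_fin ?normal_pdf_ge0.
    apply: emeasurable_funM; apply/measurable_EFinP => //.
    exact: (measurableT_comp (measurable_indic mA)).
  apply: eq_integral => u _; rewrite normal_probE// -ge0_integralZr//; last 3 first.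
  - exact: measurable_indic_normal.
  - by move=> x _; rewrite mule_ge0// lee_fin ?normal_pdf_ge0.
  - by rewrite lee_fin normal_pdf_ge0.
  by apply: eq_integral => s _; rewrite /q EFinM muleA.
rewrite (@fubini_tonelli _ _ _ _ _ mu mu (fun z : R * R => q z.1 z.2))//=.
rewrite normal_probE//; apply: eq_integral => s _.
under eq_integral do rewrite /q normal_pdf_mul// EFinM muleA.
rewrite ge0_integralZl//; first by rewrite integral_normal_pdf mule1.
- by apply/measurable_EFinP; exact: measurable_normal_pdf.
- by move=> x _; rewrite lee_fin normal_pdf_ge0.
- by rewrite mule_ge0// lee_fin ?normal_pdf_ge0.
Qed.

End normal_affine.

(** * Existence of multivariate normal laws *)

Section normal_existence.
Context {R : realType}.

Lemma measurable_normal_shift (a : R) (A : set R) : measurable A ->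
  measurable_fun setT (fun u : R => gauss 0 1 ((fun y : R => u + a * y) @^-1` A)).
Proof.
move=> mA.
have mB : measurable [set z : R * R | A (z.1 + a * z.2)].
  rewrite -[X in measurable X]setTI.
  have mf : measurable_fun setT (fun z : R * R => z.1 + a * z.2).
    by apply: measurable_funD => //; apply: measurable_funM.
  exact: mf.
rewrite (_ : (fun u : R => _) = gauss 0 1 \o xsection [set z : R * R | A (z.1 + a * z.2)]).
  exact: (measurable_fun_xsection (gauss 0 1)).
by apply/funext => u /=; congr (gauss 0 1 _); apply/seteqP; split => y; rewrite /xsection /= inE.
Qed.

(** The degenerate cases [v = 0] and [a = 0] are included, since covariance matrices
    may be singular. *)
Lemma normal_var_convolution (kappa : probability R R) (v a : R) (A : set R) :
  0 <= v -> measurable A -> (forall B, measurable B -> kappa B = normal_var v B) ->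
  (\int[kappa]_u gauss 0 1 ((fun y => (u + a * y)%R) @^-1` A) =
   normal_var (v + a ^+ 2) A)%E.
Proof.
move=> v0 mA kE; have [a0|a0] := eqVneq a 0.
  rewrite a0 expr0n/= addr0 -kE// -[in RHS](setIT A) -integral_indic//.
  apply: eq_integral => u _; rewrite indicE.
  have [uA|uA] := boolP (u \in A).
    rewrite (_ : _ @^-1` _ = setT) ?probability_setT//.
    by apply/seteqP; split => // y _ /=; rewrite mul0r addr0; rewrite inE in uA.
  rewrite (_ : _ @^-1` _ = set0) ?measure0//.
  by apply/seteqP; split => // y /=; rewrite mul0r addr0 => uA'; rewrite notin_setE in uA.
under eq_integral do rewrite gaussE -normal_prob_affine//.
have a2 : 0 < a ^+ 2 by rewrite exprn_even_gt0.
rewrite [in RHS]/normal_var gt_eqF ?ltr_wpDl//.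
have [ve|ve] := eqVneq v 0.
  rewrite ve add0r sqrtr_sqr.
  transitivity (\int[\d_(0%R : R)]_u normal_prob u `|a|%R A)%E.
    by apply: eq_measure_integral => B mB _; have := kE _ mB; rewrite ve /normal_var eqxx => e; exact: e.
  rewrite integral_dirac// ?diracT ?mul1e//.
  under eq_fun do rewrite normal_prob_affine// -gaussE.
  exact: measurable_normal_shift.
rewrite -normal_convolution//; last by rewrite lt_neqAle eq_sym ve.
apply: (eq_measure_integral (gauss 0 (Num.sqrt v))) => B mB _.
by have := kE _ mB; rewrite /normal_var (negbTE ve) => e; exact: e.
Qed.

Lemma linear_formE q (c : 'cV[R]_q) (x : q.-tuple R) :
  (c^T *m colv x) ord0 ord0 = \sum_i c i ord0 * tnth x i.
Proof. by rewrite mxE; apply: eq_bigr => i _; rewrite !mxE. Qed.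

Lemma measurable_linear_form q (c : 'cV[R]_q) :
  measurable_fun setT (fun x : q.-tuple R => (c^T *m colv x) ord0 ord0).
Proof.
under eq_fun do rewrite linear_formE.
by apply: measurable_sum => i; apply: measurable_funM => //; exact: measurable_tnth.
Qed.

Definition gauss_shift q (m : 'cV[R]_q) (z : q.-tuple R * R) : q.-tuple R :=
  rowt (colv z.1 + z.2 *: m).

Lemma measurable_gauss_shift q (m : 'cV[R]_q) : measurable_fun setT (gauss_shift m).
Proof.
apply/measurable_fun_tnthP => i; rewrite (_ : _ \o _ = fun z => tnth z.1 i + z.2 * m i ord0); last first.
  by apply/funext => z; rewrite /= tnth_mktuple !mxE.
apply: measurable_funD; last exact: measurable_funM.
exact: (measurableT_comp (measurable_tnth i)).
Qed.

(** Adding an independent standard normal multiple of [m] adds [(c^T m) ^ 2] to the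
    variance of each linear form [c]. *)
Lemma is_normal0_add q (N : probability (q.-tuple R) R) (L : 'M[R]_q) (m : 'cV[R]_q) :
  psd L -> is_normal0 N L ->
  exists N' : probability (q.-tuple R) R, is_normal0 N' (L + m *m m^T).
Proof.
move=> pL hN.
pose fM : {mfun _ >-> _} := HB.pack (gauss_shift m)
  (isMeasurableFun.Build _ _ _ _ _ (measurable_gauss_shift m)).
exists (distribution (N \x gauss 0 1)%E fM) => c A mA.
pose lM : {mfun _ >-> _} := HB.pack (fun x : q.-tuple R => (c^T *m colv x) ord0 ord0)
  (isMeasurableFun.Build _ _ _ _ _ (measurable_linear_form c)).
pose a := (c^T *m m) ord0 ord0.
have -> : (c^T *m (L + m *m m^T) *m c) ord0 ord0 = (c^T *m L *m c) ord0 ord0 + a ^+ 2.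
  rewrite mulmxDr mulmxDl mxE; congr +%R; rewrite !mulmxA -mulmxA mxE big_ord1 expr2.
  by congr (_ * _); rewrite -[m^T *m c]trmxK trmx_mul trmxK mxE.
rewrite -(@normal_var_convolution (distribution N lM))//; last first.
  by move=> B mB; rewrite -hN.
rewrite ge0_integral_distribution//; last exact: measurable_normal_shift.
rewrite /distribution /pushforward /= /product_measure1.
apply: eq_integral => x _ /=; congr (gauss 0 1 _).
have e y : (c^T *m colv (gauss_shift m (x, y))) ord0 ord0 =
    (c^T *m colv x) ord0 ord0 + a * y.
  rewrite (_ : colv _ = colv x + y *: m); last first.
    by apply/colP => i; rewrite mxE tnth_mktuple !mxE.
  by rewrite mulmxDr -scalemxAr mxE [X in _ + X]mxE mulrC.
by apply/seteqP; split => y; rewrite /xsection /= inE/= e.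
Qed.

Lemma is_normal0_0 q : exists N : probability (q.-tuple R) R, is_normal0 N (0 : 'M[R]_q).
Proof.
exists (dirac (rowt (0 : 'cV[R]_q))) => c A mA.
rewrite mulmx0 mul0mx mxE /normal_var eqxx !diracE; congr ((_ : bool)%:R%:E).
have e : (c^T *m colv (rowt (0 : 'cV[R]_q))) ord0 ord0 = 0.
  rewrite (_ : colv _ = 0) ?mulmx0 ?mxE//.
  by apply/colP => i; rewrite mxE tnth_mktuple.
by apply/idP/idP; rewrite !inE/= e.
Qed.

(** One step of the Cholesky decomposition: it clears row [i] and keeps cleared rows
    cleared, whether or not the matrix is definite. *)
Lemma psd_split q (L : 'M[R]_q) (i : 'I_q) : L^T = L -> psd L ->
  exists m : 'cV[R]_q, [/\ psd (L - m *m m^T), (L - m *m m^T)^T = L - m *m m^T &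
    (forall j, (L - m *m m^T) i j = 0) /\
    forall k, (forall j, L k j = 0) -> forall j, (L - m *m m^T) k j = 0].
Proof.
move=> sL pL; pose e : 'cV[R]_q := delta_mx i ord0.
have symE j k : L j k = L k j by rewrite -{1}sL mxE.
have eL (c : 'cV[R]_q) : (c^T *m L *m e) ord0 ord0 = \sum_j c j ord0 * L j i.
  by rewrite -colE !mxE; apply: eq_bigr => j _; rewrite !mxE.
have ee : (e^T *m L *m e) ord0 ord0 = L i i.
  rewrite eL (bigD1 i)//= mxE !eqxx mul1r big1 ?addr0// => j /negPf ji.
  by rewrite mxE ji mul0r.
have := pL e; rewrite ee le_eqVlt => /predU1P[/esym a0|a0].
  have Le : L *m e = 0 by apply: psd_form_eq0 => //; rewrite ee.
  have Li j : L i j = 0.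
    by rewrite symE; have := congr1 (fun M : 'cV[R]_q => M j ord0) Le; rewrite -colE !mxE.
  by exists 0; rewrite mul0mx subr0; split.
pose r := Num.sqrt (L i i); have r0 : r != 0 by rewrite gt_eqF ?sqrtr_gt0.
have r2 : r ^+ 2 = L i i by rewrite sqr_sqrtr// ltW.
pose m : 'cV[R]_q := r^-1 *: col i L.
have mE j : m j ord0 = L j i / r by rewrite !mxE mulrC.
have LmE j k : (L - m *m m^T) j k = L j k - L j i * L k i / L i i.
  by rewrite mxE [X in _ + X]mxE mxE big_ord1 [m^T _ _]mxE !mE -r2; congr (_ - _); field.
exists m; split.
- move=> c.
  have -> : (c^T *m (L - m *m m^T) *m c) ord0 ord0 =
      (c^T *m L *m c) ord0 ord0 - (c^T *m (m *m m^T) *m c) ord0 ord0.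
    by rewrite mulmxBr mulmxBl [LHS]mxE; congr (_ + _); rewrite [LHS]mxE.
  set u := (c^T *m L *m e) ord0 ord0; set t := u / L i i.
  have -> : (c^T *m (m *m m^T) *m c) ord0 ord0 = u ^+ 2 / L i i.
    have -> : c^T *m (m *m m^T) *m c = (c^T *m m) *m (c^T *m m)^T.
      by rewrite trmx_mul trmxK !mulmxA.
    have -> : c^T *m m = (u / r)%:M.
      rewrite [LHS]mx11_scalar; congr (_%:M); rewrite /u eL mxE mulr_suml.
      by apply: eq_bigr => j _; rewrite mE mxE mulrA.
    by rewrite tr_scalar_mx -scalar_mxM mxE eqxx mulr1n -r2; field.
  have := pL (c - t *: e).
  have -> : (c - t *: e)^T = c^T - t *: e^T by rewrite linearB linearZ.
  rewrite !(mulmxBl, mulmxBr) -!(scalemxAr, scalemxAl).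
  have -> : (e^T *m L *m c) = c^T *m L *m e.
    have tr1 (X : 'M[R]_1) : X^T = X by rewrite [X]mx11_scalar tr_scalar_mx.
    by rewrite -[RHS]tr1 !trmx_mul trmxK sL mulmxA.
  move: (c^T *m L *m c) ee => X; rewrite /t /u; move: (c^T *m L *m e) (e^T *m L *m e) => Y Z.
  rewrite !mxE => ee h; apply: le_trans h _; rewrite ee le_eqVlt; apply/orP; left; apply/eqP.
  by field; rewrite gt_eqF.
- by rewrite linearB/= sL trmx_mul trmxK.
- split=> [j|k Lk j]; rewrite LmE.
    by rewrite (symE j i); field; rewrite gt_eqF.
  by rewrite !Lk !mul0r subrr.
Qed.

(** Subtract rank-one matrices until [0] is reached, then build the law back from
    the point mass at the origin. *)
Lemma is_normal0_exists q (L : 'M[R]_q) : L^T = L -> psd L ->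
  exists N : probability (q.-tuple R) R, is_normal0 N L.
Proof.
suff H (s : seq 'I_q) (M : 'M[R]_q) : (forall i, i \notin s -> forall j, M i j = 0) ->
    M^T = M -> psd M -> exists N : probability (q.-tuple R) R, is_normal0 N M.
  by apply: (H (enum 'I_q)) => i; rewrite mem_enum.
elim: s M => [|i s ih] M hM sM pM.
  by rewrite (_ : M = 0); [exact: is_normal0_0|apply/matrixP => i j; rewrite hM// mxE].
have [m [pm sm [mi mk]]] := psd_split i sM pM.
have [|N hN] := ih (M - m *m m^T) _ sm pm.
  move=> l ls; have [->|li] := eqVneq l i; first exact: mi.
  by apply: mk; apply: hM; rewrite inE negb_or li.
have [N' hN'] := is_normal0_add m pm hN; exists N'.
by rewrite subrK in hN'.
Qed.

End normal_existence.

(** * Powers of a characteristic function *)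

Section characteristic_recursion.
Context {R : realType}.

Lemma expRN_le (x : R) : 0 <= x -> `|expR (- x) - 1 + x| <= x ^+ 2.
Proof.
move=> x0; have h1 : 1 - x <= expR (- x) by exact: expR_ge1Dx.
have h2 : expR (- x) * (1 + x) <= 1.
  by rewrite -[leRHS](expRxMexpNx_1 x) mulrC ler_wpM2r ?expR_ge0// expR_ge1Dx.
have e0 := expR_ge0 (- x); rewrite ger0_norm; last by lra.
have : (1 - x + x ^+ 2) * (1 + x) >= 1 by rewrite (_ : _ * _ = 1 + x ^+ 3); [rewrite lerDl exprn_ge0|ring].
move=> h3; rewrite -[leRHS](addKr (1 - x)) addrC -lerBrDr.
have : expR (- x) * (1 + x) <= (1 - x + x ^+ 2) * (1 + x) by exact: le_trans h2 h3.
by rewrite ler_pM2r; lra.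
Qed.

(** [a + i b] is the [k]th power of [al + i be].  Replacing one factor by [rho]
    costs at most [|al - rho| + |be|] because all factors have modulus at most
    [1]. *)
Lemma char_recursion_bound (al be rho : R) (a b : nat -> R) :
  0 <= rho <= 1 -> a 0%N = 1 -> b 0%N = 0 ->
  (forall k, a k.+1 = a k * al - b k * be) ->
  (forall k, b k.+1 = b k * al + a k * be) ->
  (forall k, `|a k| <= 1) -> (forall k, `|b k| <= 1) ->
  forall k, `|a k - rho ^+ k| <= k%:R * (`|al - rho| + `|be|) /\
            `|b k| <= k%:R * (`|al - rho| + `|be|).
Proof.
case/andP=> r0 r1 a0 b0 aS bS a1 b1; elim=> [|k [iha ihb]].
  by rewrite a0 b0 expr0 subrr normr0 mul0r.
rewrite -natr1 mulrDl mul1r; set D := `|al - rho| + `|be| in iha ihb *; split.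
  have -> : a k.+1 - rho ^+ k.+1 =
      rho * (a k - rho ^+ k) + (a k * (al - rho) - b k * be) by rewrite aS exprS; ring.
  apply: le_trans (ler_normD _ _) _; apply: lerD.
    by rewrite normrM ger0_norm// (le_trans _ iha)// ler_piMl.
  apply: le_trans (ler_normB _ _) _; rewrite !normrM.
  by apply: lerD; rewrite ler_piMl.
have -> : b k.+1 = rho * b k + (b k * (al - rho) + a k * be) by rewrite bS; ring.
apply: le_trans (ler_normD _ _) _; apply: lerD.
  by rewrite normrM ger0_norm// (le_trans _ ihb)// ler_piMl.
apply: le_trans (ler_normD _ _) _; rewrite !normrM.
by apply: lerD; rewrite ler_piMl.
Qed.

Lemma cvg_invS : (fun n : nat => n.+1%:R^-1 : R) @ \oo --> 0.
Proof. exact: cvg_harmonic. Qed.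

(** Compare with the powers of [rho n = exp (- v / (2 (n + 1)))], whose [(n + 1)]st
    power is the limit; the hypotheses say that a single factor differs from
    [rho n] by [o (1 / n)]. *)
Lemma char_recursion_cvg (v : R) (al be : nat -> R) (a b : nat -> nat -> R) : 0 <= v ->
  (forall n, a n 0%N = 1) -> (forall n, b n 0%N = 0) ->
  (forall n k, a n k.+1 = a n k * al n - b n k * be n) ->
  (forall n k, b n k.+1 = b n k * al n + a n k * be n) ->
  (forall n k, `|a n k| <= 1) -> (forall n k, `|b n k| <= 1) ->
  (fun n => n.+1%:R * (al n - 1 + v / 2 / n.+1%:R)) @ \oo --> (0 : R) ->
  (fun n => n.+1%:R * be n) @ \oo --> (0 : R) ->
  (fun n => a n n.+1) @ \oo --> expR (- (v / 2)) /\ (fun n => b n n.+1) @ \oo --> (0 : R).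
Proof.
move=> v0 a0 b0 aS bS a1 b1 cal cbe.
pose x n := v / 2 / n.+1%:R; pose rho n := expR (- x n).
have x0 n : 0 <= x n by rewrite !divr_ge0.
have rho01 n : 0 <= rho n <= 1 by rewrite expR_ge0 expR_le1 oppr_le0 x0.
have rhoX n : rho n ^+ n.+1 = expR (- (v / 2)).
  by rewrite /rho -expRM_natl; congr expR; rewrite /x mulrN mulrC divfK// pnatr_eq0.
have crho : (fun n => n.+1%:R * (rho n - 1 + x n)) @ \oo --> (0 : R).
  apply/cvgr0Pnorm_le => e e0.
  have : (fun n => (v / 2) ^+ 2 * n.+1%:R^-1) @ \oo --> (v / 2) ^+ 2 * 0.
    by apply: cvgM; [exact: cvg_cst|exact: cvg_invS].
  rewrite mulr0 => /cvgr0Pnorm_le/(_ e e0); apply: filterS => n; apply: le_trans.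
  rewrite normrM ger0_norm// (le_trans (ler_wpM2l _ (expRN_le (x0 n))))//.
  rewrite ger0_norm ?mulr_ge0 ?sqr_ge0// le_eqVlt /x; apply/orP; left; apply/eqP.
  have : n.+1%:R != 0 :> R by rewrite pnatr_eq0.
  by move: (n.+1%:R) => N N0; field.
pose D n := n.+1%:R * (`|al n - rho n| + `|be n|).
have cD : D @ \oo --> (0 : R).
  have -> : D = fun n => `|n.+1%:R * (al n - 1 + v / 2 / n.+1%:R) - n.+1%:R * (rho n - 1 + x n)|
      + `|n.+1%:R * be n|.
    apply/funext => n; rewrite /D mulrDr normrM [`|n.+1%:R|]ger0_norm// -mulrBr normrM.
    by rewrite [`|n.+1%:R|]ger0_norm//; congr (_ * `|_| + _); rewrite /x; ring.
  rewrite -[0 in X in _ --> X]addr0; apply: cvgD.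
    by rewrite -(normr0 R); apply: cvg_norm; rewrite -[0 in X in _ --> X]subr0; exact: cvgB.
  by rewrite -(normr0 R); exact: cvg_norm.
have bound n := char_recursion_bound (rho01 n) (a0 n) (b0 n) (aS n) (bS n) (a1 n) (b1 n) n.+1.
split.
  apply/subr_cvg0; apply: norm_cvg0.
  apply: (squeeze_cvgr _ (cvg_cst 0) cD); near=> n.
  by rewrite normr_ge0 -(rhoX n); have [] := bound n.
apply: norm_cvg0; apply: (squeeze_cvgr _ (cvg_cst 0) cD); near=> n.
by rewrite normr_ge0; have [] := bound n.
Unshelve. all: by end_near. Qed.

End characteristic_recursion.

(** * Second-order expansion of a characteristic function *)

Section taylor.
Context {R : realType} d (T : measurableType d) (F : probability T R).

(** Dominated convergence for real-valued integrals. *)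
Lemma Rintegral_cvg (g_ : nat -> T -> R) (g G : T -> R) :
  (forall n, measurable_fun setT (g_ n)) -> measurable_fun setT g ->
  (forall x, g_ n x @[n --> \oo] --> g x) ->
  F.-integrable setT (EFin \o G) -> (forall n x, `|g_ n x| <= G x) ->
  \int[F]_x g_ n x @[n --> \oo] --> \int[F]_x g x.
Proof.
move=> mg_ mg cg iG gG.
have m1 n : measurable_fun setT (fun x => (g_ n x)%:E) by exact/measurable_EFinP.
have m2 : measurable_fun setT (fun x => (g x)%:E) by exact/measurable_EFinP.
have c : \forall x \ae F, setT x -> (g_ n x)%:E @[n --> \oo] --> (g x)%:E.
  by apply: aeW => x _; apply: cvg_EFin; [near=> n|exact: cg].
have bd : \forall x \ae F, forall n, setT x -> (`|(g_ n x)%:E| <= (EFin \o G) x)%E.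
  by apply: aeW => x n _; rewrite lee_fin.
have [i0 _ c0] := dominated_convergence measurableT m1 m2 c iG bd.
apply: fine_cvg; rewrite /Rintegral fineK//.
exact: (integrable_fin_num measurableT i0).
Unshelve. all: by end_near. Qed.

Variable f : T -> R.
Hypothesis mf : measurable_fun setT f.
Hypothesis if2 : F.-integrable setT (EFin \o (fun x => f x ^+ 2)).

Let h (n : nat) : R := Num.sqrt n.+1%:R^-1.

Let h2 n : h n ^+ 2 = n.+1%:R^-1.
Proof. by rewrite sqr_sqrtr// invr_ge0. Qed.

Let h0 n : 0 <= h n. Proof. exact: sqrtr_ge0. Qed.

Let ch : h @ \oo --> (0 : R).
Proof.
rewrite -[0 in X in _ --> X](@sqrtr0 R).
by apply: (@cvg_comp _ _ _ (fun n : nat => n.+1%:R^-1 : R) Num.sqrt); [exact: cvg_invS|exact: sqrt_continuous].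
Qed.

Let mcos n : measurable_fun setT (fun x => cos (h n * f x)).
Proof.
apply: (measurableT_comp (@measurable_cosR R)).
exact: measurable_funM.
Qed.

Let msin n : measurable_fun setT (fun x => sin (h n * f x)).
Proof.
apply: (measurableT_comp (@measurable_sinR R)).
exact: measurable_funM.
Qed.

Let icos n : F.-integrable setT (EFin \o (fun x => cos (h n * f x))).
Proof. by apply: (@bounded_integrable _ _ _ _ _ 1) => // x; exact: cos_max. Qed.

Let isin n : F.-integrable setT (EFin \o (fun x => sin (h n * f x))).
Proof. by apply: (@bounded_integrable _ _ _ _ _ 1) => // x; exact: sin_max. Qed.

Let nh n : n.+1%:R * h n ^+ 2 = 1.
Proof. by rewrite h2 mulfV// pnatr_eq0. Qed.

Let hf2 n x : n.+1%:R * (h n * f x) ^+ 2 = f x ^+ 2.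
Proof. by rewrite exprMn mulrA nh mul1r. Qed.

(** The integrand of the rescaled remainder tends to [0] by the fourth-order bound on
    the cosine and is dominated by [f ^ 2] by the second-order one, so that two
    moments suffice. *)
Lemma char_cos_taylor :
  n.+1%:R * (\int[F]_x cos (h n * f x) - 1 + (\int[F]_x f x ^+ 2) / 2 / n.+1%:R)
    @[n --> \oo] --> (0 : R).
Proof.
pose g n x := n.+1%:R * (cos (h n * f x) - 1 + (h n * f x) ^+ 2 / 2).
have -> : (fun n => n.+1%:R * (\int[F]_x cos (h n * f x) - 1 + (\int[F]_x f x ^+ 2) / 2 / n.+1%:R)) =
   (fun n => \int[F]_x g n x).
  apply/funext => n.
  have -> : \int[F]_x g n x = \int[F]_x (n.+1%:R * (cos (h n * f x) + (- 1 + n.+1%:R^-1 / 2 * f x ^+ 2))).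
    by apply: eq_Rintegral => x _; rewrite /g exprMn h2; ring.
  have i1 : F.-integrable setT (EFin \o (fun x => - 1 + n.+1%:R^-1 / 2 * f x ^+ 2)).
    apply: integrableDR => //; last exact: integrableZlR.
    exact: integrable_cstR.
  rewrite RintegralZl//; last exact: integrableDR.
  rewrite RintegralD// RintegralD//; last 2 first.
  - exact: integrable_cstR.
  - exact: integrableZlR.
  rewrite Rintegral_cst_prob RintegralZl//; ring.
rewrite -(Rintegral_cst_prob F (0 : R)).
apply: (@Rintegral_cvg g _ (fun x => f x ^+ 2)) => //.
- move=> n; apply: measurable_funM => //; apply: measurable_funD.
    exact: measurable_funB.
  apply: measurable_funM => //; apply: measurable_funX; exact: measurable_funM.
- move=> x; apply/cvgr0Pnorm_le => e e0.
  have : `|f x| ^+ 4 * n.+1%:R^-1 @[n --> \oo] --> `|f x| ^+ 4 * 0.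
    by apply: cvgM; [exact: cvg_cst|exact: cvg_invS].
  rewrite mulr0 => /cvgr0Pnorm_le/(_ e e0); apply: filterS => n; apply: le_trans.
  rewrite /g normrM ger0_norm//.
  apply: le_trans (ler_wpM2l _ (cos_sub1_le4 _)) _ => //.
  rewrite [leRHS]ger0_norm ?mulr_ge0 ?exprn_ge0// normrM exprMn [`|h n|]ger0_norm//.
  have -> : h n ^+ 4 = n.+1%:R^-1 ^+ 2 by rewrite -h2 -exprM.
  by rewrite mulrA expr2 (mulrA n.+1%:R) mulfV ?pnatr_eq0// mul1r mulrC.
- move=> n x; rewrite /g normrM ger0_norm//.
  have : `|cos (h n * f x) - 1 + (h n * f x) ^+ 2 / 2| <= (h n * f x) ^+ 2.
    apply: le_trans (ler_normD _ _) _; rewrite [X in _ + X]ger0_norm; last by rewrite divr_ge0 ?sqr_ge0.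
    by have := cos_sub1_le (h n * f x); lra.
  move=> /(ler_wpM2l (ler0n R n.+1)); rewrite hf2//.
Qed.

(** As for the cosine, the linear term being removed because [f] has mean [0]. *)
Lemma char_sin_taylor : F.-integrable setT (EFin \o f) -> \int[F]_x f x = 0 ->
  n.+1%:R * \int[F]_x sin (h n * f x) @[n --> \oo] --> (0 : R).
Proof.
move=> if1 f0; pose g n x := n.+1%:R * (sin (h n * f x) - h n * f x).
have -> : (fun n => n.+1%:R * \int[F]_x sin (h n * f x)) = (fun n => \int[F]_x g n x).
  apply/funext => n; rewrite RintegralZl//; last first.
    by apply: integrableBR => //; exact: integrableZlR.
  by rewrite RintegralB//; [rewrite RintegralZl// f0 mulr0 subr0|exact: integrableZlR].
rewrite -(Rintegral_cst_prob F (0 : R)).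
apply: (@Rintegral_cvg g _ (fun x => f x ^+ 2)) => //.
- move=> n; apply: measurable_funM => //; apply: measurable_funB => //.
  exact: measurable_funM.
- move=> x; apply/cvgr0Pnorm_le => e e0.
  have : `|f x| ^+ 3 * h n @[n --> \oo] --> `|f x| ^+ 3 * 0.
    by apply: cvgM; [exact: cvg_cst|exact: ch].
  rewrite mulr0 => /cvgr0Pnorm_le/(_ e e0); apply: filterS => n; apply: le_trans.
  rewrite /g normrM ger0_norm//.
  apply: le_trans (ler_wpM2l _ (sin_sub_le3 _)) _ => //.
  rewrite [leRHS]ger0_norm ?mulr_ge0 ?exprn_ge0// normrM exprMn [`|h n|]ger0_norm//.
  by rewrite [h n ^+ 3]exprSr mulrA (mulrA n.+1%:R) nh mul1r mulrC.
- move=> n x; rewrite /g normrM ger0_norm//.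
  have := ler_wpM2l (ler0n R n.+1) (sin_sub_le (h n * f x)).
  by rewrite hf2.
Qed.

End taylor.

(** * Moments of the standard normal law *)

Section gauss_moments.
Context {R : realType}.
Local Notation nu := (gauss (0 : R) 1).

Lemma gauss_integralE (w : R -> R) : measurable_fun setT w -> (forall x, 0 <= w x) ->
  (\int[nu]_x (w x)%:E = \int[lebesgue_measure]_x ((w x * normal_pdf 0 1 x)%:E))%E.
Proof.
move=> mw w0.
by rewrite integral_gauss//; exact/measurable_EFinP.
Qed.

Lemma normal_pdf01E (s : R) x : 0 < s ->
  normal_pdf 0 s x = (s * Num.sqrt (pi *+ 2))^-1 * expR (- (x ^+ 2 / (s ^+ 2 *+ 2))).
Proof.
move=> s0; rewrite normal_pdfE ?gt_eqF// /normal_peak /normal_fun subr0 mulNr; congr (_^-1 * _).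
by rewrite -mulrnAr sqrtrM ?sqr_ge0// sqrtr_sqr gtr0_norm.
Qed.

Lemma measurable_gauss_exp (s : R) : measurable_fun setT (fun x : R => expR (- (s * x ^+ 2 / 2))).
Proof.
apply: (measurableT_comp (@measurable_expR R)); apply: (measurableT_comp (@oppr_measurable R setT)).
by apply: measurable_funM => //; apply: measurable_funM => //; exact: measurable_funX.
Qed.

(** The integrand times the standard normal density is [(1 + s) ^ (- 1 / 2)] times
    the density of variance [1 / (1 + s)]. *)
Lemma integral_gauss_exp (s : R) : 0 <= s ->
  \int[nu]_x expR (- (s * x ^+ 2 / 2)) = (Num.sqrt (1 + s))^-1.
Proof.
move=> s0; have s1 : 0 < 1 + s by rewrite ltr_wpDr.
have r0 : 0 < Num.sqrt (1 + s) by rewrite sqrtr_gt0.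
rewrite /Rintegral (gauss_integralE (measurable_gauss_exp s) (fun x => expR_ge0 _)).
transitivity (fine (\int[lebesgue_measure]_x ((Num.sqrt (1 + s))^-1%:E *
    (normal_pdf 0 (Num.sqrt (1 + s))^-1 x)%:E)))%E.
  congr fine; apply: eq_integral => x _; rewrite -EFinM; congr EFin.
  rewrite !normal_pdf01E ?invr_gt0// mul1r expr1n mulrCA -expRD.
  rewrite exprVn sqr_sqrtr ?ltW// [RHS]mulrA; congr (_ * expR _).
    by rewrite invfM invrK mulrA mulVf ?mul1r ?gt_eqF.
  by field; rewrite gt_eqF.
rewrite ge0_integralZl//.
- by rewrite integral_normal_pdf mule1.
- by apply/measurable_EFinP; exact: measurable_normal_pdf.
- by move=> x _; rewrite lee_fin normal_pdf_ge0.
Qed.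

(** [x ^ 2 exp (- x ^ 2 / 2)] is dominated by a multiple of the density of variance
    [2]. *)
Lemma gauss_integrable_sqr : nu.-integrable setT (EFin \o (fun x : R => x ^+ 2)).
Proof.
have m2 : measurable_fun setT (fun x : R => x ^+ 2) by exact: measurable_funX.
apply/integrableP; split; first exact/measurable_EFinP.
under eq_integral do rewrite /= ger0_norm ?sqr_ge0//.
rewrite (gauss_integralE m2 (fun x => sqr_ge0 _)).
have r2 : 0 < Num.sqrt (2 : R) by rewrite sqrtr_gt0.
apply: (@le_lt_trans _ _ (\int[lebesgue_measure]_x ((4 * Num.sqrt 2)%:E *
    (normal_pdf 0 (Num.sqrt 2) x)%:E))%E).
  apply: ge0_le_integral => //.
  - by move=> x _; rewrite lee_fin mulr_ge0 ?sqr_ge0 ?normal_pdf_ge0.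
  - by apply/measurable_EFinP; apply: measurable_funM => //; exact: measurable_normal_pdf.
  - by apply: emeasurable_funM => //; apply/measurable_EFinP; exact: measurable_normal_pdf.
  move=> x _; rewrite -EFinM lee_fin !normal_pdf01E// mul1r expr1n sqr_sqrtr//.
  have p0 : 0 < Num.sqrt (pi *+ 2 : R) by rewrite sqrtr_gt0 mulrn_wgt0 ?pi_gt0.
  have -> : 4 * Num.sqrt 2 * ((Num.sqrt 2 * Num.sqrt (pi *+ 2))^-1 * expR (- (x ^+ 2 / (2 *+ 2)))) =
      (Num.sqrt (pi *+ 2))^-1 * (4 * expR (- (x ^+ 2 / (2 *+ 2)))).
    by field; rewrite !gt_eqF.
  rewrite mulrCA ler_wpM2l ?invr_ge0 ?(ltW p0)//.
  have -> : expR (- (x ^+ 2 / (1 *+ 2))) = expR (- (x ^+ 2 / (2 *+ 2))) * expR (- (x ^+ 2 / (2 *+ 2))).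
    by rewrite -expRD; congr expR; field.
  rewrite (mulrA (x ^+ 2)); apply: ler_wpM2r; first exact: expR_ge0.
  have h1 : x ^+ 2 / (2 *+ 2) <= expR (x ^+ 2 / (2 *+ 2)).
    by apply: le_trans (expR_ge1Dx _); rewrite lerDr.
  have h2 : x ^+ 2 / (2 *+ 2) * expR (- (x ^+ 2 / (2 *+ 2))) <= 1.
    by rewrite -[leRHS](expRxMexpNx_1 (x ^+ 2 / (2 *+ 2))) ler_wpM2r// expR_ge0.
  have -> : x ^+ 2 * expR (- (x ^+ 2 / (2 *+ 2))) = 4 * (x ^+ 2 / (2 *+ 2) * expR (- (x ^+ 2 / (2 *+ 2)))).
    by field.
  lra.
rewrite ge0_integralZl//.
- by rewrite integral_normal_pdf mule1 ltry.
- by apply/measurable_EFinP; exact: measurable_normal_pdf.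
- by move=> x _; rewrite lee_fin normal_pdf_ge0.
Qed.

(** Differentiate [integral_gauss_exp] at [s = 0], as a limit of difference quotients
    under dominated convergence. *)
Lemma gauss_sqr : \int[nu]_x (x ^+ 2) = 1.
Proof.
(* Difference quotient at [0], with increment [1 / (n + 1)]. *)
pose g (n : nat) (x : R) := n.+1%:R * (1 - expR (- (n.+1%:R^-1 * x ^+ 2 / 2))).
have N0 n : n.+1%:R != 0 :> R by rewrite pnatr_eq0.
have mg n : measurable_fun setT (g n).
  by apply: measurable_funM => //; apply: measurable_funB => //; exact: measurable_gauss_exp.
have mh : measurable_fun setT (fun x : R => x ^+ 2 / 2).
  by apply: measurable_funM => //; exact: measurable_funX.
have c1 : \int[nu]_x g n x @[n --> \oo] --> \int[nu]_x (x ^+ 2 / 2).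
  apply: (@Rintegral_cvg _ _ _ _ g _ (fun x => x ^+ 2)) => //; last 2 first.
  - exact: gauss_integrable_sqr.
  - move=> n x; set y := n.+1%:R^-1 * x ^+ 2 / 2.
    have y0 : 0 <= y by rewrite divr_ge0// mulr_ge0 ?sqr_ge0 ?invr_ge0.
    have h1 : expR (- y) <= 1 by rewrite expR_le1 oppr_le0.
    have h2 : 1 - y <= expR (- y) by exact: expR_ge1Dx.
    rewrite /g -/y ger0_norm ?mulr_ge0 ?subr_ge0//.
    have : n.+1%:R * (1 - expR (- y)) <= n.+1%:R * y by rewrite ler_wpM2l//; lra.
    move=> /le_trans; apply; have -> : n.+1%:R * y = x ^+ 2 / 2.
      by rewrite /y; move: (n.+1%:R) (N0 n) => N NN; field.
    by have := sqr_ge0 x; lra.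
  move=> x; apply/subr_cvg0/cvgr0Pnorm_le => e e0.
  have : x ^+ 4 * n.+1%:R^-1 @[n --> \oo] --> x ^+ 4 * (0 : R).
    by apply: cvgM; [exact: cvg_cst|exact: cvg_invS].
  rewrite mulr0 => /cvgr0Pnorm_le/(_ e e0); apply: filterS => n; apply: le_trans.
  set y := n.+1%:R^-1 * x ^+ 2 / 2.
  have y0 : 0 <= y by rewrite divr_ge0// mulr_ge0 ?sqr_ge0 ?invr_ge0.
  have -> : g n x - x ^+ 2 / 2 = - (n.+1%:R * (expR (- y) - 1 + y)).
    have <- : n.+1%:R * y = x ^+ 2 / 2.
      by rewrite /y; move: (n.+1%:R) (N0 n) => N NN; field.
    by rewrite /g -/y; ring.
  rewrite normrN normrM ger0_norm//; apply: le_trans (ler_wpM2l _ (expRN_le y0)) _ => //.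
  have -> : n.+1%:R * y ^+ 2 = x ^+ 4 / n.+1%:R / 4.
    by rewrite /y; move: (n.+1%:R) (N0 n) => N NN; field.
  have x4 : 0 <= x ^+ 4 / n.+1%:R by rewrite divr_ge0// exprn_even_ge0.
  by rewrite ger0_norm// ler_pdivrMr// ler_peMr// ler1n.
have c2 : \int[nu]_x g n x @[n --> \oo] --> (2^-1 : R).
  pose s n : R := 1 + n.+1%:R^-1; pose r n := Num.sqrt (s n).
  have s0 n : 0 < s n by rewrite ltr_wpDr// invr_ge0.
  have cs : s @ \oo --> (1 : R).
    have : s @ \oo --> (1 + 0 : R) by apply: cvgD; [exact: cvg_cst|exact: cvg_invS].
    by rewrite addr0.
  have cr : r @ \oo --> (1 : R).
    have : r @ \oo --> (Num.sqrt 1 : R).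
      by apply: (@cvg_comp _ _ _ s Num.sqrt _ _ _ cs); exact: sqrt_continuous.
    by rewrite sqrtr1.
  have ie n : nu.-integrable setT (EFin \o (fun x => expR (- (n.+1%:R^-1 * x ^+ 2 / 2)))).
    apply: (@bounded_integrable _ _ _ _ _ 1) => [|x]; first exact: measurable_gauss_exp.
    by rewrite ger0_norm ?expR_ge0// expR_le1 oppr_le0 divr_ge0// mulr_ge0 ?sqr_ge0 ?invr_ge0.
  have -> : (fun n => \int[nu]_x g n x) = (fun n => (r n * (1 + r n))^-1).
    apply/funext => n; rewrite /g RintegralZl//; last first.
      by apply: integrableBR; [exact: integrable_cstR|exact: ie].
    rewrite RintegralB//; last exact: integrable_cstR.
    rewrite Rintegral_cst_prob integral_gauss_exp ?invr_ge0// -/(s n) -/(r n).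
    have r0 : 0 < r n by rewrite sqrtr_gt0.
    have rs : r n ^+ 2 = 1 + n.+1%:R^-1 by rewrite sqr_sqrtr// ltW.
    have NE : (r n ^+ 2 - 1) * n.+1%:R = 1 by rewrite rs addrAC subrr add0r mulVf.
    apply: (mulfI (_ : r n * (1 + r n) != 0)); first by rewrite mulf_neq0 ?gt_eqF ?addr_gt0.
    rewrite divff; last by rewrite mulf_neq0 ?gt_eqF ?addr_gt0.
    apply: etrans NE; move: (r n) (n.+1%:R) r0 => x N x0; field; by rewrite gt_eqF.
  have -> : (2^-1 : R) = (1 * (1 + 1))^-1 by rewrite mul1r.
  apply: cvgV; first by rewrite mul1r.
  by apply: cvgM => //; apply: cvgD => //; exact: cvg_cst.
have e : \int[nu]_x (x ^+ 2 / 2) = 2^-1 by exact: (cvg_unique (@Rhausdorff R) c1 c2).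
have e2 : \int[nu]_x (x ^+ 2 / 2) = 2^-1 * \int[nu]_x (x ^+ 2).
  rewrite -RintegralZl//; last exact: gauss_integrable_sqr.
  by apply: eq_Rintegral => x _; rewrite mulrC.
by move: e; rewrite e2 => /(canRL (mulKf _)) ->; rewrite ?invrK ?mulfV.
Qed.

Lemma integrable_of_sqr d (T : measurableType d) (F : probability T R) (f : T -> R) :
  measurable_fun setT f -> F.-integrable setT (EFin \o (fun x => f x ^+ 2)) ->
  F.-integrable setT (EFin \o f).
Proof.
move=> mf if2; have ig := integrableDR (integrable_cstR F 1) if2.
have mef : measurable_fun setT (EFin \o f) by exact/measurable_EFinP.
apply: (le_integrable measurableT mef _ ig) => x _; rewrite /= lee_fin [leRHS]ger0_norm ?addr_ge0 ?sqr_ge0//.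
by rewrite -[f x ^+ 2]real_normK ?num_real//; have := sqr_ge0 (`|f x| - 1); nra.
Qed.

Lemma gauss_integrable_id : nu.-integrable setT (EFin \o (fun x : R => x)).
Proof.
by apply: integrable_of_sqr => //; exact: gauss_integrable_sqr.
Qed.

(** The standard normal law is symmetric. *)
Lemma gauss_mean : \int[nu]_x x = 0.
Proof.
have mN : measurable_fun setT (fun x : R => - x) by exact: (@oppr_measurable R setT).
have hl A : measurable A -> nu ((fun x : R => - x) @^-1` A) = nu A.
  move=> mA; have N1 : (-1 : R) != 0 by rewrite oppr_eq0 oner_eq0.
  have := normal_prob_affine 0 N1 mA; rewrite normrN1 => e.
  apply: etrans (esym e); congr (normal_prob 0 1 _).
  by apply/seteqP; split => x /=; rewrite mulN1r add0r.
have [_] := law_Rintegral mN hl gauss_integrable_id.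
rewrite (_ : \int[nu]_w - w = - \int[nu]_w w).
  move=> h; lra.
rewrite -mulN1r -RintegralZl//; last exact: gauss_integrable_id.
by apply: eq_Rintegral => x _; rewrite mulN1r.
Qed.

End gauss_moments.

(** * Characteristic function of a normal law *)

Section normal_characteristic.
Context {R : realType}.
Local Notation nu := (gauss (0 : R) 1).

Lemma Rintegral_prod_bounded d1 d2 (T1 : measurableType d1) (T2 : measurableType d2)
    (P1 : probability T1 R) (P2 : probability T2 R) (g : T1 -> R) (q : T2 -> R) :
  measurable_fun setT g -> (forall x, `|g x| <= 1) ->
  measurable_fun setT q -> (forall x, `|q x| <= 1) ->
  (P1 \x P2)%E.-integrable setT (EFin \o (fun z => g z.1 * q z.2)) /\
  \int[(P1 \x P2)%E]_z (g z.1 * q z.2) = \int[P1]_x g x * \int[P2]_y q y.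
Proof.
move=> mg g1 mq q1.
have mgq : measurable_fun setT (fun z : T1 * T2 => g z.1 * q z.2).
  by apply: measurable_funM; [exact: (measurableT_comp mg)|exact: (measurableT_comp mq)].
have i : (P1 \x P2)%E.-integrable setT (EFin \o (fun z : T1 * T2 => g z.1 * q z.2)).
  apply: (@bounded_integrable _ _ _ ((P1 \x P2)%E : probability _ R) _ 1) => // z.
  by rewrite normrM mulr_ile1.
split => //.
have iq : P2.-integrable setT (EFin \o q) by exact: (@bounded_integrable _ _ _ _ _ 1).
have ig : P1.-integrable setT (EFin \o g) by exact: (@bounded_integrable _ _ _ _ _ 1).
rewrite {1}/Rintegral -(integral12_prod_meas1 i) /fubini_F.
transitivity (fine (\int[P1]_x (g x * \int[P2]_y q y)%:E)); last by rewrite -[LHS]/(Rintegral _ _ _) RintegralZr.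
congr fine; apply: eq_integral => x _ /=.
rewrite -RintegralZl// /Rintegral fineK//.
exact: (integrable_fin_num measurableT (integrableZlR (g x) iq)).
Qed.

(** [normal_var] as a probability. *)
Definition normal_law (t : R) : probability R R :=
  if t == 0 then (\d_(0 : R) : probability R R) else gauss 0 (Num.sqrt t).

Lemma normal_lawE t B : normal_law t B = normal_var t B.
Proof. by rewrite /normal_law /normal_var; case: eqP. Qed.

Lemma normal_law_add t a (g : R -> R) : 0 <= t -> measurable_fun setT g ->
  (forall x, `|g x| <= 1) ->
  \int[normal_law (t + a ^+ 2)]_x g x =
  \int[(normal_law t \x nu)%E]_z g (z.1 + a * z.2).
Proof.
move=> t0 mg g1.
have mX : measurable_fun setT (fun z : R * R => z.1 + a * z.2).
  by apply: measurable_funD => //; apply: measurable_funM.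
have ig : (normal_law (t + a ^+ 2)).-integrable setT (EFin \o g).
  exact: (@bounded_integrable _ _ _ _ _ 1).
have hl A : measurable A -> ((normal_law t \x nu)%E : probability _ _)
    ((fun z : R * R => z.1 + a * z.2) @^-1` A) = normal_law (t + a ^+ 2) A.
  move=> mA; rewrite normal_lawE -(@normal_var_convolution _ (normal_law t))//; last first.
    by move=> B _; rewrite normal_lawE.
  rewrite /= /product_measure1; apply: eq_integral => x _ /=; congr (gauss 0 1 _).
  by apply/seteqP; split => y; rewrite /xsection /= inE.
by have [_ <-] := law_Rintegral mX hl ig.
Qed.

(** The normal law of variance [v] is the sum of [n + 1] independent normal variables
    of variance [v / (n + 1)]: its characteristic function does not depend on
    [n], but is also the [(n + 1)]st power to which [char_recursion_cvg] applies. *)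
Lemma normal_law_char (v : R) : 0 <= v ->
  \int[normal_law v]_x cos x = expR (- (v / 2)) /\ \int[normal_law v]_x sin x = 0.
Proof.
move=> v0; pose f (y : R) := Num.sqrt v * y.
pose h (n : nat) : R := Num.sqrt n.+1%:R^-1.
pose al n := \int[nu]_y cos (h n * f y); pose be n := \int[nu]_y sin (h n * f y).
pose K n k := normal_law (k%:R * (v / n.+1%:R)).
have mC := @measurable_cosR R.
have mS := @measurable_sinR R.
have mf : measurable_fun setT f by apply: measurable_funM.
have if2 : nu.-integrable setT (EFin \o (fun y => f y ^+ 2)).
  have := integrableZlR v (@gauss_integrable_sqr R); apply: eq_integrable => // x _ /=.
  by rewrite /f exprMn sqr_sqrtr.
have f2 : \int[nu]_y f y ^+ 2 = v.
  transitivity (\int[nu]_y (v * y ^+ 2)).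
    by apply: eq_Rintegral => x _; rewrite /f exprMn sqr_sqrtr.
  by rewrite RintegralZl ?gauss_sqr ?mulr1//; exact: gauss_integrable_sqr.
have if1 : nu.-integrable setT (EFin \o f) by exact: (integrableZlR _ (@gauss_integrable_id R)).
have f0 : \int[nu]_y f y = 0.
  rewrite /f RintegralZl ?gauss_mean ?mulr0//; exact: gauss_integrable_id.
have KS n k : k.+1%:R * (v / n.+1%:R) = k%:R * (v / n.+1%:R) + (h n * Num.sqrt v) ^+ 2.
  by rewrite exprMn !sqr_sqrtr// ?invr_ge0// -natr1 mulrDl mul1r [n.+1%:R^-1 * v]mulrC.
have k0 n k : 0 <= k%:R * (v / n.+1%:R) by rewrite mulr_ge0// divr_ge0.
have mhf n : measurable_fun setT (fun y => h n * f y) by exact: measurable_funM.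
have rec n k : \int[K n k.+1]_x cos x = \int[K n k]_x cos x * al n - \int[K n k]_x sin x * be n /\
    \int[K n k.+1]_x sin x = \int[K n k]_x sin x * al n + \int[K n k]_x cos x * be n.
  have mcf : measurable_fun setT (fun y => cos (h n * f y)) by exact: (measurableT_comp mC).
  have msf : measurable_fun setT (fun y => sin (h n * f y)) by exact: (measurableT_comp mS).
  have [icc ecc] := @Rintegral_prod_bounded _ _ _ _ (K n k) nu _ _ mC (@cos_max R) mcf (fun=> cos_max _).
  have [ics ecs] := @Rintegral_prod_bounded _ _ _ _ (K n k) nu _ _ mC (@cos_max R) msf (fun=> sin_max _).
  have [isc esc] := @Rintegral_prod_bounded _ _ _ _ (K n k) nu _ _ mS (@sin_max R) mcf (fun=> cos_max _).
  have [iss ess] := @Rintegral_prod_bounded _ _ _ _ (K n k) nu _ _ mS (@sin_max R) msf (fun=> sin_max _).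
  have ac := @normal_law_add _ (h n * Num.sqrt v) _ (k0 n k) mC (@cos_max R).
  have as' := @normal_law_add _ (h n * Num.sqrt v) _ (k0 n k) mS (@sin_max R).
  have KSn : K n k.+1 = normal_law (k%:R * (v / n.+1%:R) + (h n * Num.sqrt v) ^+ 2).
    by rewrite -KS.
  split.
    apply: (etrans (etrans (congr1 (fun m : probability R R => Rintegral m setT cos) KSn) ac)).
    apply/esym; apply: (etrans (congr2 (fun u w => u - w) (esym ecc) (esym ess))).
    apply: (etrans (esym (RintegralB measurableT icc iss))).
    by apply: eq_Rintegral => z _; rewrite -cosD /f mulrA.
  apply: (etrans (etrans (congr1 (fun m : probability R R => Rintegral m setT sin) KSn) as')).
  apply/esym; apply: (etrans (congr2 (fun u w => u + w) (esym esc) (esym ecs))).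
  apply: (etrans (esym (RintegralD measurableT isc ics))).
  by apply: eq_Rintegral => z _; rewrite -sinD /f mulrA.
have K0 n : K n 0%N = normal_law 0 by rewrite /K mul0r.
have d0 (g : R -> R) : measurable_fun setT g -> \int[normal_law 0]_x g x = g 0.
  move=> mg; rewrite /normal_law eqxx /Rintegral integral_dirac//; last exact/measurable_EFinP.
  by rewrite diracT mul1e.
have [] := @char_recursion_cvg R v al be (fun n k => \int[K n k]_x cos x)
  (fun n k => \int[K n k]_x sin x) v0.
- by move=> n; rewrite K0 d0// cos0.
- by move=> n; rewrite K0 d0// sin0.
- by move=> n k; exact: (rec n k).1.
- by move=> n k; exact: (rec n k).2.
- by move=> n k; apply: norm_Rintegral_le => //; exact: cos_max.
- by move=> n k; apply: norm_Rintegral_le => //; exact: sin_max.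
- by rewrite -f2; exact: char_cos_taylor.
- exact: char_sin_taylor.
have KE n : K n n.+1 = normal_law v.
  by rewrite /K mulrC divfK// pnatr_eq0.
have lim (g : R -> R) (l : R) : (fun n => \int[K n n.+1]_x g x) @ \oo --> l ->
    \int[normal_law v]_x g x = l.
  have -> : (fun n => \int[K n n.+1]_x g x) = (fun=> \int[normal_law v]_x g x).
    by apply/funext => n; rewrite KE.
  by move=> gl; apply: (cvg_unique _ _ gl); [exact: Rhausdorff|exact: cvg_cst].
by move=> c s; split; apply: lim; [exact: c|exact: s].
Qed.

End normal_characteristic.

(** * Expectation of a product of independent factors *)

Section product_formula.
Context {R : realType} dO (O : measurableType dO) (P : probability O R).
Context dT (T : measurableType dT) (F : probability T R) (Z : nat -> O -> T).
Hypothesis mZ : forall i, measurable_fun setT (Z i).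
Hypothesis lawZ : forall i A, measurable A -> P (Z i @^-1` A) = F A.
Hypothesis indZ : mutually_independent P Z.

Definition upd (u : nat -> T -> R) (k : nat) (w : T -> R) : nat -> T -> R :=
  fun i => if i == k then w else u i.

Let prod_upd n (k : 'I_n) u w (g : nat -> (T -> R) -> R) :
  \prod_(i < n) g i (upd u k w i) =
  g k w * \prod_(i < n | i != k) g i (u i).
Proof.
rewrite (bigD1 k)//= /upd eqxx; congr (_ * _); apply: eq_bigr => i ik.
by rewrite ifN.
Qed.

Let prod_formula n (u : nat -> T -> R) :=
  (\int[P]_w (\prod_(i < n) u i (Z i w))%:E = (\prod_(i < n) \int[F]_x u i x)%:E)%E.

Let measurable_prodZ n (Q : pred 'I_n) (u : nat -> T -> R) :
  (forall i, measurable_fun setT (u i)) ->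
  measurable_fun setT (fun w => \prod_(i < n | Q i) u i (Z i w)).
Proof.
move=> mu; under eq_fun do rewrite -big_filter.
by apply: measurable_prod => i _; exact: measurableT_comp.
Qed.

Let Rintegral_indic (B : set T) : measurable B -> (\int[F]_x \1_B x)%:E = F B.
Proof. by move=> mB; rewrite Rintegral_indic_prob// fineK// fin_num_measure. Qed.

Let step n (k : 'I_n) (u : nat -> T -> R) (w : T -> R) :
  (forall i, measurable_fun setT (u i)) -> (forall i x, 0 <= u i x) ->
  F.-integrable setT (EFin \o w) -> (forall x, 0 <= w x) ->
  (forall B, measurable B -> prod_formula n (upd u k \1_B)) ->
  prod_formula n (upd u k w).
Proof.
move=> mu u0 iw w0 hB.
have mw : measurable_fun setT w by have /measurable_EFinP := measurable_int _ iw.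
pose h v := \prod_(i < n | i != k) u i (Z i v).
pose c := \prod_(i < n | i != k) \int[F]_x u i x.
have c0 : 0 <= c by apply: prodr_ge0 => i _; apply: Rintegral_ge0 => x _; exact: u0.
have e w' : prod_formula n (upd u k w') =
    (\int[P]_v ((w' (Z k v))%:E * (h v)%:E) = (\int[F]_x w' x)%:E * c%:E)%E.
  rewrite /prod_formula (prod_upd k u w' (fun i f => \int[F]_x f x)) -/c EFinM.
  congr (_ = _); apply: eq_integral => v _.
  by rewrite (prod_upd k u w' (fun i f => f (Z i v))) EFinM.
rewrite e -(@transfer_density _ _ _ _ _ P (mscale (NngNum c0) F) (Z k) h _ _ _ _ (fun x => (w x)%:E))//.
- rewrite ge0_integral_mscale//; [|exact/measurable_EFinP|by move=> x _; rewrite lee_fin].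
  by rewrite /= muleC /Rintegral fineK//; exact: (integrable_fin_num measurableT iw).
- exact: measurable_prodZ.
- by move=> v; apply: prodr_ge0.
- by move=> B mB; have := hB _ mB; rewrite e => ->; rewrite Rintegral_indic// /mscale /= muleC.
- exact/measurable_EFinP.
Qed.

Let prod_indic n (B : nat -> set T) w :
  \prod_(i < n) \1_(B i) (Z i w) = \1_(\bigcap_(i < n) (Z i @^-1` B i)) w :> R.
Proof.
rewrite [RHS]indicE; have [|] := boolP (w \in _).
  rewrite inE => h; rewrite big1// => i _; rewrite indicE mem_set//.
  exact: (h i (ltn_ord i)).
rewrite notin_setE => h; have [i] : exists i : 'I_n, ~ B i (Z i w).
  apply: contrapT => hn; apply: h => i /= ilt; apply: contrapT => hi.
  by apply: hn; exists (Ordinal ilt).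
by move=> hi; rewrite (bigD1 i)//= indicE memNset// mul0r.
Qed.

Let prod_formula_indic n (B : nat -> set T) : (forall i, measurable (B i)) ->
  prod_formula n (fun i => \1_(B i)).
Proof.
move=> mB; rewrite /prod_formula.
under eq_integral do rewrite prod_indic.
have mI : measurable (\bigcap_(i < n) (Z i @^-1` B i)).
  apply: bigcap_measurableType => i _.
  by rewrite -[_ @^-1` _]setTI; exact: mZ.
rewrite integral_indic// setIT; transitivity (\prod_(i < n) P (Z i @^-1` B i))%E.
  exact: indZ.
elim/big_ind2 : _ => //= [x y u v -> ->|i _]; first by rewrite EFinM.
by rewrite Rintegral_indic// lawZ.
Qed.

(** Independence is the case of indicators.  Replace the indicators by nonnegative
    functions one factor at a time: with the other factors fixed, both sides are
    integrals of the factor against measures that agree on indicators. *)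
Lemma ge0_expectation_prod n (u : nat -> T -> R) :
  (forall i, F.-integrable setT (EFin \o u i)) -> (forall i x, 0 <= u i x) ->
  (\int[P]_w (\prod_(i < n) u i (Z i w))%:E = (\prod_(i < n) \int[F]_x u i x)%:E)%E.
Proof.
move=> iu u0.
have mi := @integrable_indicR R _ _ F.
suff H j (v : nat -> T -> R) : (j <= n)%N -> (forall i, F.-integrable setT (EFin \o v i)) ->
    (forall i x, 0 <= v i x) -> (exists B : nat -> set T, (forall i, measurable (B i)) /\
    forall i, (j <= i)%N -> v i = \1_(B i)) -> prod_formula n v.
  pose v i := if (i < n)%N then u i else \1_(set0 : set T).
  have := H n v (leqnn _); rewrite /prod_formula /v.
  have e (g : nat -> (T -> R) -> R) : \prod_(i < n) g i (if (i < n)%N then u i else \1_(set0 : set T)) =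
      \prod_(i < n) g i (u i) by apply: eq_bigr => i _; rewrite ltn_ord.
  rewrite (e (fun i f => \int[F]_x f x)) => {}H; rewrite -H.
  - by apply: eq_integral => w _; rewrite (e (fun i f => f (Z i w))).
  - by move=> i; case: ifP => // _; exact: mi.
  - by move=> i x; case: ifP.
  - exists (fun=> set0); split => // i ni; by rewrite ltnNge ni.
elim: j v => [|j ih] v jn iv v0 [B [mB vB]].
  rewrite (_ : v = (fun i => \1_(B i))); first exact: prod_formula_indic.
  by apply/funext => i; exact: vB.
have -> : v = upd v (Ordinal jn) (v j).
  by apply/funext => i; rewrite /upd /=; case: eqP => // ->.
have mv i : measurable_fun setT (v i) by have /measurable_EFinP := measurable_int _ (iv i).
apply: step => // C mC; apply: ih => //; first exact: ltnW.
- by move=> i; rewrite /upd; case: ifP => // _; exact: mi.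
- by move=> i x; rewrite /upd; case: ifP.
- exists (fun i => if i == j then C else B i); split; first by move=> i; case: ifP.
  move=> i ji; rewrite /upd/=; case: eqP => // /eqP ij; apply: vB.
  by rewrite ltn_neqAle eq_sym ij.
Qed.

(** Split the factors into positive and negative parts one at a time. *)
Lemma expectation_prod n (u : nat -> T -> R) :
  (forall i, F.-integrable setT (EFin \o u i)) ->
  P.-integrable setT (EFin \o (fun w => \prod_(i < n) u i (Z i w))) /\
  \int[P]_w (\prod_(i < n) u i (Z i w)) = \prod_(i < n) \int[F]_x u i x.
Proof.
move=> iu.
have iP (v : nat -> T -> R) : (forall i, F.-integrable setT (EFin \o v i)) ->
    P.-integrable setT (EFin \o (fun w => \prod_(i < n) v i (Z i w))).
  move=> iv; have mv i : measurable_fun setT (v i).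
    by have /measurable_EFinP := measurable_int _ (iv i).
  apply/integrableP; split; first by apply/measurable_EFinP; exact: (@measurable_prodZ n xpredT v mv).
  under eq_integral do rewrite /= normr_prod.
  rewrite (@ge0_expectation_prod n (fun i x => `|v i x|)) ?ltry//.
  by move=> i; exact: (integrable_norm (iv i)).
split; first exact: iP.
suff H j (v : nat -> T -> R) : (j <= n)%N -> (forall i, F.-integrable setT (EFin \o v i)) ->
    (forall i x, (j <= i)%N -> (i < n)%N -> 0 <= v i x) ->
    \int[P]_w (\prod_(i < n) v i (Z i w)) = \prod_(i < n) \int[F]_x v i x.
  by apply: (H n) => // i x ni; rewrite ltnNge ni.
elim: j v => [|j ih] v jn iv v0.
  pose w i := if (i < n)%N then v i else cst 0.
  have e (g : nat -> (T -> R) -> R) : \prod_(i < n) g i (v i) = \prod_(i < n) g i (w i).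
    by apply: eq_bigr => i _; rewrite /w ltn_ord.
  rewrite (e (fun i f => \int[F]_x f x)) /Rintegral.
  under eq_integral => x _ do rewrite (e (fun i f => f (Z i x))).
  rewrite ge0_expectation_prod//.
  - by move=> i; rewrite /w; case: ifP => // _; exact: integrable_cstR.
  - by move=> i x; rewrite /w; case: ifP => // ni; exact: v0.
have vE (w : T -> R) : v j = w -> v = upd v (Ordinal jn) w.
  by move=> vw; apply/funext => i; rewrite /upd /=; case: eqP => // ->.
have ip : F.-integrable setT (EFin \o (v j)^\+) by exact: integrable_funrpos.
have im : F.-integrable setT (EFin \o (v j)^\-) by exact: integrable_funrneg.
have iup w : F.-integrable setT (EFin \o w) ->
    forall i, F.-integrable setT (EFin \o upd v (Ordinal jn) w i).
  by move=> iw i; rewrite /upd; case: ifP.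
have pos (w : T -> R) : (forall x, 0 <= w x) ->
    forall i x, (j <= i)%N -> (i < n)%N -> 0 <= upd v (Ordinal jn) w i x.
  move=> w0 i x ji ni; rewrite /upd/=; case: eqP => // /eqP ij.
  by apply: v0 => //; rewrite ltn_neqAle eq_sym ij.
have e (g : nat -> (T -> R) -> R) : g j (v j) = g j (v j)^\+ - g j (v j)^\- ->
    \prod_(i < n) g i (v i) = \prod_(i < n) g i (upd v (Ordinal jn) (v j)^\+ i) -
      \prod_(i < n) g i (upd v (Ordinal jn) (v j)^\- i).
  move=> gj; rewrite {1}(vE _ erefl) !prod_upd gj mulrBl //.
under eq_Rintegral => w _.
  rewrite (e (fun i f => f (Z i w))); last by rewrite -[in LHS](funrposBneg (v j)).
  over.
rewrite RintegralB//; [|exact: iP (iup _ ip)|exact: iP (iup _ im)].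
rewrite !ih ?(ltnW jn)//; try exact: iup; try by apply: pos => x; rewrite ?funrpos_ge0 ?funrneg_ge0.
rewrite -(e (fun i f => \int[F]_x f x))//.
rewrite -RintegralB//; apply: eq_Rintegral => x _.
by rewrite -[in LHS](funrposBneg (v j)).
Qed.

End product_formula.

(** * Sums of independent identically distributed variables *)

Section iid_sums.
Context {R : realType} dO (O : measurableType dO) (P : probability O R).
Context dT (T : measurableType dT) (F : probability T R) (Z : nat -> O -> T).
Hypothesis mZ : forall i, measurable_fun setT (Z i).
Hypothesis lawZ : forall i A, measurable A -> P (Z i @^-1` A) = F A.
Hypothesis indZ : mutually_independent P Z.
Variable f : T -> R.
Hypothesis mf : measurable_fun setT f.

(** Real and imaginary parts of the [k]th power of the characteristic function of
    [f] at [h]. *)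
Definition char_pair (h : R) (k : nat) : R * R :=
  iter k (fun ab => (ab.1 * \int[F]_x cos (h * f x) - ab.2 * \int[F]_x sin (h * f x),
                     ab.2 * \int[F]_x cos (h * f x) + ab.1 * \int[F]_x sin (h * f x))) (1, 0).

Let mcosf h : measurable_fun setT (fun x => cos (h * f x)).
Proof.
apply: (measurableT_comp (@measurable_cosR R)).
exact: measurable_funM.
Qed.

Let msinf h : measurable_fun setT (fun x => sin (h * f x)).
Proof.
apply: (measurableT_comp (@measurable_sinR R)).
exact: measurable_funM.
Qed.

Definition psum (k : nat) (w : O) : R := \sum_(i < k) f (Z i w).

Lemma measurable_psum k : measurable_fun setT (psum k).
Proof. by apply: measurable_sum => i; exact: measurableT_comp. Qed.

(** The extra factors [u i], which depend on later observations, let the induction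
    split off the last summand by the addition formulas: its cosine and sine
    become the first of the extra factors. *)
Lemma char_psum_prod (h : R) k N (u : nat -> T -> R) :
  (forall i, measurable_fun setT (u i)) -> (forall i x, `|u i x| <= 1) ->
  \int[P]_w (cos (h * psum k w) * \prod_(i < N) u i (Z (k + i)%N w)) =
    (char_pair h k).1 * \prod_(i < N) \int[F]_x u i x /\
  \int[P]_w (sin (h * psum k w) * \prod_(i < N) u i (Z (k + i)%N w)) =
    (char_pair h k).2 * \prod_(i < N) \int[F]_x u i x.
Proof.
elim: k N u => [|k ih] N u mu u1.
  have iu i : F.-integrable setT (EFin \o u i) by exact: (@bounded_integrable _ _ _ _ _ 1).
  split.
    rewrite mul1r -(expectation_prod mZ lawZ indZ N iu).2; apply: eq_Rintegral => w _.
    by rewrite /psum big_ord0 mulr0 cos0 mul1r; apply: eq_bigr.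
  rewrite mul0r -(Rintegral_cst_prob P 0); apply: eq_Rintegral => w _.
  by rewrite /psum big_ord0 mulr0 sin0 mul0r.
pose cons (g : T -> R) i := if i is i'.+1 then u i' else g.
have mc g i : measurable_fun setT g -> measurable_fun setT (cons g i).
  by move=> mg; case: i => [|i] /=.
have c1 g : (forall x, `|g x| <= 1) -> forall i x, `|cons g i x| <= 1.
  by move=> g1 [|i] x /=.
have [cc sc] := ih N.+1 (cons (fun x => cos (h * f x))) (fun i => mc _ i (mcosf h))
  (c1 _ (fun x => cos_max _)).
have [cs ss] := ih N.+1 (cons (fun x => sin (h * f x))) (fun i => mc _ i (msinf h))
  (c1 _ (fun x => sin_max _)).
have int (g : R -> R) (q : T -> R) : measurable_fun setT g -> (forall x, `|g x| <= 1) ->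
    measurable_fun setT q -> (forall x, `|q x| <= 1) ->
    P.-integrable setT (EFin \o (fun w => g (h * psum k w) * \prod_(i < N.+1) cons q i (Z (k + i)%N w))).
  move=> mg g1 mq q1; apply: (@bounded_integrable _ _ _ _ _ 1).
    apply: measurable_funM.
      apply: (measurableT_comp mg); apply: measurable_funM => //; exact: measurable_psum.
    by apply: measurable_prod => i _; apply: measurableT_comp => //; exact: mc.
  move=> w; rewrite normrM; apply: mulr_ile1 => //.
  by rewrite normr_prod; apply: prodr_ile1 => i _; rewrite normr_ge0; exact: c1.
have ic (g : R -> R) q := int g q.
have mC := @measurable_cosR R.
have mS := @measurable_sinR R.
have addE w : psum k.+1 w = psum k w + f (Z k w) by rewrite /psum big_ord_recr.
have prodE q w : \prod_(i < N.+1) cons q i (Z (k + i)%N w) =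
    q (Z k w) * \prod_(i < N) u i (Z (k.+1 + i)%N w).
  rewrite big_ord_recl/= addn0; congr (_ * _); apply: eq_bigr => i _.
  by rewrite /= addSnnS.
have RprodE q : \prod_(i < N.+1) \int[F]_x cons q i x =
    \int[F]_x q x * \prod_(i < N) \int[F]_x u i x by rewrite big_ord_recl.
rewrite !RprodE in cc sc cs ss; split.
- transitivity (\int[P]_w (cos (h * psum k w) * \prod_(i < N.+1) cons (fun x => cos (h * f x)) i (Z (k + i)%N w)
      - sin (h * psum k w) * \prod_(i < N.+1) cons (fun x => sin (h * f x)) i (Z (k + i)%N w))).
    by apply: eq_Rintegral => w _; rewrite !prodE addE mulrDr cosD; ring.
  rewrite RintegralB//; [|apply: int => //..].
  + by rewrite cc ss /=; ring.
  + by move=> x; exact: cos_max.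
  + by move=> x; exact: cos_max.
  + by move=> x; exact: sin_max.
  + by move=> x; exact: sin_max.
- transitivity (\int[P]_w (sin (h * psum k w) * \prod_(i < N.+1) cons (fun x => cos (h * f x)) i (Z (k + i)%N w)
      + cos (h * psum k w) * \prod_(i < N.+1) cons (fun x => sin (h * f x)) i (Z (k + i)%N w))).
    by apply: eq_Rintegral => w _; rewrite !prodE addE mulrDr sinD; ring.
  rewrite RintegralD//; [|apply: int => //..].
  + by rewrite sc cs /=; ring.
  + by move=> x; exact: sin_max.
  + by move=> x; exact: cos_max.
  + by move=> x; exact: cos_max.
  + by move=> x; exact: sin_max.
Qed.

Lemma char_psum (h : R) k :
  \int[P]_w cos (h * psum k w) = (char_pair h k).1 /\
  \int[P]_w sin (h * psum k w) = (char_pair h k).2.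
Proof.
have [] := @char_psum_prod h k 0%N (fun _ _ => 0) _ _.
- by move=> _; exact: measurable_cst.
- by move=> _ x; rewrite normr0.
have e (g : R -> R) : \int[P]_w (g (h * psum k w) * \prod_(i < 0) 0) =
    \int[P]_w g (h * psum k w).
  by apply: eq_Rintegral => w _; rewrite big_ord0 mulr1.
by rewrite !e !big_ord0 !mulr1.
Qed.

Hypothesis if2 : F.-integrable setT (EFin \o (fun x => f x ^+ 2)).
Hypothesis if1 : F.-integrable setT (EFin \o f).
Hypothesis f0 : \int[F]_x f x = 0.
Local Notation v := (\int[F]_x f x ^+ 2).

Lemma char_psum_cvg :
  \int[P]_w cos (Num.sqrt n.+1%:R^-1 * psum n.+1 w) @[n --> \oo] --> expR (- (v / 2)) /\
  \int[P]_w sin (Num.sqrt n.+1%:R^-1 * psum n.+1 w) @[n --> \oo] --> (0 : R).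
Proof.
pose h (n : nat) : R := Num.sqrt n.+1%:R^-1.
have v0 : 0 <= v by apply: Rintegral_ge0 => x _; exact: sqr_ge0.
have mh n k : measurable_fun setT (fun w => h n * psum k w).
  by apply: measurable_funM => //; exact: measurable_psum.
have mC := @measurable_cosR R.
have mS := @measurable_sinR R.
have [] := @char_recursion_cvg R v (fun n => \int[F]_x cos (h n * f x))
  (fun n => \int[F]_x sin (h n * f x)) (fun n k => (char_pair (h n) k).1)
  (fun n k => (char_pair (h n) k).2) v0 => //.
- by move=> n k; rewrite -(char_psum (h n) k).1; apply: norm_Rintegral_le => [|x]; [exact: (measurableT_comp mC)|exact: cos_max].
- by move=> n k; rewrite -(char_psum (h n) k).2; apply: norm_Rintegral_le => [|x]; [exact: (measurableT_comp mS)|exact: sin_max].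
- exact: char_cos_taylor.
- exact: char_sin_taylor.
move=> c s; split.
  by under eq_fun do rewrite (char_psum _ _).1.
by under eq_fun do rewrite (char_psum _ _).2.
Qed.

(** Cross terms vanish by independence and centring. *)
Lemma second_moment_psum n :
  P.-integrable setT (EFin \o (fun w => psum n w ^+ 2)) /\
  \int[P]_w psum n w ^+ 2 = n%:R * v.
Proof.
have prod2 (i j : nat) (w : nat -> R) : i != j ->
    \prod_(l < (maxn i j).+1) (if (l == i :> nat) || (l == j :> nat) then w l else 1) = w i * w j.
  move=> ij; rewrite (bigD1 (inord i))//= inordK ?ltnS ?leq_maxl// eqxx.
  rewrite (bigD1 (inord j))/=; last first.
    by apply/negP => /eqP /(congr1 val); rewrite /= !inordK ?ltnS ?leq_maxl ?leq_maxr// => ji; rewrite ji eqxx in ij.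
  rewrite inordK ?ltnS ?leq_maxr// eqxx orbT big1 ?mulr1// => l /andP[li lj].
  rewrite ifF//; apply/negP => /orP[] /eqP e.
    by move/eqP: li; apply; apply: val_inj; rewrite /= inordK ?ltnS ?leq_maxl.
  by move/eqP: lj; apply; apply: val_inj; rewrite /= inordK ?ltnS ?leq_maxr.
have cross i j : P.-integrable setT (EFin \o (fun w => f (Z i w) * f (Z j w))) /\
    \int[P]_w (f (Z i w) * f (Z j w)) = if i == j then v else 0.
  have [<-|ij] := eqVneq i j.
    have [a b] := law_Rintegral (mZ i) (lawZ i) if2.
    split; first by apply: eq_integrable a => // w _; rewrite /= expr2.
    by rewrite -b; apply: eq_Rintegral => w _; rewrite expr2.
  pose u (l : nat) (x : T) := if (l == i) || (l == j) then f x else 1.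
  have iu l : F.-integrable setT (EFin \o u l).
    by rewrite /u; case: (_ || _) => //; exact: integrable_cstR.
  have [a b] := expectation_prod mZ lawZ indZ (maxn i j).+1 iu.
  have uE w : \prod_(l < (maxn i j).+1) u l (Z l w) = f (Z i w) * f (Z j w).
    exact: (prod2 i j (fun l => f (Z l w)) ij).
  split; first by apply: eq_integrable a => // w _; rewrite /= uE.
  transitivity (\int[P]_w \prod_(l < (maxn i j).+1) u l (Z l w)).
    by apply: eq_Rintegral => w _; rewrite uE.
  rewrite b (bigD1 (inord i))//= /u inordK ?ltnS ?leq_maxl// eqxx /=.
  by rewrite f0 mul0r.
have sqE w : psum n w ^+ 2 = \sum_(i < n) \sum_(j < n) f (Z i w) * f (Z j w).
  by rewrite expr2 mulr_suml; apply: eq_bigr => i _; rewrite mulr_sumr.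
split.
  apply: (@eq_integrable _ _ _ _ _ measurableT (EFin \o (fun w => \sum_(i < n) \sum_(j < n) f (Z i w) * f (Z j w)))).
    by move=> w _; rewrite /= sqE.
  apply: integrable_sumR => i; apply: integrable_sumR => j; exact: (cross i j).1.
under eq_Rintegral do rewrite sqE.
rewrite Rintegral_sum; last by move=> i; apply: integrable_sumR => j; exact: (cross i j).1.
transitivity (\sum_(i < n) v); last by rewrite sumr_const card_ord mulr_natl.
apply: eq_bigr => i _; rewrite Rintegral_sum; last by move=> j; exact: (cross i j).1.
rewrite (bigD1 i)//= (cross i i).2 eqxx big1 ?addr0// => j ji.
by rewrite (cross i j).2 ifN// eq_sym.
Qed.

End iid_sums.

(** * Uniform continuity on boxes *)

Section box_uniform_continuity.
Context {R : realType} {q : nat}.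
Implicit Types (x y : 'cV[R]_q) (g : 'cV[R]_q -> R).

Lemma box_compact (K : R) :
  compact [set v : 'rV[R]_q | forall j, -K <= v ord0 j <= K].
Proof.
have := @rV_compact R q (fun=> [set` `[- K, K]]) (fun=> segment_compact (a := - K) (b := K)).
congr compact; apply/seteqP; split => v /= h j; have := h j; by rewrite in_itv/=.
Qed.

(** Compactness of the box; [y] may lie slightly outside it. *)
Lemma box_uniform_continuous g (K e : R) : continuous g -> 0 < e ->
  exists2 del : R, 0 < del & forall x y, (forall j, `|x j ord0| <= K) ->
    (forall j, `|x j ord0 - y j ord0| < del) -> `|g x - g y| <= e.
Proof.
move=> cg e0.
pose Q (del : R) (v : 'rV[R]_q) := forall y,
  (forall j, `|v ord0 j - y j ord0| < del) -> `|g v^T - g y| <= e.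
have : \forall del \near 0^'+, [set v : 'rV[R]_q | forall j, -K <= v ord0 j <= K] `<=` Q del.
  have /compact_near_coveringP := (@box_compact K); apply => v _.
  have e20 : 0 < e / 2 by rewrite divr_gt0.
  have /nbhs_ballP[eta /= eta0 h] := cg v^T _ (nbhsx_ballx (g v^T) _ e20).
  have eta20 : 0 < eta / 2 by rewrite divr_gt0.
  exists (ball v (eta / 2), [set del | del < eta / 2]) => /=.
    split; first exact: nbhsx_ballx.
    exact: nbhs_right_lt.
  move=> [v' del] /= [bv dl] y hy.
  have h1 : ball (g v^T) (e / 2) (g v'^T).
    apply: h; split => // i j; rewrite !mxE; have := bv.2 j i; rewrite /ball/= => /lt_le_trans; apply.
    by lra.
  have h2 : ball (g v^T) (e / 2) (g y).
    apply: h; split => // i j; rewrite mxE (ord1 j).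
    have hb : `|v ord0 i - v' ord0 i| < eta / 2 by have := bv.2 ord0 i.
    have hc := lt_trans (hy i) dl.
    by rewrite [eta]splitr; apply: le_lt_trans (ler_distD (v' ord0 i) _ _) _; exact: ltrD.
  have h1' : `|g v'^T - g v^T| < e / 2 by rewrite distrC.
  rewrite [e]splitr; apply: le_trans (ler_distD (g v^T) _ _) _.
  by apply: ltW; exact: (ltrD h1' h2).
move=> near0.
have [del [dQ d0]] : exists del : R,
    [set v : 'rV[R]_q | forall j, -K <= v ord0 j <= K] `<=` Q del /\ 0 < del.
  apply: (@filter_ex _ (0^'+) _); apply: filterI => //.
  exact: nbhs_right_gt.
exists del => // x y xK xy; have := dQ x^T _ y; rewrite trmxK; apply.
  by move=> j; rewrite mxE -ler_norml.
by move=> j; rewrite mxE.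
Qed.

End box_uniform_continuity.

(** * Bernstein operators *)

Section bernstein.
Context {R : realType}.

(** [bern n p g] is the expectation of [g S] for a binomial variable [S] with
    parameters [n] and [p], computed by conditioning on the first trial. *)
Fixpoint bern (n : nat) (p : R) (g : nat -> R) : R :=
  if n is n'.+1 then p * bern n' p (fun k => g k.+1) + (1 - p) * bern n' p g
  else g 0%N.

Lemma bern_affine n p g (e a : R) :
  bern n p (fun k => e + a * g k) = e + a * bern n p g.
Proof. by elim: n g => [//|n ih] g /=; rewrite !ih; ring. Qed.

Lemma bern_le n p g h : 0 <= p <= 1 -> (forall k, (k <= n)%N -> g k <= h k) ->
  bern n p g <= bern n p h.
Proof.
move=> /andP[p0 p1]; elim: n g h => [|n ih] g h gh /=; first exact: gh.
apply: lerD; apply: ler_wpM2l; rewrite ?subr_ge0//; apply: ih => k kn; apply: gh => //.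
exact: leqW.
Qed.

(** For [a = n p] this is the variance of the binomial law. *)
Lemma bern_sqr n p a :
  bern n p (fun k => (k%:R - a) ^+ 2) = (n%:R * p - a) ^+ 2 + n%:R * p * (1 - p).
Proof.
elim: n a => [|n ih] a /=; first by rewrite !mul0r addr0.
have -> : (fun k => (k.+1%:R - a) ^+ 2) = (fun k => (k%:R - (a - 1)) ^+ 2) :> (nat -> R).
  by apply/funext => k; rewrite -natr1; ring.
by rewrite !ih -natr1; ring.
Qed.

(** Chebyshev's argument for Bernstein polynomials: the quadratic term of the error
    bound has expectation at most [a n]. *)
Lemma bern_approx n p (c : nat -> R) c0 e a : 0 <= p <= 1 -> 0 <= a ->
  (forall k, (k <= n)%N -> `|c k - c0| <= e + a * (k%:R - n%:R * p) ^+ 2) ->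
  `|bern n p c - c0| <= e + a * n%:R.
Proof.
move=> p01 a0 h; have /andP[p0 p1] := p01.
have v : n%:R * p * (1 - p) <= n%:R :> R.
  rewrite -[leRHS]mulr1 -mulrA ler_wpM2l//; nra.
have va := ler_wpM2l a0 v.
have B b : bern n p (fun k => b + a * (k%:R - n%:R * p) ^+ 2) = b + a * (n%:R * p * (1 - p)).
  by rewrite bern_affine bern_sqr subrr expr0n add0r.
have Bn b : bern n p (fun k => b + (- a) * (k%:R - n%:R * p) ^+ 2) = b - a * (n%:R * p * (1 - p)).
  by rewrite bern_affine bern_sqr subrr expr0n add0r mulNr.
have up : bern n p c <= c0 + e + a * (n%:R * p * (1 - p)).
  rewrite -B; apply: bern_le => // k kn; have := h k kn; rewrite ler_norml => /andP[_]; lra.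
have lo : c0 - e - a * (n%:R * p * (1 - p)) <= bern n p c.
  rewrite -Bn; apply: bern_le => // k kn; have := h k kn; rewrite ler_norml => /andP[+ _]; lra.
by rewrite ler_norml; apply/andP; split; lra.
Qed.

(** The sine is strictly increasing on the interval, uniformly so by
    [sin x - sin y = 2 cos ((x + y) / 2) sin ((x - y) / 2)], where the cosine is
    at least the other factor. *)
Lemma sin_gap (x y del : R) : - (pi / 2) <= x <= pi / 2 -> - (pi / 2) <= y <= pi / 2 ->
  0 < del -> del <= `|x - y| -> 0 < sin (del / 2) /\
  2 * sin (del / 2) ^+ 2 <= `|sin x - sin y|.
Proof.
wlog xy : x y / y <= x.
  move=> hw hx hy d0; have [/hw|/ltW/hw] := leP y x; first by apply.
  by move=> h; rewrite (distrC x) (distrC (sin x)); apply: h.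
move=> /andP[x1 x2] /andP[y1 y2] d0; rewrite ger0_norm ?subr_ge0// => dxy.
have s0 : 0 < sin (del / 2) by apply: sin_gt0_pi; apply/andP; split; lra.
split => //.
have sE : sin x - sin y = 2 * (cos ((x + y) / 2) * sin ((x - y) / 2)).
  have ex : sin x = sin ((x + y) / 2 + (x - y) / 2) by congr sin; lra.
  have ey : sin y = sin ((x + y) / 2 - (x - y) / 2) by congr sin; lra.
  by rewrite ex ey sinD sinB; ring.
have ler_sin := le_mono_in (monoW_in (@ltr_sin R)).
have sd : sin (del / 2) <= sin ((x - y) / 2).
  by rewrite ler_sin ?in_itv/=; [lra|apply/andP; split; lra|apply/andP; split; lra].
have cd : sin ((x - y) / 2) <= cos ((x + y) / 2).
  have [h|h] := leP 0 (x + y).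
    have -> : cos ((x + y) / 2) = sin (pi / 2 - (x + y) / 2).
      by rewrite -[pi / 2 - _]opprB sinN sinBpihalf opprK.
    by rewrite ler_sin ?in_itv/=; [lra|apply/andP; split; lra|apply/andP; split; lra].
  rewrite -sinDpihalf.
  by rewrite ler_sin ?in_itv/=; [lra|apply/andP; split; lra|apply/andP; split; lra].
rewrite sE; apply: le_trans (ler_norm _); rewrite ler_pM2l// expr2.
by apply: ler_pM => //; [exact: ltW|exact: ltW|exact: le_trans cd].
Qed.

End bernstein.

(** * Approximation by combinations of cosines *)

Section trigonometric_approximation.
Context {R : realType} {q : nat}.
Implicit Types (x y : 'cV[R]_q) (g : 'cV[R]_q -> R).

(** Finite linear combinations of cosines of affine forms, that is, the functions
    whose expectations are determined by characteristic functions. *)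
Inductive trig_comb : ('cV[R]_q -> R) -> Prop :=
| trig_cos (c : 'cV[R]_q) (t : R) : trig_comb (fun x => cos ((c^T *m x) ord0 ord0 + t))
| trig_add f g : trig_comb f -> trig_comb g -> trig_comb (fun x => f x + g x)
| trig_scale k f : trig_comb f -> trig_comb (fun x => k * f x).

Lemma trig_cst k : trig_comb (fun=> k).
Proof.
have -> : (fun=> k) = (fun x : 'cV[R]_q => k * cos (((0 : 'cV[R]_q)^T *m x) ord0 ord0 + 0)).
  by apply/funext => x; rewrite trmx0 mul0mx mxE addr0 cos0 mulr1.
exact/trig_scale/trig_cos.
Qed.

(** The product formula for cosines makes the combinations an algebra. *)
Lemma trig_mul f g : trig_comb f -> trig_comb g -> trig_comb (fun x => f x * g x).
Proof.
move=> tf tg; elim: tf => [c t|f1 f2 _ h1 _ h2|k f1 _ h1].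
- elim: tg => [c' t'|g1 g2 _ h1 _ h2|k g1 _ h1].
  + have -> : (fun x => cos ((c^T *m x) ord0 ord0 + t) * cos ((c'^T *m x) ord0 ord0 + t')) =
      (fun x => 2^-1 * (cos (((c + c')^T *m x) ord0 ord0 + (t + t')) +
                        cos (((c - c')^T *m x) ord0 ord0 + (t - t')))).
      apply/funext => x; rewrite !linearD !linearN /= !mulmxDl mulNmx.
      set a1 := (c^T *m x); set a2 := (c'^T *m x).
      have -> : (a1 + a2) ord0 ord0 + (t + t') = (a1 ord0 ord0 + t) + (a2 ord0 ord0 + t').
        by rewrite mxE; ring.
      have -> : (a1 - a2) ord0 ord0 + (t - t') = (a1 ord0 ord0 + t) - (a2 ord0 ord0 + t').
        by rewrite !mxE; ring.
      move: (a1 ord0 ord0 + t) (a2 ord0 ord0 + t') => u v.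
      by rewrite cosD cosB; field.
    by apply/trig_scale/trig_add; exact: trig_cos.
  + by under eq_fun do rewrite mulrDr; exact: trig_add.
  + by under eq_fun do rewrite mulrCA; exact: trig_scale.
- by under eq_fun do rewrite mulrDl; exact: trig_add.
- by under eq_fun do rewrite -mulrA; exact: trig_scale.
Qed.

Lemma trig_sin_coord i k : trig_comb (fun x => sin (k * x i ord0)).
Proof.
have -> : (fun x : 'cV[R]_q => sin (k * x i ord0)) =
    (fun x : 'cV[R]_q => cos (((k *: (delta_mx i ord0 : 'cV[R]_q))^T *m x) ord0 ord0 + (- (pi / 2)))).
  apply/funext => x; rewrite cosBpihalf; congr sin.
  rewrite linearZ /= -scalemxAl mxE; congr (_ * _).
  rewrite trmx_delta mxE (bigD1 i)//= mxE !eqxx mul1r big1 ?addr0// => j ji.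
  by rewrite mxE (negbTE ji) andbF mul0r.
exact: trig_cos.
Qed.

Lemma trig_bern n (p : 'cV[R]_q -> R) (T : nat -> 'cV[R]_q -> R) :
  trig_comb p -> (forall k, trig_comb (T k)) -> trig_comb (fun x => bern n (p x) (fun k => T k x)).
Proof.
move=> tp; elim: n T => [|n ih] T tT /=; first exact: tT.
apply: trig_add; apply: trig_mul => //.
- exact: (ih (fun k => T k.+1)).
- apply: trig_add; [exact: trig_cst|].
  by under eq_fun do rewrite -mulN1r; exact: trig_scale.
- exact: ih.
Qed.

Definition set_coord x (i : 'I_q) (u : R) : 'cV[R]_q :=
  \col_j if j == i then u else x j ord0.

(** Uniform continuity on boxes, kept in place of continuity because fixing a
    coordinate obviously preserves it. *)
Definition box_unif g := forall K e : R, 0 < e ->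
  exists2 del : R, 0 < del & forall x y, (forall j, `|x j ord0| <= K) ->
    (forall j, `|x j ord0 - y j ord0| < del) -> `|g x - g y| <= e.

Lemma box_unif_set_coord g i u : box_unif g -> box_unif (fun x => g (set_coord x i u)).
Proof.
move=> ug K e e0; have [del d0 h] := ug (Num.max K `|u|) e e0.
exists del => // x y xK xy; apply: h => j; rewrite !mxE; case: eqP => _ //.
- by rewrite le_max lexx orbT.
- by rewrite le_max xK.
- by rewrite subrr normr0.
Qed.

(** Induction on the number of coordinates on which [g] depends.  In the last one,
    [x_i / K] lies in [[- pi / 2, pi / 2]], where the sine is invertible, so [g]
    is a continuous function of [p x = (1 + sin (x_i / K)) / 2] and can be
    replaced by its Bernstein polynomial; the coefficients, values of [g] at
    fixed [x_i], depend on one coordinate less.  Bernstein operators preserve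
    bounds, whence the global bound [M]. *)
Lemma trig_approx_aux r g (M : R) : (r <= q)%N -> box_unif g -> (forall x, `|g x| <= M) ->
  (forall x y, (forall j : 'I_q, (j < r)%N -> x j ord0 = y j ord0) -> g x = g y) ->
  forall K e : R, 0 < K -> 0 < e -> exists T, [/\ trig_comb T, (forall x, `|T x| <= M) &
    forall x, (forall j, `|x j ord0| <= K) -> `|T x - g x| <= e].
Proof.
elim: r g => [|r ih] g rq ug gM dep K e K0 e0.
  exists (fun=> g 0); split => [|x|x _]; [exact: trig_cst|exact: gM|].
  by rewrite (dep x 0)// subrr normr0 ltW.
pose i := Ordinal rq; have e40 : 0 < e / 4 by rewrite divr_gt0.
have M0 : 0 <= M by apply: le_trans (gM 0).
have [del0 d00 hdel] := ug K (e / 4) e40.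
pose del := Num.min del0 K.
have d0 : 0 < del by rewrite lt_min d00 K0.
have dK : del <= K by rewrite ge_min lexx orbT.
pose et := sin (del / K / 2) ^+ 2.
have et0 : 0 < et.
  rewrite exprn_gt0// sin_gt0_pi//; apply/andP; split; first by rewrite !divr_gt0.
  have : del / K <= 1 by rewrite ler_pdivrMr// mul1r.
  have := pi_ge2 R; lra.
(* [n] is so large that the Bernstein error away from the node is at most [e / 4]. *)
pose n := (Num.truncn (2 * M / et ^+ 2 / (e / 4))).+1.
have n0 : 0 < n%:R :> R by rewrite ltr0n.
have hn : 2 * M / et ^+ 2 / n%:R <= e / 4.
  by rewrite ler_pdivrMr// -ler_pdivrMl// mulrC ltW// /n truncnS_gt.
pose node k : R := K * asin (2 * k%:R / n%:R - 1).
pose p x : R := (1 + sin (K^-1 * x i ord0)) / 2.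
have tp : trig_comb p.
  rewrite /p; under eq_fun do rewrite mulrC.
  by apply/trig_scale/trig_add; [exact: trig_cst|exact: trig_sin_coord].
have p01 x : 0 <= p x <= 1.
  have := sin_geN1 (K^-1 * x i ord0); have := sin_le1 (K^-1 * x i ord0); rewrite /p => *.
  by apply/andP; split; lra.
have ihk k : exists T, [/\ trig_comb T, (forall x, `|T x| <= M) &
    forall x, (forall j, `|x j ord0| <= K) -> `|T x - g (set_coord x i (node k))| <= e / 4].
  apply: (ih (fun x => g (set_coord x i (node k)))) => //.
  - exact: ltnW.
  - exact: box_unif_set_coord.
  - move=> x y xy; apply: dep => j; rewrite ltnS !mxE => jr; case: eqP => // ji; apply: xy.
    by rewrite ltn_neqAle jr andbT; apply/eqP => jr'; apply: ji; exact/val_inj.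
have [T hT] := choice ihk.
exists (fun x => bern n (p x) (fun k => T k x)); split.
- by apply: trig_bern => // k; have [] := hT k.
- move=> x; have := @bern_approx R n (p x) (fun k => T k x) 0 M 0 (p01 x) (lexx _).
  rewrite subr0 mul0r addr0; apply => k kn; rewrite subr0 mul0r addr0.
  by have [_ h _] := hT k.
move=> x xK.
have A0 : 0 <= 2 * M / et ^+ 2 / n%:R ^+ 2 by do 2 (apply: divr_ge0; last exact: sqr_ge0); exact: mulr_ge0.
suff hall k : (k <= n)%N -> `|T k x - g x| <=
    e / 2 + 2 * M / et ^+ 2 / n%:R ^+ 2 * (k%:R - n%:R * p x) ^+ 2.
  apply: le_trans (bern_approx (p01 x) A0 hall) _.
  have -> : 2 * M / et ^+ 2 / n%:R ^+ 2 * n%:R = 2 * M / et ^+ 2 / n%:R.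
    by field; rewrite !gt_eqF.
  lra.
move=> kn; have [_ _ /(_ x xK) hk] := hT k.
apply: le_trans (ler_distD (g (set_coord x i (node k))) _ _) _.
suff hg : `|g (set_coord x i (node k)) - g x| <= e / 4 + 2 * M / et ^+ 2 / n%:R ^+ 2 * (k%:R - n%:R * p x) ^+ 2.
  lra.
have kn1 : -1 <= (2 * k%:R / n%:R - 1 : R) <= 1.
  have k01 : 0 <= (k%:R / n%:R : R) <= 1.
    by apply/andP; split; [exact: divr_ge0|rewrite ler_pdivrMr// mul1r ler_nat].
  have -> : 2 * k%:R / n%:R = 2 * (k%:R / n%:R) :> R by rewrite mulrA.
  by move: k01 => /andP[? ?]; apply/andP; split; lra.
have [clo|far] := ltP `|x i ord0 - node k| del.
  apply: (@le_trans _ _ (e / 4)); last by rewrite lerDl mulr_ge0// sqr_ge0.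
  rewrite distrC; apply: hdel => // j; rewrite mxE; case: eqP => [->|_]; last by rewrite subrr normr0.
  by apply: lt_le_trans clo _; rewrite ge_min lexx.
have sx : - (pi / 2) <= K^-1 * x i ord0 <= pi / 2.
  rewrite -ler_norml normrM gtr0_norm ?invr_gt0// mulrC ler_pdivrMr//.
  by apply: le_trans (xK i) _; rewrite ler_peMl ?(ltW K0)//; have := pi_ge2 R; lra.
have sn : - (pi / 2) <= (asin (2 * k%:R / n%:R - 1) : R) <= pi / 2.
  by rewrite asin_geNpi2// asin_lepi2.
have dK0 : 0 < del / K by rewrite divr_gt0.
have far' : del / K <= `|K^-1 * x i ord0 - asin (2 * k%:R / n%:R - 1)|.
  rewrite ler_pdivrMr// -[X in _ * X](gtr0_norm K0) -normrM mulrBl mulrAC mulVf ?gt_eqF// mul1r.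
  by rewrite [asin _ * K]mulrC.
have [_] := sin_gap sx sn dK0 far'; rewrite asinK ?in_itv//= -/et => hgap.
have -> : (k%:R - n%:R * p x) ^+ 2 = n%:R ^+ 2 * (`|sin (K^-1 * x i ord0) - (2 * k%:R / n%:R - 1)| / 2) ^+ 2.
  rewrite expr_div_n real_normK ?num_real// /p; field.
  by rewrite gt_eqF.
have hsq : et ^+ 2 <= (`|sin (K^-1 * x i ord0) - (2 * k%:R / n%:R - 1)| / 2) ^+ 2.
  by rewrite lerXn2r ?nnegrE ?divr_ge0 ?(ltW et0)//; lra.
set w := (_ / 2) ^+ 2 in hsq *.
rewrite mulrA mulfVK ?sqrf_eq0 ?gt_eqF//.
apply: (@le_trans _ _ (2 * M)).
  apply: le_trans (ler_normB _ _) _; have := gM (set_coord x i (node k)); have := gM x; lra.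
apply: le_trans (_ : 2 * M / et ^+ 2 * w <= _); last by rewrite lerDr ltW.
rewrite [leRHS]mulrAC (ler_pdivlMr _ _ (exprn_gt0 2 et0)).
by apply: ler_wpM2l hsq; rewrite mulr_ge0.
Qed.

Lemma trig_approx g (M : R) : continuous g -> (forall x, `|g x| <= M) ->
  forall K e : R, 0 < K -> 0 < e -> exists T, [/\ trig_comb T, (forall x, `|T x| <= M) &
    forall x, (forall j, `|x j ord0| <= K) -> `|T x - g x| <= e].
Proof.
move=> cg gM; apply: (@trig_approx_aux q) => // [K e e0|x y xy].
  exact: box_uniform_continuous.
by congr g; apply/matrixP => i j; rewrite (ord1 j) xy.
Qed.

End trigonometric_approximation.

(** * Continuity theorem for characteristic functions *)

Section levy_continuity.
Context {R : realType} {q : nat}.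
Implicit Types (f T : 'cV[R]_q -> R).

Lemma trig_bounded T : trig_comb T -> exists B, forall x, `|T x| <= B.
Proof.
elim=> [c t|f g _ [B1 h1] _ [B2 h2]|k f _ [B h]].
- by exists 1 => x; exact: cos_max.
- by exists (B1 + B2) => x; apply: le_trans (ler_normD _ _) _; apply: lerD.
- by exists (`|k| * B) => x; rewrite normrM ler_wpM2l.
Qed.

Lemma Rintegral_close d (S : measurableType d) (P : probability S R) (A : set S)
    (g h : S -> R) (M e : R) : measurable A ->
  measurable_fun setT g -> measurable_fun setT h ->
  (forall w, `|g w| <= M) -> (forall w, `|h w| <= M) ->
  (forall w, ~ A w -> `|h w - g w| <= e) -> 0 <= e ->
  `|\int[P]_w h w - \int[P]_w g w| <= e + 2 * M * fine (P A).
Proof.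
move=> mA mg mh gM hM hg e0.
have ig : P.-integrable setT (EFin \o g) by exact: (@bounded_integrable _ _ _ _ _ M).
have ih : P.-integrable setT (EFin \o h) by exact: (@bounded_integrable _ _ _ _ _ M).
have i1 := integrable_indicR P mA.
rewrite -RintegralB//; apply: le_trans (le_normr_Rintegral measurableT (integrableBR ih ig)) _.
have i2 := integrableZlR (2 * M) i1.
have i3 := integrableDR (integrable_cstR P e) i2.
rewrite -(Rintegral_indic_prob P mA) -RintegralZl// -[X in X + _](Rintegral_cst_prob P) -RintegralD//; last exact: integrable_cstR.
apply: le_Rintegral => //; first exact: (integrable_norm (integrableBR ih ig)).
move=> w _; rewrite indicE; case: (boolP (w \in A)) => [_|]; rewrite ?mulr1 ?mulr0 ?addr0.
  by apply: le_trans (ler_normB _ _) _; have := gM w; have := hM w; lra.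
by rewrite notin_setE => /hg.
Qed.

Section random_vector.
Context d (S : measurableType d) (P : probability S R) (V : S -> 'cV[R]_q).
Hypothesis mV : forall j, measurable_fun setT (fun w => V w j ord0).

Lemma measurable_form (c : 'cV[R]_q) :
  measurable_fun setT (fun w => (c^T *m V w) ord0 ord0).
Proof.
under eq_fun do rewrite mxE.
by apply: measurable_sum => j; apply: measurable_funM.
Qed.

Lemma measurable_trig T : trig_comb T -> measurable_fun setT (T \o V).
Proof.
elim=> [c t|f g _ h1 _ h2|k f _ h] /=.
- apply: (measurableT_comp (f := @cos R)).
    exact: measurable_cosR.
  by apply: measurable_funD => //; exact: measurable_form.
- exact: measurable_funD.
- exact: measurable_funM.
Qed.

Lemma integrable_trig T : trig_comb T -> P.-integrable setT (EFin \o (T \o V)).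
Proof.
move=> tT; have [B hB] := trig_bounded tT.
by apply: (@bounded_integrable _ _ _ _ _ B) => [|w]; [exact: measurable_trig|exact: hB].
Qed.

(** A continuous function is a pointwise limit of combinations of cosines. *)
Lemma measurable_continuous f (M : R) : continuous f -> (forall x, `|f x| <= M) ->
  measurable_fun setT (f \o V).
Proof.
move=> cf fM.
have h n : exists T, trig_comb T /\ forall x : 'cV[R]_q,
    (forall j, `|x j ord0| <= n.+1%:R) -> `|T x - f x| <= n.+1%:R^-1.
  have n0 : 0 < n.+1%:R^-1 :> R by rewrite invr_gt0.
  by have [T [tT _ hT]] := trig_approx cf fM (ltr0Sn R n) n0; exists T.
have [T hT] := choice h.
apply: (@measurable_fun_cvg _ _ _ setT (fun n => T n \o V)) => //.
  by move=> n; apply: measurable_trig; have [] := hT n.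
move=> w _; apply/cvgrPdist_le => e e0.
have V0 : 0 <= \sum_j `|V w j ord0| by apply: sumr_ge0.
near=> n; rewrite distrC; have [_ /(_ (V w))] := hT n; move=> /(_ _)/le_trans; apply.
  move=> j; apply: (@le_trans _ _ (\sum_j `|V w j ord0|)).
    by rewrite (bigD1 j)//= lerDl sumr_ge0.
  apply: (@le_trans _ _ n%:R); last by rewrite ler_nat.
  by near: n; exact: nbhs_infty_ger.
apply: ltW; near: n; exact: (near_infty_natSinv_lt (PosNum e0)).
Unshelve. all: by end_near.
Qed.

Definition tail (K : R) : set S := [set w | exists j, K < `|V w j ord0|].

Lemma measurable_tail K : measurable (tail K).
Proof.
have -> : tail K = \bigcup_(j in [set: 'I_q]) [set w | K < `|V w j ord0|].
  by apply/seteqP; split => [w [j h]|w [j _ h]]; exists j.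
apply: fin_bigcup_measurable => // j _.
have mn : measurable_fun setT (fun w => `|V w j ord0|) by exact: measurableT_comp.
rewrite -[X in measurable X]setTI; have := mn measurableT [set` `]K, +oo[] (measurable_itv _).
by congr (measurable (_ `&` _)); apply/seteqP; split => w; rewrite /= in_itv/= andbT.
Qed.

(** Each point leaves all but finitely many of these sets: dominated convergence. *)
Lemma tail_cvg0 : fine (P (tail n%:R)) @[n --> \oo] --> (0 : R).
Proof.
have -> : (fun n => fine (P (tail n%:R))) = (fun n => \int[P]_w (\1_(tail n%:R) w : R)).
  by apply/funext => n; rewrite Rintegral_indic_prob//; exact: measurable_tail.
rewrite -[0](Rintegral_cst_prob P).
apply: (@Rintegral_cvg _ _ _ _ _ _ (fun=> 1)) => //.
- by move=> n; apply: measurable_indic; exact: measurable_tail.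
- move=> w; apply: cvg_near_cst; near=> n; rewrite indicE memNset//= => -[j].
  apply/negP; rewrite -leNgt; apply: (@le_trans _ _ (\sum_j `|V w j ord0|)).
    by rewrite (bigD1 j)//= lerDl sumr_ge0.
  by near: n; exact: nbhs_infty_ger.
- exact: integrable_cstR.
- by move=> n w; rewrite indicE; case: (_ \in _); rewrite ?normr1 ?normr0.
Unshelve. all: by end_near.
Qed.

Lemma expectationE f (M : R) : continuous f -> (forall x, `|f x| <= M) ->
  ('E_P[f \o V] = (\int[P]_w f (V w))%:E)%E.
Proof.
move=> cf fM; rewrite unlock /Rintegral fineK//.
have := @bounded_integrable _ _ _ P (f \o V) M (measurable_continuous cf fM) (fun w => fM _).
by move=> i; exact: (integrable_fin_num measurableT i).
Qed.

End random_vector.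

Lemma trig_cvg dO (O : measurableType dO) (P : probability O R) (U : nat -> O -> 'cV[R]_q)
    (N : probability (q.-tuple R) R) T :
  (forall n j, measurable_fun setT (fun w => U n w j ord0)) ->
  (forall (c : 'cV[R]_q) (t : R), \int[P]_w cos ((c^T *m U n w) ord0 ord0 + t) @[n --> \oo] -->
     \int[N]_x cos ((c^T *m colv x) ord0 ord0 + t)) ->
  trig_comb T -> \int[P]_w T (U n w) @[n --> \oo] --> \int[N]_x T (colv x).
Proof.
move=> mU hU.
have mC j : measurable_fun setT (fun x : q.-tuple R => colv x j ord0).
  by under eq_fun do rewrite mxE; exact: measurable_tnth.
elim=> [//|f g tf h1 tg h2|k f tf h].
- rewrite (RintegralD measurableT (integrable_trig N mC tf) (integrable_trig N mC tg)).
  have -> : (fun n => \int[P]_w (f (U n w) + g (U n w))) =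
      (fun n => \int[P]_w f (U n w) + \int[P]_w g (U n w)).
    apply/funext => n; apply: RintegralD => //.
      exact: (integrable_trig P (mU n) tf).
    exact: (integrable_trig P (mU n) tg).
  exact: cvgD.
- rewrite (RintegralZl _ measurableT (integrable_trig N mC tf)).
  have -> : (fun n => \int[P]_w (k * f (U n w))) = (fun n => k * \int[P]_w f (U n w)).
    by apply/funext => n; exact: (RintegralZl _ measurableT (integrable_trig P (mU n) tf)).
  exact: cvgMr.
Qed.

(** Outside a box of probability close to [1] for all the laws involved, [f] and an
    approximating combination of cosines are both bounded by [M]; inside they are
    close, and the expectations of the combination converge. *)
Theorem levy_continuity dO (O : measurableType dO) (P : probability O R)
    (U : nat -> O -> 'cV[R]_q) (N : probability (q.-tuple R) R) :
  (forall n j, measurable_fun setT (fun w => U n w j ord0)) ->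
  (forall (c : 'cV[R]_q) (t : R), \int[P]_w cos ((c^T *m U n w) ord0 ord0 + t) @[n --> \oo] -->
     \int[N]_x cos ((c^T *m colv x) ord0 ord0 + t)) ->
  (forall e : R, 0 < e -> exists K : R,
     \forall n \near \oo, fine (P (tail (U n) K)) <= e) ->
  cvg_in_distribution P U N.
Proof.
move=> mU hU tight f cf [M fM].
have mC j : measurable_fun setT (fun x : q.-tuple R => colv x j ord0).
  by under eq_fun do rewrite mxE; exact: measurable_tnth.
have M0 : 0 <= M by apply: le_trans (fM 0).
have -> : (fun n => 'E_P[fun w => f (U n w)])%E = EFin \o (fun n => \int[P]_w f (U n w)).
  by apply/funext => n; exact: (expectationE P (mU n) cf fM).
rewrite (expectationE N mC cf fM).
apply: cvg_EFin; first exact: nearW.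
apply/cvgrPdist_le => e e0.
pose tau := e / 8 / (M + 1).
have t0 : 0 < tau by rewrite !divr_gt0// ltr_pwDr.
have Mt : 2 * M * tau <= e / 4.
  have -> : e / 4 = 2 * (M + 1) * tau by rewrite /tau; field; rewrite gt_eqF// ltr_pwDr.
  by apply: ler_wpM2r; [exact: ltW|lra].
have [K1 hK1] := tight _ t0.
have [m hK2] : exists m : nat, fine (N (tail (@colv R q) m%:R)) <= tau.
  have /cvgrPdist_le/(_ _ t0) := tail_cvg0 N mC.
  move=> /filter_ex[m]; rewrite sub0r normrN => h; exists m; exact: le_trans (ler_norm _) h.
have tailS d (S : measurableType d) (Q : probability S R) (V : S -> 'cV[R]_q) (A B : R) :
    (forall j, measurable_fun setT (fun w => V w j ord0 : R)) -> A <= B ->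
    fine (Q (tail V B)) <= fine (Q (tail V A)).
  move=> mV AB; rewrite fine_le ?fin_num_measure//; try exact: measurable_tail.
  apply: le_measure; rewrite ?inE; try exact: measurable_tail.
  by move=> w [j h]; exists j; exact: le_lt_trans h.
pose K := Num.max (Num.max K1 m%:R) 1.
have K0 : 0 < K by rewrite lt_max ltr01 orbT.
have KK1 : K1 <= K by rewrite !le_max lexx.
have Km : m%:R <= K by rewrite !le_max lexx orbT.
have e80 : 0 < e / 8 by rewrite divr_gt0.
have [T [tT TM hT]] := trig_approx cf fM K0 e80.
have /cvgrPdist_le/(_ _ (divr_gt0 e0 (ltr0Sn R 3))) hcv := trig_cvg mU hU tT.
have close d (S : measurableType d) (Q : probability S R) (V : S -> 'cV[R]_q) :
    (forall j, measurable_fun setT (fun w => V w j ord0 : R)) ->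
    `|\int[Q]_w T (V w) - \int[Q]_w f (V w)| <= e / 8 + 2 * M * fine (Q (tail V K)).
  move=> mV; apply: Rintegral_close => //; [exact: measurable_tail| | | |exact: ltW].
  - exact: (measurable_continuous mV cf fM).
  - exact: (measurable_trig mV tT).
  - move=> w nt; apply: hT => j; rewrite leNgt; apply/negP => h; apply: nt.
    by exists j.
have aN := close _ _ N (@colv R q) mC.
near=> n.
have aP := close _ _ P (U n) (mU n).
have tP : fine (P (tail (U n) K)) <= tau.
  by apply: le_trans (tailS _ _ P (U n) _ _ (mU n) KK1) _; near: n.
have tN : fine (N (tail (@colv R q) K)) <= tau.
  exact: le_trans (tailS _ _ N (@colv R q) _ _ mC Km) hK2.
have hn : `|\int[N]_x T (colv x) - \int[P]_w T (U n w)| <= e / 4 by near: n.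
have M20 : 0 <= 2 * M by rewrite mulr_ge0.
have bP := ler_wpM2l M20 tP; have bN := ler_wpM2l M20 tN.
move: aN aP hn; rewrite /= !ler_norml => /andP[h1 h2] /andP[h3 h4] /andP[h5 h6].
by apply/andP; split; lra.
Unshelve. all: by end_near.
Qed.

End levy_continuity.

(** * Multivariate central limit theorem with a negligible remainder *)

Section central_limit.
Context {R : realType} {q : nat}.

Lemma cos_lip (x y : R) : `|cos x - cos y| <= `|x - y|.
Proof.
have ex : cos x = cos ((x + y) / 2 + (x - y) / 2) by congr cos; lra.
have ey : cos y = cos ((x + y) / 2 - (x - y) / 2) by congr cos; lra.
rewrite ex ey cosD cosB.
set u := (x + y) / 2; set v := (x - y) / 2.
have -> : cos u * cos v - sin u * sin v - (cos u * cos v + sin u * sin v) =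
  - (2 * (sin u * sin v)) by ring.
have -> : `|x - y| = 2 * `|v| by rewrite -[2 in RHS]gtr0_norm// -normrM /v; congr `|_|; lra.
rewrite normrN normrM gtr0_norm// ler_pM2l// normrM.
by rewrite -[leRHS]mul1r; apply: ler_pM => //; [exact: sin_max|exact: norm_sin_le].
Qed.

Lemma Rintegral_cosD d (S : measurableType d) (Q : probability S R) (l : S -> R) (t : R) :
  measurable_fun setT l ->
  \int[Q]_x cos (l x + t) = \int[Q]_x cos (l x) * cos t - \int[Q]_x sin (l x) * sin t.
Proof.
move=> ml.
have ic : Q.-integrable setT (EFin \o (fun x => cos (l x))).
  apply: (@bounded_integrable _ _ _ _ _ 1) => [|x]; last exact: cos_max.
  exact: (measurableT_comp measurable_cosR).
have is_ : Q.-integrable setT (EFin \o (fun x => sin (l x))).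
  apply: (@bounded_integrable _ _ _ _ _ 1) => [|x]; last exact: sin_max.
  exact: (measurableT_comp measurable_sinR).
rewrite [X in _ = X - _]mulrC [X in _ = _ - X]mulrC -(RintegralZl _ measurableT ic) -(RintegralZl _ measurableT is_).
rewrite -(RintegralB measurableT (integrableZlR _ ic) (integrableZlR _ is_)).
by apply: eq_Rintegral => x _; rewrite cosD; ring.
Qed.

(** A linear form has a univariate normal law; expand the cosine of the sum. *)
Lemma normal_char (N : probability (q.-tuple R) R) (L : 'M[R]_q) (c : 'cV[R]_q) (t : R) :
  is_normal0 N L -> 0 <= (c^T *m L *m c) ord0 ord0 ->
  \int[N]_x cos ((c^T *m colv x) ord0 ord0 + t) =
  expR (- ((c^T *m L *m c) ord0 ord0 / 2)) * cos t.
Proof.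
move=> hN; set v := _ ord0 ord0 => v0.
have mC := @measurable_cosR R.
have mS := @measurable_sinR R.
have lm := measurable_linear_form c.
have law A : measurable A -> N ((fun x => (c^T *m colv x) ord0 ord0) @^-1` A) = normal_law v A.
  by move=> mA; rewrite normal_lawE; exact: hN.
have ic : (normal_law v).-integrable setT (EFin \o @cos R).
  by apply: (@bounded_integrable _ _ _ _ _ 1) => // x; exact: cos_max.
have is_ : (normal_law v).-integrable setT (EFin \o @sin R).
  by apply: (@bounded_integrable _ _ _ _ _ 1) => // x; exact: sin_max.
have [jc ec] := law_Rintegral lm law ic; have [js es] := law_Rintegral lm law is_.
have [hc hs] := normal_law_char v0.
rewrite Rintegral_cosD//.
have -> : \int[N]_x cos ((c^T *m colv x) ord0 ord0) = expR (- (v / 2)) by rewrite -hc.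
have -> : \int[N]_x sin ((c^T *m colv x) ord0 ord0) = 0 by rewrite -hs.
by rewrite mul0r subr0.
Qed.

Context dO (O : measurableType dO) (P : probability O R).
Context dT (T : measurableType dT) (F : probability T R) (Z : nat -> O -> T).
Hypothesis mZ : forall i, measurable_fun setT (Z i).
Hypothesis lawZ : forall i A, measurable A -> P (Z i @^-1` A) = F A.
Hypothesis indZ : mutually_independent P Z.
Variable r : T -> 'cV[R]_q.
Hypothesis mr : forall j, measurable_fun setT (fun z => r z j ord0).
Hypothesis ir2 : forall i j, F.-integrable setT (EFin \o (fun z => (r z *m (r z)^T) i j)).
Hypothesis r0 : forall j, \int[F]_z r z j ord0 = 0.

Let form (c : 'cV[R]_q) (z : T) : R := (c^T *m r z) ord0 ord0.

Let mform c : measurable_fun setT (form c).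
Proof. exact: measurable_form. Qed.

Let iform2 c : F.-integrable setT (EFin \o (fun z => form c z ^+ 2)).
Proof.
rewrite (_ : (fun z => _) = fun z => \sum_j \sum_i (c i ord0 * c j ord0) * (r z *m (r z)^T) i j); last first.
  by apply/funext => z; exact: sqr_linear_form.
by do 2 (apply: integrable_sumR => ?); exact: integrableZlR.
Qed.

Let iform c : F.-integrable setT (EFin \o form c).
Proof. exact: (integrable_of_sqr (mform c) (iform2 c)). Qed.

Let ir j : F.-integrable setT (EFin \o (fun z => r z j ord0)).
Proof.
apply: integrable_of_sqr => //; have := ir2 j j; apply: eq_integrable => // z _ /=.
by rewrite mxE big_ord1 mxE expr2.
Qed.

Let form0 c : \int[F]_z form c z = 0.
Proof.
transitivity (\int[F]_z \sum_j c j ord0 * r z j ord0).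
  by apply: eq_Rintegral => z _; rewrite /form mxE; apply: eq_bigr => j _; rewrite mxE.
rewrite Rintegral_sum; last by move=> j; exact: integrableZlR.
by rewrite big1// => j _; rewrite (RintegralZl _ measurableT (ir j)) r0 mulr0.
Qed.

Definition scaled_mean (n : nat) (w : O) : 'cV[R]_q :=
  Num.sqrt n.+1%:R *: sample_mean n (fun i => Z i w) r.

Lemma scaled_mean_form c n w :
  (c^T *m scaled_mean n w) ord0 ord0 = Num.sqrt n.+1%:R^-1 * psum Z (form c) n.+1 w.
Proof.
have s : Num.sqrt n.+1%:R * n.+1%:R^-1 = Num.sqrt n.+1%:R^-1 :> R.
  rewrite sqrtrV// -[X in _ * X^-1](sqr_sqrtr (ler0n R n.+1)) expr2 invfM mulrA.
  by rewrite mulfV ?mul1r// sqrtr_eq0 -ltNge ltr0n.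
rewrite /scaled_mean /sample_mean scalerA s -scalemxAr mxE mulmx_sumr summxE; congr (_ * _).
Qed.

Lemma scaled_mean_coord n w j : scaled_mean n w j ord0 =
  Num.sqrt n.+1%:R^-1 * psum Z (fun z => r z j ord0) n.+1 w.
Proof.
have e (v : 'cV[R]_q) : v j ord0 = (((delta_mx j ord0 : 'cV[R]_q)^T *m v) ord0 ord0).
  by rewrite trmx_delta -rowE mxE.
rewrite e scaled_mean_form; congr (_ * _); apply: eq_bigr => i _.
by rewrite /form -e.
Qed.

Lemma measurable_scaled_mean n j : measurable_fun setT (fun w => scaled_mean n w j ord0).
Proof.
under eq_fun do rewrite scaled_mean_coord.
by apply: measurable_funM => //; exact: measurable_psum.
Qed.

Lemma scaled_mean_second_moment j n :
  P.-integrable setT (EFin \o (fun w => scaled_mean n w j ord0 ^+ 2)) /\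
  \int[P]_w scaled_mean n w j ord0 ^+ 2 = \int[F]_z r z j ord0 ^+ 2.
Proof.
have i2 : F.-integrable setT (EFin \o (fun z => r z j ord0 ^+ 2)).
  by have := ir2 j j; apply: eq_integrable => // z _ /=; rewrite mxE big_ord1 mxE expr2.
have [is2 es2] := second_moment_psum mZ lawZ indZ i2 (ir j) (r0 j) n.+1.
have E : (fun w => scaled_mean n w j ord0 ^+ 2) =
    (fun w => n.+1%:R^-1 * psum Z (fun z => r z j ord0) n.+1 w ^+ 2).
  by apply/funext => w; rewrite scaled_mean_coord exprMn sqr_sqrtr// invr_ge0.
rewrite E; split; first exact: integrableZlR.
by rewrite (RintegralZl _ measurableT is2) es2 mulrA mulVf// mul1r.
Qed.

Variables (L : 'M[R]_q) (N : probability (q.-tuple R) R).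
Hypothesis LE : forall c : 'cV[R]_q, (c^T *m L *m c) ord0 ord0 = \int[F]_z (c^T *m r z) ord0 ord0 ^+ 2.
Hypothesis hN : is_normal0 N L.
Variable xi : nat -> O -> 'cV[R]_q.
Hypothesis mxi : forall n j, measurable_fun setT (fun w => xi n w j ord0).
Hypothesis xi0 : forall K : R, 0 < K -> fine (P (tail (xi n) K)) @[n --> \oo] --> (0 : R).

(** The characteristic functions converge because the remainder changes them by at
    most its size, cosines being Lipschitz.  Tightness follows from the second
    moments of the normalized sum, which do not depend on [n]. *)
Theorem central_limit_slutsky :
  cvg_in_distribution P (fun n w => scaled_mean n w + xi n w) N.
Proof.
have mC := @measurable_cosR R.
have mS := @measurable_sinR R.
have mU n j : measurable_fun setT (fun w => (scaled_mean n w + xi n w) j ord0).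
  under eq_fun do rewrite mxE.
  by apply: measurable_funD => //; exact: measurable_scaled_mean.
apply: levy_continuity => //.
- move=> c t; rewrite (normal_char t hN) ?LE; last first.
    by apply: Rintegral_ge0 => z _; exact: sqr_ge0.
  have [cc cs] := char_psum_cvg mZ lawZ indZ (mform c) (iform2 c) (iform c) (form0 c).
  have msc n : measurable_fun setT (fun w => (c^T *m scaled_mean n w) ord0 ord0).
    by apply: measurable_form => j; exact: measurable_scaled_mean.
  have lim0 : \int[P]_w cos ((c^T *m scaled_mean n w) ord0 ord0 + t) @[n --> \oo] -->
      expR (- (\int[F]_z (c^T *m r z) ord0 ord0 ^+ 2 / 2)) * cos t.
    have -> : (fun n => \int[P]_w cos ((c^T *m scaled_mean n w) ord0 ord0 + t)) =
      (fun n => \int[P]_w cos (Num.sqrt n.+1%:R^-1 * psum Z (form c) n.+1 w) * cos t -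
                \int[P]_w sin (Num.sqrt n.+1%:R^-1 * psum Z (form c) n.+1 w) * sin t).
      apply/funext => n; rewrite (Rintegral_cosD P t (msc n)).
      by congr (_ * _ - _ * _); apply: eq_Rintegral => w _; rewrite scaled_mean_form.
    rewrite -[X in _ --> X]subr0 -[X in _ --> _ - X](mul0r (sin t)).
    by apply: cvgB; exact: cvgMl.
  apply/cvgrPdist_le => e e0.
  pose C := 1 + \sum_j `|c j ord0|.
  have C0 : 0 < C by rewrite ltr_pwDl// sumr_ge0.
  pose K := e / 4 / C; have K0 : 0 < K by rewrite !divr_gt0.
  have e40 : 0 < e / 4 by rewrite divr_gt0.
  have e80 : 0 < e / 8 by rewrite divr_gt0.
  have /cvgrPdist_le/(_ _ e40) h1 := lim0.
  have /cvgrPdist_le/(_ _ e80) h2 := xi0 K0.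
  near=> n.
  have hx : fine (P (tail (xi n) K)) <= e / 8.
    apply: le_trans (ler_norm _) _; rewrite -normrN -[X in `|X|]sub0r.
    by near: n.
  have hl : `|expR (- (\int[F]_z (c^T *m r z) ord0 ord0 ^+ 2 / 2)) * cos t -
     \int[P]_w cos ((c^T *m scaled_mean n w) ord0 ord0 + t)| <= e / 4 by near: n.
  have cl : `|\int[P]_w cos ((c^T *m (scaled_mean n w + xi n w)) ord0 ord0 + t) -
     \int[P]_w cos ((c^T *m scaled_mean n w) ord0 ord0 + t)| <= e / 4 + 2 * 1 * fine (P (tail (xi n) K)).
    apply: Rintegral_close => //; [exact: measurable_tail| | | | | |exact: ltW].
    - by apply: (measurableT_comp mC); apply: measurable_funD.
    - apply: (measurableT_comp mC); apply: measurable_funD => //.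
      exact: measurable_form.
    - by move=> w; exact: cos_max.
    - by move=> w; exact: cos_max.
    move=> w nt; apply: le_trans (cos_lip _ _) _.
    have -> : (c^T *m (scaled_mean n w + xi n w)) ord0 ord0 + t -
      ((c^T *m scaled_mean n w) ord0 ord0 + t) = (c^T *m xi n w) ord0 ord0.
      by rewrite mulmxDr [X in X + t - _]mxE; ring.
    rewrite mxE; apply: le_trans (ler_norm_sum _ _ _) _.
    apply: (@le_trans _ _ (\sum_j `|c j ord0| * K)).
      apply: ler_sum => j _; rewrite mxE normrM ler_wpM2l// leNgt; apply/negP => hK.
      by apply: nt; exists j.
    rewrite -mulr_suml; have -> : e / 4 = C * K by rewrite /K; field; rewrite gt_eqF.
    by rewrite ler_wpM2r ?(ltW K0)// /C lerDr.
  by move: hl cl; rewrite !ler_norml => /andP[a1 a2] /andP[a3 a4]; apply/andP; split; lra.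
- move=> e e0; pose v := \sum_j \int[F]_z r z j ord0 ^+ 2.
  have vj j : 0 <= \int[F]_z r z j ord0 ^+ 2 by apply: Rintegral_ge0 => z _; exact: sqr_ge0.
  have v0 : 0 <= v by exact: sumr_ge0.
  have e20 : 0 < e / 2 by rewrite divr_gt0.
  pose K := 1 + v / (e / 2).
  (* Bounding the indicator of the tail by [|sum| ^ 2 / K ^ 2]: this [K] makes the
     bound at most [e / 2]. *)
  have K1 : 1 <= K by rewrite lerDl divr_ge0// ltW.
  have K0 : 0 < K by apply: lt_le_trans K1.
  have vK : v / K ^+ 2 <= e / 2.
    rewrite ler_pdivrMr ?exprn_gt0//; apply: (@le_trans _ _ (e / 2 * K)).
      have -> : e / 2 * K = e / 2 + v by rewrite /K; field; rewrite gt_eqF.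
      by rewrite lerDr ltW.
    by rewrite ler_pM2l// ler_eXnr.
  have /cvgrPdist_le/(_ _ e20) h2 := xi0 ltr01.
  exists (K + 1); near=> n.
  have hx : fine (P (tail (xi n) 1)) <= e / 2.
    apply: le_trans (ler_norm _) _; rewrite -normrN -[X in `|X|]sub0r.
    by near: n.
  have mtU : measurable (tail (fun w => scaled_mean n w + xi n w) (K + 1)).
    exact: measurable_tail.
  have mtx : measurable (tail (xi n) 1) by exact: measurable_tail.
  have i1 := @integrable_indicR R _ _ P.
  have iS j := (scaled_mean_second_moment j n).1.
  have iSS : P.-integrable setT (EFin \o (fun w => \sum_j scaled_mean n w j ord0 ^+ 2)).
    exact: integrable_sumR.
  have vE : v = \int[P]_w \sum_j scaled_mean n w j ord0 ^+ 2.
    rewrite Rintegral_sum//; apply: eq_bigr => j _.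
    by have [_ ->] := scaled_mean_second_moment j n.
  apply: (@le_trans _ _ (fine (P (tail (xi n) 1)) + v / K ^+ 2)); last lra.
  rewrite -!Rintegral_indic_prob// vE mulrC -(RintegralZl _ measurableT iSS) -RintegralD//; last 2 first.
  - exact: i1.
  - exact: integrableZlR.
  apply: le_Rintegral => //; first exact: i1.
    by apply: integrableDR; [exact: i1|exact: integrableZlR].
  move=> w _; have S0 : 0 <= \sum_j scaled_mean n w j ord0 ^+ 2.
    by apply: sumr_ge0 => j _; exact: sqr_ge0.
  have KS : 0 <= (K ^+ 2)^-1 * \sum_j scaled_mean n w j ord0 ^+ 2.
    by rewrite mulr_ge0// invr_ge0 sqr_ge0.
  rewrite !indicE; case: (boolP (w \in tail (fun w => _) _)) => [|_]; last by rewrite addr_ge0.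
  rewrite inE => -[j]; rewrite mxE => h; case: (boolP (w \in tail (xi n) 1)) => [_|].
    by rewrite lerDl.
  rewrite notin_setE => nx; rewrite add0r mulrC ler_pdivlMr ?exprn_gt0// mul1r.
  have hxi : `|xi n w j ord0| <= 1 by rewrite leNgt; apply/negP => hx1; apply: nx; exists j.
  have hS : K <= `|scaled_mean n w j ord0|.
    by have := ler_normD (scaled_mean n w j ord0) (xi n w j ord0); lra.
  rewrite (bigD1 j)//= -[X in _ <= X + _]real_normK ?num_real//.
  apply: (@le_trans _ _ (`|scaled_mean n w j ord0| ^+ 2)).
    by rewrite lerXn2r ?nnegrE// ltW.
  by rewrite lerDl sumr_ge0// => i _; exact: sqr_ge0.
Unshelve. all: by end_near.
Qed.

End central_limit.

(** * Asymptotic normality of the projected minimizer *)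

Section symmetric_pseudoinverse.
Context {R : realType} {q : nat} (W : 'M[R]_q).
Hypothesis sW : W^T = W.

Lemma mpinv_sym : (mpinv W)^T = mpinv W.
Proof.
apply: (@is_mpinv_uniq _ _ _ W); last exact: mpinvP.
move: (mpinv W) (mpinvP W) => M [h1 h2 h3 h4].
have e1 : W *m M^T = M *m W by rewrite -{1}sW -trmx_mul h4.
have e2 : M^T *m W = W *m M by rewrite -{1}sW -trmx_mul h3.
split.
- by apply: trmx_inj; rewrite !trmx_mul trmxK sW mulmxA h1.
- by apply: trmx_inj; rewrite !trmx_mul trmxK sW mulmxA h2.
- by rewrite e1 h4.
- by rewrite e2 h3.
Qed.

(** For symmetric [W] the two projections [W M] and [M W] coincide. *)
Lemma orthproj_sym : orthproj W = mpinv W *m W.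
Proof.
have [h1 h2 h3 h4] := mpinvP W.
apply: (@is_orthproj_uniq _ _ _ W); first exact: orthprojP.
have e : mpinv W *m W = W *m mpinv W by rewrite -h4 trmx_mul mpinv_sym sW.
move=> v; split; first by exists (mpinv W *m v); rewrite mulmxA e.
rewrite sW mulmxBr !mulmxA. by rewrite h1 subrr.
Qed.

End symmetric_pseudoinverse.

Section norm.
Context {R : realType} {q : nat}.

Lemma coord_le_norm (v : 'cV[R]_q) j : `|v j ord0| <= `|v|.
Proof.
have -> : `|v| = mx_norm v by [].
by rewrite mx_normrE (le_bigmax 0 (fun ij => `|v ij.1 ij.2|) (j, ord0)).
Qed.

Lemma measurable_norm d (S : measurableType d) (V : S -> 'cV[R]_q) :
  (forall j, measurable_fun setT (fun w => V w j ord0)) ->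
  measurable_fun setT (fun w => `|V w|).
Proof.
move=> mV; have -> : (fun w => `|V w|) = (fun w => \big[Num.max/0]_ij `|V w ij.1 ij.2|).
  by apply/funext => w; rewrite -mx_normrE.
elim: (index_enum _) => [|ij s ih].
  by under eq_fun do rewrite big_nil; exact: measurable_cst.
under eq_fun do rewrite big_cons.
apply: measurable_maxr => //; apply: measurableT_comp => //.
by rewrite (ord1 ij.2); exact: mV.
Qed.

(** A fixed linear map preserves convergence to [0] in probability. *)
Lemma op1_tail dO (O : measurableType dO) (P : probability O R) (zeta : nat -> O -> 'cV[R]_q)
    m (Q : 'M[R]_(m, q)) (K : R) :
  (forall n j, measurable_fun setT (fun w => zeta n w j ord0)) -> op1 P zeta -> 0 < K ->
  fine (P (tail (fun w => Q *m zeta n w) K)) @[n --> \oo] --> (0 : R).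
Proof.
move=> mz oz K0; pose C := 1 + \sum_i \sum_j `|Q i j|.
have C0 : 0 < C by rewrite ltr_pwDl// sumr_ge0// => i _; rewrite sumr_ge0.
have KC : 0 < K / C by rewrite divr_gt0.
have mQ n j : measurable_fun setT (fun w => (Q *m zeta n w) j ord0).
  under eq_fun do rewrite mxE.
  by apply: measurable_sum => i; apply: measurable_funM.
have mB n : measurable [set w | K / C <= `|zeta n w|].
  rewrite -[X in measurable X]setTI.
  have := measurable_norm (mz n) measurableT (measurable_itv `[K / C, +oo[).
  by congr (measurable (_ `&` _)); apply/seteqP; split => w; rewrite /= in_itv/= andbT.
have lim : fine (P [set w | K / C <= `|zeta n w|]) @[n --> \oo] --> (0 : R).
  exact: (fine_cvg (oz _ KC)).
apply: (squeeze_cvgr _ _ lim); last exact: cvg_cst.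
near=> n; rewrite fine_ge0//= fine_le ?fin_num_measure//; first exact: measurable_tail.
apply: le_measure; rewrite ?inE//; first exact: measurable_tail.
move=> w [j hj] /=; rewrite ler_pdivrMr// ltW//; apply: lt_le_trans hj _.
rewrite mxE; apply: le_trans (ler_norm_sum _ _ _) _.
apply: (@le_trans _ _ (\sum_i `|Q j i| * `|zeta n w|)).
  by apply: ler_sum => i _; rewrite normrM ler_wpM2l// coord_le_norm.
rewrite -mulr_suml mulrC ler_wpM2l// /C.
apply: (@le_trans _ _ (\sum_i \sum_j `|Q i j|)); last by rewrite lerDr.
by rewrite [leRHS](bigD1 j)//= lerDl sumr_ge0// => i _; rewrite sumr_ge0.
Unshelve. all: by end_near.
Qed.

End norm.

Lemma Emx_empirical {R : realType} p q n (z : nat -> obs R p) (A : obs R p -> 'cV[R]_q) :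
  (forall j, measurable_fun setT (fun x => A x j ord0)) ->
  Emx (empirical n z : probability _ _) A = sample_mean n z A.
Proof.
move=> mA; apply/colP => j; rewrite [LHS]EmxE empirical_Rintegral// /sample_mean mxE summxE.
by [].
Qed.

Theorem corollary6p1 (R : realType) (p d s k : nat) (hd : (d <= p)%N)
  (* bases of monomials, each containing the constant 1 *)
  (b : 'I_s -> nat) (a : 'I_k -> 'I_d -> nat)
  (hb : exists j, b j = 0%N) (ha : exists i, forall j, a i j = 0%N)
  (* class of distributions and the functional phi *)
  (FF : set (probability (obs R p) R)) (F0 : probability (obs R p) R)
  (phi : probability (obs R p) R -> 'cV[R]_(nangles p d))
  (hconv : convex_class FF) (hF0 : FF F0)
  (* i.i.d. sample from F0 *)
  (dO : measure_display) (Omega : measurableType dO) (P : probability Omega R)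
  (Z : nat -> {RV P >-> obs R p})
  (hlaw : forall i A, measurable A -> P (Z i @^-1` A) = F0 A)
  (hind : mutually_independent P (fun i => Z i : Omega -> obs R p))
  (hemp : forall n w, FF (empirical n (fun i => Z i w) : probability _ _))
  (* existence of moments and inverses *)
  (hmom : forall F, FF F -> moments_exist hd b a F)
  (hinv0 : inverses_exist hd b a F0)
  (hinvn : (fun n => P [set w | inverses_exist hd b a
                     (empirical n (fun i => Z i w) : probability _ _)])
             @ \oo --> 1%E)
  (* phi(F) minimizes ell(., F) and satisfies the first-order condition *)
  (hphi : forall F, FF F -> inverses_exist hd b a F -> is_phi hd b a F (phi F))
  (hphim : forall n j, measurable_fun [set: Omega]
     (fun w => phi (empirical n (fun i => Z i w) : probability _ _) j ord0))
  (* dimension-reduction model *)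
  (hmodel : model_assumption hd b a F0 (phi F0))
  (* regularity conditions *)
  (phistar gstar gphistar : obs R p -> 'cV[R]_(nangles p d))
  (hphistar : influence_function FF F0 phi phistar)
  (hgstar : influence_function FF F0
     (fun F => grad_ell hd b a (phi F0) F) gstar)
  (hgphistar : influence_function FF F0
     (fun F => grad_ell hd b a (phi F) F) gphistar)
  (hlin : op1 P (fun n w => Num.sqrt n.+1%:R *:
     (phi (empirical n (fun i => Z i w) : probability _ _) - phi F0
      - sample_mean n (fun i => Z i w) phistar))) :
  let W := hess_ell hd b a (phi F0) F0 in
  let Lambda :=
    mpinv W *m Emx F0 (fun z => gstar z *m (gstar z)^T) *m mpinv W in
  exists N : probability (_.-tuple R) R,
    is_normal0 N Lambda /\
    cvg_in_distribution P (fun n w => Num.sqrt n.+1%:R *: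
      (orthproj W *m
         (phi (empirical n (fun i => Z i w) : probability _ _) - phi F0))) N.
Proof.
move=> W Lambda.
have [Ophi _ _] := hphi _ hF0 hinv0.
have sW : W^T = W by exact: (hess_ell_sym Ophi (hmom _ hF0) hinv0).
have sM := mpinv_sym sW; have QE := orthproj_sym sW.
set M := mpinv W in Lambda sM QE *.
have [_ phi2 _ _] := hphistar; have [_ g2 g0 _] := hgstar.
have mphi j : measurable_fun setT (fun z => phistar z j ord0).
  by have := phi2 j ord0; rewrite inE => /andP[]; rewrite inE.
have mg j : measurable_fun setT (fun z => gstar z j ord0).
  by have := g2 j ord0; rewrite inE => /andP[]; rewrite inE.
have igg i j : F0.-integrable setT (EFin \o (fun z => (gstar z *m (gstar z)^T) i j)).
  have /Lfun1_integrable := Lfun2_mul_Lfun1 (g2 i ord0) (g2 j ord0).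
  by apply: eq_integrable => // z _; rewrite /= !mxE big_ord1 !mxE.
have ig j : F0.-integrable setT (EFin \o (fun z => gstar z j ord0)).
  apply: integrable_of_sqr => //; have := igg j j; apply: eq_integrable => // z _ /=.
  by rewrite mxE big_ord1 mxE expr2.
(* The influence function of the projected minimizer. *)
pose r z := - (M *m gstar z).
have rE z j : r z j ord0 = \sum_i (- M j i) * gstar z i ord0.
  by rewrite mxE mxE -sumrN; apply: eq_bigr => i _; rewrite mulNr.
have mr j : measurable_fun setT (fun z => r z j ord0).
  under eq_fun do rewrite rE.
  by apply: measurable_sum => i; exact: measurable_funM.
have r0 j : \int[F0]_z r z j ord0 = 0.
  under eq_Rintegral do rewrite rE.
  rewrite Rintegral_sum; last by move=> i; exact: integrableZlR.
  rewrite big1// => i _; rewrite (RintegralZl _ measurableT (ig i)) -EmxE g0 mxE mulr0//.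
have irr i j : F0.-integrable setT (EFin \o (fun z => (r z *m (r z)^T) i j)).
  rewrite (_ : (fun z => _) = fun z => \sum_l \sum_m (M i l * M j m) *
      (gstar z *m (gstar z)^T) l m); last first.
    apply/funext => z; rewrite mxE big_ord1 [X in _ * X]mxE !rE mulr_suml; apply: eq_bigr => l _.
    rewrite mulr_sumr; apply: eq_bigr => m _; rewrite mxE big_ord1 mxE; ring.
  by do 2 (apply: integrable_sumR => ?); exact: integrableZlR.
have LE (c : 'cV[R]_(nangles p d)) :
    (c^T *m Lambda *m c) ord0 ord0 = \int[F0]_z (c^T *m r z) ord0 ord0 ^+ 2.
  have -> : c^T *m Lambda *m c =
      (M *m c)^T *m Emx F0 (fun z => gstar z *m (gstar z)^T) *m (M *m c).
    by rewrite trmx_mul sM /Lambda !mulmxA.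
  rewrite gram_form//; apply: eq_Rintegral => z _.
  by rewrite /r mulmxN trmx_mul sM mulmxA [X in _ = X ^+ 2]mxE sqrrN.
have LT : Lambda^T = Lambda.
  by rewrite /Lambda !trmx_mul sM gram_sym mulmxA.
have [N hN] : exists N, is_normal0 N Lambda.
  apply: is_normal0_exists => // c; rewrite LE.
  by apply: Rintegral_ge0 => z _; exact: sqr_ge0.
exists N; split => //.
pose zeta n w := Num.sqrt n.+1%:R *: (phi (empirical n (fun i => Z i w) : probability _ _)
  - phi F0 - sample_mean n (fun i => Z i w) phistar).
have mZ i : measurable_fun setT (Z i : Omega -> obs R p) by exact: measurable_funPT.
have mzeta n j : measurable_fun setT (fun w => zeta n w j ord0).
  rewrite (_ : (fun w => _) = fun w => Num.sqrt n.+1%:R *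
    (phi (empirical n (fun i => Z i w) : probability _ _) j ord0 - phi F0 j ord0 -
     n.+1%:R^-1 * \sum_(i < n.+1) phistar (Z i w) j ord0)); last first.
    by apply/funext => w; rewrite !mxE summxE.
  apply: measurable_funM => //; apply: measurable_funB; first exact: measurable_funB.
  apply: measurable_funM => //; apply: measurable_sum => i.
  exact: (measurableT_comp (mphi j)).
have -> : (fun n w => Num.sqrt n.+1%:R *: (orthproj W *m
      (phi (empirical n (fun i => Z i w) : probability _ _) - phi F0))) =
    (fun n w => scaled_mean (fun i => Z i : Omega -> obs R p) r n w + orthproj W *m zeta n w).
  apply/funext => n; apply/funext => w.
  pose Fn : probability (obs R p) R := empirical n (fun i => Z i w).
  have lin := influence_linearization hconv hF0 (hemp n w) hmom hinv0 hphi hphistar hgstar.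
  (* The linearization at the empirical distribution, multiplied by [M]. *)
  have mean : sample_mean n (fun i => Z i w) r =
      orthproj W *m sample_mean n (fun i => Z i w) phistar.
    have -> : sample_mean n (fun i => Z i w) r =
        - (M *m sample_mean n (fun i => Z i w) gstar).
      by rewrite /sample_mean -scalemxAr mulmx_sumr -scalerN -sumrN.
    rewrite -!Emx_empirical// QE -mulmxA.
    by apply/eqP; rewrite eq_sym -subr_eq0 opprK -mulmxDr lin mulmx0.
  rewrite /scaled_mean mean -[X in _ = _ + X](scalemxAr (Num.sqrt n.+1%:R)) -scalerDr -mulmxDr.
  by congr (_ *: (_ *m _)); rewrite [RHS]addrC subrK.
apply: (central_limit_slutsky mZ hlaw hind mr irr r0 LE hN).
- move=> n j; under eq_fun do rewrite mxE.
  by apply: measurable_sum => i; exact: measurable_funM.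
- by move=> K K0; exact: op1_tail.
Qed.
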